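(* Let $R$ be a commutative ring and let $P$ be a balanced polytope. Then the natural homomorphism $\mathrm{St}(R,P)\to\mathbb{E}(R,P)$, $x_v^\lambda\mapsto e_v^\lambda$, makes $\mathrm{St}(R,P)$ a universal central extension of $\mathbb{E}(R,P)$, and $$\operatorname{Ker}\bigl(\mathrm{St}(R,P)\to\mathbb{E}(R,P)\bigr)=Z\bigl(\mathrm{St}(R,P)\bigr),$$ the center of $\mathrm{St}(R,P)$.
   Context: **Polytopes and column vectors.** All polytopes are convex lattice polytopes $P\subset\mathbb{R}^n$ (vertices in $\mathbb{Z}^n$), $L_P=P\cap\mathbb{Z}^n$. Standing assumption: $\dim P=n$ and $\mathbb{Z}^n$ is the smallest affine sublattice of $\mathbb{R}^n$ containing $L_P$ (otherwise replace $\mathbb{R}^n$, $\mathbb{Z}^n$ by the affine hull of $P$ and the affine lattice generated by $L_P$). For a facet $F$ of $P$, $\langle F,-\rangle:\mathbb{Z}^n\to\mathbb{Z}$ is the unique surjective group homomorphism that vanishes on differences of points of $\mathbb{Z}^n\cap\mathrm{Aff}(F)$ and whose minimum $b_F$ on $L_P$ is attained at the lattice points of $F$; put $\mathrm{ht}_F(x)=\langle F,x\rangle-b_F$. A vector $v\in\mathbb{Z}^n$, $v\ne0$, is a column vector of $P$ if there is a facet $F$ with $x+v\in P$ for all $x\in L_P\setminus F$; this $F$ is unique, called the base facet of $v$ and denoted $P_v$. $\mathrm{Col}(P)$ is the set of column vectors; it is assumed that the starting polytope $P$ has at least one column vector. For $u,v\in\mathrm{Col}(P)$ the product $uv$ exists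 if $u+v\neq0$ and $x+u\notin P_v$ for every $x\in L_P\setminus P_u$; then $uv:=u+v$. $P$ is balanced if $\langle P_u,v\rangle\le1$ for all $u,v\in\mathrm{Col}(P)$. **Elementary automorphisms.** $S_P\subset\mathbb{Z}^{n+1}$ is the additive semigroup generated by $\{(x,1):x\in L_P\}$, $R[P]=R[S_P]$ (semigroup algebra). Identify $x\in L_P$ with $(x,1)$ and $v\in\mathrm{Col}(P)$ with $(v,0)$. For $v\in \mathrm{Col}(P)$, $\lambda\in R$, $e_v^\lambda$ is the graded $R$-algebra automorphism of $R[P]$ with $x\mapsto(1+\lambda v)^{\mathrm{ht}_{P_v}(x)}x$ for $x\in L_P$ (the semigroup operation written multiplicatively). **Doubling.** Let $F$ be a facet of $P$, translated so that $0\in F$. Let $\rho:\mathbb{R}^n\to\mathbb{R}^{n+1}=\mathbb{R}^n\oplus\mathbb{R}$ be the linear isometric embedding that is the identity on the linear span of $F$ and sends the unit normal of $F$ pointing into $P$ to the last standard basis vector. Put $P^-=P$, $P^{|}=\rho(P)$, $P^{\square_F}=\mathrm{conv}(P\cup\rho(P))\subset\mathbb{R}^{n+1}$, a lattice polytope with respect to the lattice $\mathbb{Z}^n+\rho(\mathbb{Z}^n)$, which is renamed $\mathbb{Z}^{n+1}$. One has $\mathrm{Col}(P)\subset\mathrm{Col}(P^{\square_F})$. For $v\in\mathrm{Col}(P)$ write $P^{\square_v}=P^{\square_{P_v}}$. **Doubling spectra and stable groups.** A doubling spectrum is an infinite chain $\mathfrak{P}=(P=P_0\subset P_1\subset\cdots)$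 such that (i) for every $i\ge 0$ there is $v\in\mathrm{Col}(P_i)$ with $P_{i+1}=P_i^{\square_v}$; (ii) for every $i$ and $v\in\mathrm{Col}(P_i)$ there is $j\ge i$ with $P_{j+1}=P_j^{\square_v}$. Put $R[\mathfrak{P}]=\varinjlim R[P_i]$, $\mathrm{Col}(\mathfrak{P})=\bigcup_i\mathrm{Col}(P_i)$. For $v\in\mathrm{Col}(\mathfrak P)$ the $e_v^\lambda$ on $R[P_j]$, $j\gg0$, are compatible and define an automorphism $e_v^\lambda$ of $R[\mathfrak{P}]$. $\mathbb{E}(R,P)$ is the subgroup of $\mathrm{Aut}(R[\mathfrak{P}])$ generated by all these $e_v^\lambda$; it is independent of $\mathfrak{P}$ up to natural isomorphism. For $u,v\in\mathrm{Col}(\mathfrak{P})$ products are formed in $\mathrm{Col}(P_i)$, $i\gg0$, and $\langle\mathfrak{P}_v,u\rangle$ is the common value of $\langle (P_i)_v,u\rangle$ for $i$ with $u,v\in\mathrm{Col}(P_i)$. **Stable Steinberg group.** $\mathrm{St}(R,P)$ is the group generated by symbols $x_v^\lambda$ ($v\in\mathrm{Col}(\mathfrak{P})$, $\lambda\in R$) with relations $x_v^\lambda x_v^\mu=x_v^{\lambda+\mu}$ and, for $u+v\ne 0$, with $[a,b]=aba^{-1}b^{-1}$: $[x_u^\lambda,x_v^\mu]=\prod_{i=1}^n x_{u+iv}^{-\binom ni\lambda\mu^i}$ if $uv$ exists, $n=\langle\mathfrak P_v,u\rangle$; $=\prod_{i=1}^n x_{v+iu}^{\binom ni\mu\lambda^i}$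 if $vu$ exists, $n=\langle\mathfrak P_u,v\rangle$; $=1$ if $u+v\notin\mathrm{Col}(\mathfrak P)\cup\{0\}$. It is independent of the choice of $\mathfrak{P}$ up to isomorphism. (For balanced $P$ all these $n$ equal $1$.) *)

(* Defs.v *)
From HB Require Import structures.
From mathcomp Require Import all_boot all_order all_algebra.
From mathcomp Require Import boolp classical_sets functions reals.
From mathcomp Require Import finmap monalg.

Set Implicit Arguments.
Unset Strict Implicit.
Unset Printing Implicit Defensive.

Import Order.TTheory GRing.Theory Num.Theory.

Local Open Scope classical_set_scope.
Local Open Scope ring_scope.

Section Hulls.
Variables (K : numDomainType) (V : lmodType K).
Implicit Type A : set V.

Definition conv_hull A : set V := [set x | exists m (a : 'I_m -> K) (y : 'I_m -> V),
  [/\ forall i, 0 <= a i, \sum_i a i = 1, forall i, A (y i)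
    & x = \sum_i a i *: y i]].

(* For K = int this is the affine lattice generated by A. *)
Definition aff_hull A : set V := [set x | exists m (a : 'I_m -> K) (y : 'I_m -> V),
  [/\ \sum_i a i = 1, forall i, A (y i) & x = \sum_i a i *: y i]].

End Hulls.

Section Pad.
Variable T : zmodType.

Definition pad n (x : 'rV[T]_n) : nat -> T :=
  fun k => if insub k is Some j then x 0 j else 0.

Definition restr n (f : nat -> T) : 'rV[T]_n := \row_(j < n) f j.

Definition incl n (x : 'rV[T]_n) : 'rV[T]_n.+1 := restr n.+1 (pad x).

Lemma padK n : cancel (@pad n) (restr n).
Proof.
move=> x; apply/rowP => j; rewrite mxE /pad insubT // => lt_j.
by congr (x _ _); apply: val_inj.
Qed.

Lemma restrK n (f : nat -> T) :
  (forall k, (n <= k)%N -> f k = 0) -> pad (restr n f) = f.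
Proof.
move=> f0; apply/funext => k; rewrite /pad; case: insubP => [j _ <-|].
  by rewrite mxE.
by rewrite -leqNgt => /f0.
Qed.

Lemma pad_out n (x : 'rV[T]_n) k : (n <= k)%N -> pad x k = 0.
Proof. by move=> le_nk; rewrite /pad insubF // ltnNge le_nk. Qed.

Lemma pad_incl n (x : 'rV[T]_n) : pad (incl x) = pad x.
Proof. by apply: restrK => k /ltnW; apply: pad_out. Qed.

Lemma padD n (x y : 'rV[T]_n) : pad (x + y) = pad x + pad y.
Proof.
apply/funext => k; rewrite fctE /pad; case: insubP => [j _ _|_].
  by rewrite mxE.
by rewrite addr0.
Qed.

Lemma pad0 n : pad (0 : 'rV[T]_n) = 0.
Proof. by apply/funext => k; rewrite /pad; case: insubP => // j; rewrite mxE. Qed.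

End Pad.

Section Polytopes.
Variable Rr : realType.

Definition latpt n (z : 'rV[int]_n) : 'rV[Rr]_n := map_mx intr z.

Section Dim.
Variable n : nat.
Implicit Types (A P F : set 'rV[Rr]_n) (x y : 'rV[Rr]_n) (u v z : 'rV[int]_n).

Definition has_dim A (d : nat) := exists (x0 : 'rV[Rr]_n) (B : 'M[Rr]_(d, n)),
  row_free B /\ aff_hull A = [set x | (x - x0 <= B)%MS].

Definition lattice_polytope P :=
  exists s : seq 'rV[int]_n, P = conv_hull [set latpt z | z in [set` s]].

Definition latpts P : set 'rV[int]_n := [set z | P (latpt z)].

(* A general lattice polytope satisfies the last two conditions in its affine
   hull, with respect to the affine lattice generated by its lattice points. *)
Definition full_lattice_polytope P :=
  [/\ lattice_polytope P, has_dim P n & aff_hull (latpts P) = setT].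

Definition facet P F := exists (c : 'cV[Rr]_n) (b : Rr),
  [/\ forall x, P x -> b <= (x *m c) 0 0,
      F = [set x | P x /\ (x *m c) 0 0 = b]
    & exists2 d, n = d.+1 & has_dim F d].

(* Homomorphisms Z^n -> Z are given by column vectors. *)
Definition is_facet_form P F (f : 'cV[int]_n) :=
  [/\ forall k : int, exists z, (z *m f) 0 0 = k,
      forall u v, aff_hull F (latpt u) -> aff_hull F (latpt v) ->
        ((u - v) *m f) 0 0 = 0
    & forall u v, latpts P u -> F (latpt u) -> latpts P v ->
        (u *m f) 0 0 <= (v *m f) 0 0].

Definition facet_form P F z : int :=
  (z *m xget 0 (is_facet_form P F)) 0 0.

Definition facet_min P F : int := xget 0 [set b |
  (exists2 z, latpts P z & facet_form P F z = b) /\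
  (forall z, latpts P z -> b <= facet_form P F z)].

Definition ht P F z : int := facet_form P F z - facet_min P F.

Definition is_base_facet P v F :=
  facet P F /\ forall z, latpts P z -> ~ F (latpt z) -> P (latpt (z + v)).

Definition Col P : set 'rV[int]_n :=
  [set v | v <> 0 /\ exists F, is_base_facet P v F].

Definition base_facet P v : set 'rV[Rr]_n := xget set0 (is_base_facet P v).

Definition prod_exists P u v := u + v <> 0 /\
  forall z, latpts P z -> ~ base_facet P u (latpt z) ->
    ~ base_facet P v (latpt (z + u)).

Definition balanced P :=
  forall u v, Col P u -> Col P v -> facet_form P (base_facet P u) v <= 1.

End Dim.

(* [rho] is the linear part of the embedding of P as P^| when the origin is
   moved to the lattice point [x0] of F. The automorphism [phi] of R^(n+1) is
   the renaming of the lattice Z^n + rho(Z^n) as Z^(n+1); it is required to fix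
   R^n pointwise, so that P = P^- is a subset of Q. *)
Definition is_doubling n (P F : set 'rV[Rr]_n) (Q : set 'rV[Rr]_n.+1) :=
  exists (x0 : 'rV[int]_n) (nu : 'rV[Rr]_n)
         (rho : 'M[Rr]_(n, n.+1)) (phi : 'M[Rr]_n.+1),
  [/\ F (latpt x0),
      [/\ nu *m nu^T = 1%:M,
          forall x, F x -> (x - latpt x0) *m nu^T = 0
        & forall x, P x -> 0 <= ((x - latpt x0) *m nu^T) 0 0],
      [/\ rho *m rho^T = 1%:M,
          forall x, F x -> (x - latpt x0) *m rho = incl (x - latpt x0)
        & nu *m rho = delta_mx 0 ord_max],
      [/\ phi \in unitmx,
          forall x : 'rV[Rr]_n, incl x *m phi = incl x
        & [set (incl (latpt z.1) + latpt z.2 *m rho) *m phi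
            | z in [set: 'rV[int]_n * 'rV[int]_n]]
          = [set latpt z | z in [set: 'rV[int]_n.+1]]]
    & Q = [set y *m phi | y in conv_hull (
            [set incl x | x in P] `|`
            [set incl (latpt x0) + (x - latpt x0) *m rho | x in P])]].

(* P_i lies in R^(i + n), with (i.+1 + n) convertible to (i + n).+1. *)
Unset Implicit Arguments.
Record doubling_spectrum n (P : set 'rV[Rr]_n) := DoublingSpectrum {
  stage :> forall i, set 'rV[Rr]_(i + n);
  stage0 : stage 0 = P;
  stageS : forall i, exists2 v, Col (stage i) v &
    is_doubling (stage i) (base_facet (stage i) v) (stage i.+1);
  stage_all : forall i v, Col (stage i) v -> exists2 j, (i <= j)%N &
    is_doubling (stage j)
      (base_facet (stage j) (restr (j + n) (pad v))) (stage j.+1)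
}.

Set Implicit Arguments.

Lemma latpt_incl n (z : 'rV[int]_n) : latpt (incl z) = incl (latpt z).
Proof.
apply/rowP => j; rewrite !mxE /pad.
by case: insubP => [k _ _|_]; rewrite ?mxE.
Qed.

Lemma latpts_doubling n (P F : set 'rV[Rr]_n) Q (z : 'rV[int]_n) :
  is_doubling P F Q -> latpts P z -> latpts Q (incl z).
Proof.
move=> [x0 [nu [rho [phi [_ _ _ [_ phi_incl _] ->]]]]] Pz.
exists (incl (latpt z)); last by rewrite phi_incl latpt_incl.
exists 1%N, (fun=> 1), (fun=> incl (latpt z)); split=> //.
- by rewrite big_ord1.
- by move=> _; left; exists (latpt z).
- by rewrite big_ord1 scale1r.
Qed.

End Polytopes.

Arguments doubling_spectrum {Rr n} P.
Arguments stage {Rr n P} _ i.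
Arguments stageS {Rr n P} _ i.
Arguments stage_all {Rr n P} _ i.

(* The algebra R[M] of a commutative monoid M, written additively. The product
   of {malg R[K]} is only available for nonzero R, and only for K without
   nontrivial invertible elements, hence not for lattices. *)
Definition monoid_alg (R : comPzRingType) (M : nmodType) : Type := {malg R[M]}.

Section MonoidAlg.
Variables (R : comPzRingType) (M : nmodType).
Local Notation A := (monoid_alg R M).
Implicit Types (g h : A) (m : M) (c : R).

HB.instance Definition _ := GRing.Zmodule.on A.

Definition mon m : A := << 1 *g m >>.

Definition ma_scale c g : A := \sum_(k <- msupp g) << c * g@_k *g k >>.

Definition ma_mul g h : A :=
  \sum_(k <- msupp g) \sum_(l <- msupp h) << g@_k * h@_l *g (k + l)%R >>.

Lemma ma_scaleE c g k : (ma_scale c g)@_k = c * g@_k.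
Proof.
rewrite {2}[g]monalgE !raddf_sum mulr_sumr.
by apply/eq_bigr=> /= i _; rewrite !mcoeffU mulrnAr.
Qed.

Lemma ma_scaleA c1 c2 g : ma_scale c1 (ma_scale c2 g) = ma_scale (c1 * c2) g.
Proof. by apply/malgP=> x; rewrite !ma_scaleE mulrA. Qed.

Lemma ma_scale1 : left_id 1 ma_scale.
Proof. by move=> g; apply/malgP=> k; rewrite !ma_scaleE mul1r. Qed.

Lemma ma_scaleDr : right_distributive ma_scale +%R.
Proof. by move=> c g h; apply/malgP=> k; rewrite !(mcoeffD, ma_scaleE) mulrDr. Qed.

Lemma ma_scaleDl g : {morph ma_scale^~ g : c1 c2 / c1 + c2}.
Proof. by move=> c1 c2; apply/malgP=> x; rewrite !(mcoeffD, ma_scaleE) mulrDl. Qed.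

HB.instance Definition _ := GRing.Zmodule_isLmodule.Build R A
  ma_scaleA ma_scale1 ma_scaleDr ma_scaleDl.

Lemma monE g : g = \sum_(k <- msupp g) (<< g@_k *g k >> : A).
Proof. exact: monalgE. Qed.

Lemma ma_mulw (d1 d2 : {fset M}) g h : (msupp g `<=` d1)%fset ->
  (msupp h `<=` d2)%fset ->
  ma_mul g h = \sum_(k <- d1) \sum_(l <- d2) << g@_k * h@_l *g (k + l)%R >>.
Proof.
move=> le_d1 le_d2; rewrite /ma_mul (big_fset_incl _ le_d1) /=.
  apply/eq_bigr=> k1 _; apply/big_fset_incl => // k _ /mcoeff_outdom ->.
  by rewrite mulr0 monalgU0.
move=> k _ /mcoeff_outdom g1k.
by rewrite big1 => // k' _; rewrite g1k mul0r monalgU0.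
Qed.

Lemma ma_mulC : commutative ma_mul.
Proof.
move=> g h; rewrite /ma_mul exchange_big; apply: eq_bigr => k _.
by apply: eq_bigr => l _; rewrite mulrC addrC.
Qed.

Lemma ma_mul0 : left_zero 0 ma_mul.
Proof. by move=> g; rewrite /ma_mul msupp0 big_seq_fset0. Qed.

Lemma ma_mulDl : left_distributive ma_mul +%R.
Proof.
move=> g1 g2 g.
rewrite (ma_mulw (msuppD_le g1 g2) (fsubset_refl _)).
rewrite (ma_mulw (fsubsetUl _ (msupp g2)) (fsubset_refl _)).
rewrite (ma_mulw (fsubsetUr (msupp g1) _) (fsubset_refl _)).
rewrite -big_split /=; apply/eq_bigr=> k1 _.
rewrite -big_split /=; apply/eq_bigr=> k2 _.
by rewrite mcoeffD mulrDl monalgUD.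
Qed.

Lemma ma_mulUU c1 c2 m1 m2 :
  ma_mul << c1 *g m1 >> << c2 *g m2 >> = << c1 * c2 *g (m1 + m2)%R >>.
Proof. by rewrite (ma_mulw msuppU_le msuppU_le) !big_seq_fset1 !mcoeffUU. Qed.

Lemma ma_mul_suml (I : Type) (s : seq I) (E : I -> A) h :
  ma_mul (\sum_(i <- s) E i) h = \sum_(i <- s) ma_mul (E i) h.
Proof. exact: (big_morph (ma_mul^~ h) (fun _ _ => ma_mulDl _ _ _) (ma_mul0 h)). Qed.

Lemma ma_mul_sumr (I : Type) (s : seq I) (E : I -> A) h :
  ma_mul h (\sum_(i <- s) E i) = \sum_(i <- s) ma_mul h (E i).
Proof. by rewrite ma_mulC ma_mul_suml; apply: eq_bigr => i _; rewrite ma_mulC. Qed.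

Lemma ma_mul1 : left_id (mon 0) ma_mul.
Proof.
move=> g; rewrite [in LHS](monE g) ma_mul_sumr [RHS]monE.
by apply: eq_bigr => k _; rewrite ma_mulUU mul1r add0r.
Qed.

Lemma ma_mulA : associative ma_mul.
Proof.
move=> g1 g2 g3; rewrite (monE g1) !ma_mul_suml; apply: eq_bigr => k1 _.
rewrite (monE g2) ma_mul_suml !ma_mul_sumr ma_mul_suml; apply: eq_bigr => k2 _.
rewrite (monE g3) !ma_mul_sumr; apply: eq_bigr => k3 _.
by rewrite !ma_mulUU mulrA addrA.
Qed.

HB.instance Definition _ := GRing.Zmodule_isComPzRing.Build A
  ma_mulA ma_mulC ma_mul1 ma_mulDl.

Lemma monD m1 m2 : mon (m1 + m2) = mon m1 * mon m2.
Proof. by rewrite /mon [RHS]ma_mulUU mulr1. Qed.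

Lemma mon0 : mon 0 = 1. Proof. by []. Qed.

Lemma scale_mmull c g h : c *: (g * h) = (c *: g) * h.
Proof.
have scU a m : c *: (<< a *g m >> : A) = << c * a *g m >>.
  by apply/malgP => k; rewrite ma_scaleE !mcoeffU mulrnAr.
have scsum (I : Type) (s : seq I) (E : I -> A) :
    c *: (\sum_(i <- s) E i) = \sum_(i <- s) c *: E i.
  exact: scaler_sumr.
have mE (x y : A) : x * y = ma_mul x y by [].
rewrite !mE (monE g) ma_mul_suml !scsum ma_mul_suml; apply: eq_bigr => k _.
rewrite (monE h) !ma_mul_sumr scsum; apply: eq_bigr => l _.
by rewrite scU !ma_mulUU scU mulrA.
Qed.

End MonoidAlg.

Section StableAlgebra.
Variables (Rr : realType) (n : nat) (P : set 'rV[Rr]_n).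
Variable PP : doubling_spectrum P.
Variable R : comPzRingType.

(* The union of the lattices Z^(i + n) sits inside the lattice of integer
   sequences, by padding with zeros. *)
Local Notation lat := (nat -> int).

(* The additive semigroup, with 0, generated by A. *)
Definition semigroup_gen (M : nmodType) (A : set M) : set M :=
  [set m | exists s : seq M, (forall x, x \in s -> A x) /\ m = \sum_(x <- s) x].

Definition SP m (Q : set 'rV[Rr]_m) : set ('rV[int]_m * int) :=
  semigroup_gen [set (z, 1) | z in latpts Q].

Definition stageSP i : set (lat * int) := [set (pad z.1, z.2) | z in SP (PP i)].

Lemma stageSP0 i : stageSP i 0.
Proof.
exists (0, 0); last by rewrite /= pad0.
by exists [::]; split=> //; rewrite big_nil.
Qed.

Lemma stageSPD i x y : stageSP i x -> stageSP i y -> stageSP i (x + y).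
Proof.
move=> [_ [s [sP ->]] <-] [_ [t [tP ->]] <-].
exists (\sum_(z <- s) z + \sum_(z <- t) z); last by rewrite padD.
exists (s ++ t); split; last by rewrite big_cat.
by move=> z; rewrite mem_cat => /orP[/sP|/tP].
Qed.

Lemma stageSP_le i j : (i <= j)%N -> stageSP i `<=` stageSP j.
Proof.
elim: j => [|j IHj]; first by rewrite leqn0 => /eqP ->.
rewrite leq_eqVlt => /predU1P[-> //|/IHj le_ij]; apply: (subset_trans le_ij).
move=> _ [_ [s [sP ->]] <-].
have [v _ dbl] := stageS PP j.
pose f (z : 'rV[int]_(j + n) * int) := (incl z.1, z.2).
exists (\sum_(z <- s) f z).
  exists (map f s); split; last by rewrite big_map.
  move=> _ /mapP[z /sP [w Pw <-] ->]; exists (incl w) => //.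
  exact: latpts_doubling dbl Pw.
have sumE : (\sum_(z <- s) f z).1 = incl (\sum_(z <- s) z).1
         /\ (\sum_(z <- s) f z).2 = (\sum_(z <- s) z).2.
  elim: s {sP} => [|z s [IH1 IH2]].
    rewrite !big_nil; split=> //=; apply: (can_inj (@padK _ _)).
    by rewrite pad_incl !pad0.
  rewrite !big_cons /= IH1 IH2; split=> //; apply: (can_inj (@padK _ _)).
  by rewrite !(padD, pad_incl).
by case: sumE => -> ->; rewrite pad_incl.
Qed.

(* All the R[P_i] are subalgebras of the group algebra of lat * int, and
   the direct limit is their union. *)
Local Notation GA := (monoid_alg R (lat * int)%type).

Definition stage_alg i : set GA := [set a | forall m, a@_m <> 0 -> stageSP i m].

Definition in_stable_alg : {pred GA} := fun a => `[< exists i, stage_alg i a >].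

Lemma stage_alg_le i j : (i <= j)%N -> stage_alg i `<=` stage_alg j.
Proof. by move=> le_ij a ai m /ai; apply: stageSP_le. Qed.

Lemma stage_algM i a b : stage_alg i a -> stage_alg i b -> stage_alg i (a * b).
Proof.
move=> ai bi m abm; apply: contrapT => nm; apply: abm.
have -> : (a * b)@_m = (ma_mul a b)@_m by [].
rewrite /ma_mul raddf_sum /= big_seq big1 // => k ka.
rewrite raddf_sum /= big_seq big1 // => l lb.
rewrite mcoeffU; case: eqP => // klm; case: nm; rewrite -klm.
apply: stageSPD; [apply: ai|apply: bi]; apply/eqP.
  by rewrite mcoeff_neq0.
by rewrite mcoeff_neq0.
Qed.

Lemma stage_algB i a b : stage_alg i a -> stage_alg i b -> stage_alg i (a - b).
Proof.
move=> ai bi m; have [am|/ai //] := pselect (a@_m = 0).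
have -> : (a - b)@_m = a@_m - b@_m by exact: mcoeffB.
by rewrite am sub0r => bm; apply: bi => b0; apply: bm; rewrite b0 oppr0.
Qed.

Lemma stage_alg1 i : stage_alg i 1.
Proof.
move=> m; have -> : (1 : GA)@_m = (1 *+ (0 == m)) by exact: mcoeffU.
by case: eqP => // <- _; apply: stageSP0.
Qed.

Lemma stage_algZ i c a : stage_alg i a -> stage_alg i (c *: a).
Proof.
move=> ai m; have -> : (c *: a)@_m = c * a@_m by exact: ma_scaleE.
by move=> cam; apply: ai => am; apply: cam; rewrite am mulr0.
Qed.

Lemma in_stable_alg2 a b : a \in in_stable_alg -> b \in in_stable_alg ->
  exists2 i, stage_alg i a & stage_alg i b.
Proof.
move=> /asboolP[i ai] /asboolP[j bj]; exists (maxn i j).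
  exact: stage_alg_le (leq_maxl _ _) _ ai.
exact: stage_alg_le (leq_maxr _ _) _ bj.
Qed.

Lemma in_stable_alg_subring : subring_closed in_stable_alg.
Proof.
split=> [|a b aA bA|a b aA bA]; apply/asboolP.
- by exists 0%N; apply: stage_alg1.
- by have [i ai bi] := in_stable_alg2 aA bA; exists i; apply: stage_algB.
- by have [i ai bi] := in_stable_alg2 aA bA; exists i; apply: stage_algM.
Qed.

HB.instance Definition _ :=
  GRing.isSubringClosed.Build GA in_stable_alg in_stable_alg_subring.

Lemma in_stable_alg_scale : GRing.scaler_closed in_stable_alg.
Proof.
by move=> c a /asboolP[i ai]; apply/asboolP; exists i; apply: stage_algZ.
Qed.

Lemma in_stable_alg_submod : submod_closed in_stable_alg.
Proof.
have [_ dB _] := in_stable_alg_subring; split=> [|c a b aA bA].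
  by rewrite -(subrr 1) dB // rpred1.
by rewrite -(opprK b) rpredB ?in_stable_alg_scale // rpredN.
Qed.

Record stable_alg := StableAlg {
  stable_val : GA;
  stable_valP : stable_val \in in_stable_alg }.

HB.instance Definition _ := [isSub for stable_val].
HB.instance Definition _ := [Choice of stable_alg by <:].
HB.instance Definition _ :=
  GRing.SubChoice_isSubComPzRing.Build GA _ stable_alg in_stable_alg_subring.
HB.instance Definition _ :=
  GRing.SubZmodule_isSubLmodule.Build R GA _ stable_alg in_stable_alg_submod.

Definition is_alg_aut (f : stable_alg -> stable_alg) :=
  [/\ bijective f, {morph f : a b / a + b}, {morph f : a b / a * b}, f 1 = 1
    & forall c, {morph f : a / c *: a}].

Record alg_aut := AlgAut {
  alg_aut_fun :> stable_alg -> stable_alg;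
  alg_autP : `[< is_alg_aut alg_aut_fun >] }.

HB.instance Definition _ := [isSub for alg_aut_fun].
HB.instance Definition _ := [Choice of alg_aut by <:].

Lemma alg_aut_ext (f g : alg_aut) : f =1 g -> f = g.
Proof. by move=> fg; apply: val_inj; apply/funext. Qed.

Lemma alg_aut_id_subproof : `[< is_alg_aut idfun >].
Proof. by apply/asboolP; split=> //; exists id. Qed.
Definition alg_aut_id := AlgAut alg_aut_id_subproof.

Lemma alg_aut_comp_subproof (f g : alg_aut) : `[< is_alg_aut (f \o g) >].
Proof.
have /asboolP[fb fD fM f1 fZ] := alg_autP f.
have /asboolP[gb gD gM g1 gZ] := alg_autP g.
apply/asboolP; split=> /=.
- exact: bij_comp.
- by move=> a b /=; rewrite gD fD.
- by move=> a b /=; rewrite gM fM.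
- by rewrite g1 f1.
- by move=> c a /=; rewrite gZ fZ.
Qed.
(* The product f * g is x |-> f (g x). *)
Definition alg_aut_comp (f g : alg_aut) := AlgAut (alg_aut_comp_subproof f g).

Lemma alg_aut_inv_ex (f : alg_aut) :
  {g : alg_aut | cancel f g /\ cancel g f}.
Proof.
apply: cid; have /asboolP[[g fK gK] fD fM f1 fZ] := alg_autP f.
have gP : `[< is_alg_aut g >].
  apply/asboolP; split.
  - by exists f.
  - by move=> a b; apply: (can_inj fK); rewrite fD !gK.
  - by move=> a b; apply: (can_inj fK); rewrite fM !gK.
  - by apply: (can_inj fK); rewrite f1 gK.
  - by move=> c a; apply: (can_inj fK); rewrite fZ !gK.
by exists (AlgAut gP).
Qed.
Definition alg_aut_inv (f : alg_aut) := sval (alg_aut_inv_ex f).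

Lemma alg_autK (f : alg_aut) : cancel f (alg_aut_inv f).
Proof. by rewrite /alg_aut_inv; case: alg_aut_inv_ex => g []. Qed.

Lemma alg_autVK (f : alg_aut) : cancel (alg_aut_inv f) f.
Proof. by rewrite /alg_aut_inv; case: alg_aut_inv_ex => g []. Qed.

Lemma alg_aut_compA : associative alg_aut_comp.
Proof. by move=> f g h; apply: alg_aut_ext. Qed.
Lemma alg_aut_comp1f : left_id alg_aut_id alg_aut_comp.
Proof. by move=> f; apply: alg_aut_ext. Qed.
Lemma alg_aut_compf1 : right_id alg_aut_id alg_aut_comp.
Proof. by move=> f; apply: alg_aut_ext. Qed.
Lemma alg_aut_compVf : left_inverse alg_aut_id alg_aut_inv alg_aut_comp.
Proof. by move=> f; apply: alg_aut_ext => a /=; rewrite alg_autK. Qed.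
Lemma alg_aut_compfV : right_inverse alg_aut_id alg_aut_inv alg_aut_comp.
Proof. by move=> f; apply: alg_aut_ext => a /=; rewrite alg_autVK. Qed.

HB.instance Definition _ := isGroup.Build alg_aut
  alg_aut_compA alg_aut_comp1f alg_aut_compf1 alg_aut_compVf alg_aut_compfV.

End StableAlgebra.

Section GeneratedSubgroup.
Variables (G : groupType) (A : set G).
Local Open Scope group_scope.

Definition is_subgroup (H : set G) :=
  [/\ H 1, forall x y, H x -> H y -> H (x * y) & forall x, H x -> H x^-1].

Definition in_gen : {pred G} := fun g =>
  `[< forall H : set G, is_subgroup H -> A `<=` H -> H g >].

Lemma in_gen_closed : group_closed in_gen.
Proof.
split=> [|x y /asboolP xA /asboolP yA]; apply/asboolP => H HG AH.
  by case: HG.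
have [_ HM HV] := HG.
by apply: HM; [exact: xA|apply: HV; exact: yA].
Qed.

Record gen_subgroup := GenSubgroup {
  gen_val : G;
  gen_valP : gen_val \in in_gen }.

HB.instance Definition _ := [isSub for gen_val].
HB.instance Definition _ := [Choice of gen_subgroup by <:].
HB.instance Definition _ :=
  SubChoice_isSubGroup.Build G _ gen_subgroup in_gen_closed.

End GeneratedSubgroup.

Inductive gterm (X : Type) :=
| Tgen of X
| Tone
| Tmul of gterm X & gterm X
| Tinv of gterm X.
Arguments Tone {X}.

HB.instance Definition _ X := gen_eqMixin (gterm X).
HB.instance Definition _ X := gen_choiceMixin (gterm X).

Section Presentation.
Variables (X : Type) (relator : gterm X -> gterm X -> Prop).

Inductive gterm_eq : gterm X -> gterm X -> Prop :=
| Erel s t : relator s t -> gterm_eq s t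
| Erefl s : gterm_eq s s
| Esym s t : gterm_eq s t -> gterm_eq t s
| Etrans s t u : gterm_eq s t -> gterm_eq t u -> gterm_eq s u
| Emul s s' t t' : gterm_eq s s' -> gterm_eq t t' ->
    gterm_eq (Tmul s t) (Tmul s' t')
| Einv s s' : gterm_eq s s' -> gterm_eq (Tinv s) (Tinv s')
| EmulA s t u : gterm_eq (Tmul s (Tmul t u)) (Tmul (Tmul s t) u)
| Emul1 s : gterm_eq (Tmul Tone s) s
| EmulV s : gterm_eq (Tmul (Tinv s) s) Tone.

Definition gterm_eqb : rel (gterm X) := fun s t => `[< gterm_eq s t >].

Lemma gterm_eqb_refl : reflexive gterm_eqb.
Proof. by move=> s; apply/asboolP/Erefl. Qed.
Lemma gterm_eqb_sym : symmetric gterm_eqb.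
Proof. by move=> s t; apply/asboolP/asboolP; apply: Esym. Qed.
Lemma gterm_eqb_trans : transitive gterm_eqb.
Proof. by move=> t s u /asboolP st /asboolP tu; apply/asboolP/(Etrans st tu). Qed.

Canonical gterm_equiv :=
  EquivRel gterm_eqb gterm_eqb_refl gterm_eqb_sym gterm_eqb_trans.

Local Open Scope quotient_scope.

(* The group with generators X and relations s = t, for relator s t. *)
Definition pres_group := {eq_quot gterm_equiv}.

Local Notation Q := {eq_quot gterm_equiv}.

HB.instance Definition _ := Choice.on pres_group.

Definition pres_class (s : gterm X) : pres_group := \pi_Q s.

Lemma pres_classP s t : pres_class s = pres_class t <-> gterm_eq s t.
Proof.
split=> [/eqmodP/asboolP //|st].
by apply/eqmodP/asboolP.
Qed.

Lemma pres_class_repr (a : pres_group) :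
  pres_class (repr (a : Q)) = a.
Proof. exact: reprK. Qed.

Lemma repr_pres_class s : gterm_eq (repr (pres_class s : Q)) s.
Proof. by apply/pres_classP; rewrite pres_class_repr. Qed.

Definition pres_mul (a b : pres_group) : pres_group :=
  pres_class (Tmul (repr (a : Q)) (repr (b : Q))).
Definition pres_inv (a : pres_group) : pres_group :=
  pres_class (Tinv (repr (a : Q))).

Lemma pres_classM s t :
  pres_class (Tmul s t) = pres_mul (pres_class s) (pres_class t).
Proof. by apply/pres_classP/Esym/Emul; apply: repr_pres_class. Qed.

Lemma pres_classV s : pres_class (Tinv s) = pres_inv (pres_class s).
Proof. by apply/pres_classP/Esym/Einv; apply: repr_pres_class. Qed.

Lemma pres_ind (K : pres_group -> Prop) :
  (forall s, K (pres_class s)) -> forall a, K a.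
Proof. by move=> Kc a; rewrite -(pres_class_repr a). Qed.

Lemma pres_mulA : associative pres_mul.
Proof.
move=> a b c; elim/pres_ind: a => s; elim/pres_ind: b => t.
elim/pres_ind: c => u; rewrite -!pres_classM; exact/pres_classP/EmulA.
Qed.

Lemma pres_mul1 : left_id (pres_class Tone) pres_mul.
Proof. by elim/pres_ind => s; rewrite -pres_classM; apply/pres_classP/Emul1. Qed.

Lemma pres_mulV : left_inverse (pres_class Tone) pres_inv pres_mul.
Proof.
elim/pres_ind => s; rewrite -pres_classV -pres_classM.
exact/pres_classP/EmulV.
Qed.

Lemma pres_mulgV : right_inverse (pres_class Tone) pres_inv pres_mul.
Proof.
move=> a; rewrite -[LHS]pres_mul1 -(pres_mulV (pres_inv a)) -pres_mulA.
by rewrite (pres_mulA (pres_inv a)) pres_mulV pres_mul1.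
Qed.

Lemma pres_mulg1 : right_id (pres_class Tone) pres_mul.
Proof. by move=> a; rewrite -(pres_mulV a) pres_mulA pres_mulgV pres_mul1. Qed.

HB.instance Definition _ := isGroup.Build pres_group
  pres_mulA pres_mul1 pres_mulg1 pres_mulV pres_mulgV.

Definition pres_gen (x : X) : pres_group := pres_class (Tgen x).

Local Open Scope group_scope.

Fixpoint gterm_eval (H : groupType) (f : X -> H) (s : gterm X) : H :=
  match s with
  | Tgen x => f x
  | Tone => 1
  | Tmul s t => gterm_eval f s * gterm_eval f t
  | Tinv s => (gterm_eval f s)^-1
  end.

Lemma gterm_eval_pres s : gterm_eval pres_gen s = pres_class s.
Proof.
elim: s => //= [s -> t ->|s ->]; first by rewrite pres_classM.
by rewrite pres_classV.
Qed.

Lemma pres_rel s t :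
  relator s t -> gterm_eval pres_gen s = gterm_eval pres_gen t.
Proof. by move=> st; rewrite !gterm_eval_pres; apply/pres_classP/Erel. Qed.

Lemma pres_lift (H : groupType) (f : X -> H) :
  (forall s t, relator s t -> gterm_eval f s = gterm_eval f t) ->
  exists phi : {multiplicative pres_group -> H},
    forall x, phi (pres_gen x) = f x.
Proof.
move=> fR.
have feq s t : gterm_eq s t -> gterm_eval f s = gterm_eval f t.
  elim=> {s t} /=.
  - by move=> s t /fR.
  - by [].
  - by move=> s t _ ->.
  - by move=> s t u _ -> _ ->.
  - by move=> s s' t t' _ -> _ ->.
  - by move=> s s' _ ->.
  - by move=> s t u; rewrite mulgA.
  - by move=> s; rewrite mul1g.
  - by move=> s; rewrite mulVg.
pose phi (a : pres_group) := gterm_eval f (repr (a : Q)).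
have phiE s : phi (pres_class s) = gterm_eval f s.
  exact/feq/repr_pres_class.
have phiM : {morph phi : a b / a * b}.
  move=> a b; elim/pres_ind: a => s; elim/pres_ind: b => t.
  by rewrite -[_ * _]pres_classM !phiE.
pose mphi :=
  monoid.isMultiplicative.Build (pres_group : groupType) H phi phiM.
exists (HB.pack_for {multiplicative pres_group -> H} phi mphi) => x.
exact: phiE.
Qed.

End Presentation.

Section CentralExtensions.
Local Open Scope group_scope.

Definition center (G : groupType) : set G := [set z | forall g, commute z g].
#[global] Arguments center G : clear implicits.

Definition kernel (G E : groupType) (f : G -> E) : set G := [set g | f g = 1].

Definition central_extension (G E : groupType) (pi : {multiplicative G -> E}) :=
  (forall e, exists g, pi g = e) /\ kernel pi `<=` center G.

Definition universal_central_extension (G E : groupType)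
    (pi : {multiplicative G -> E}) :=
  central_extension pi /\
  forall (H : groupType) (rho : {multiplicative H -> E}),
    central_extension rho ->
    exists2 f : {multiplicative G -> H}, (forall g, rho (f g) = pi g) &
      forall f' : {multiplicative G -> H},
        (forall g, rho (f' g) = pi g) -> f' =1 f.

End CentralExtensions.

Section Stable.
Variables (Rr : realType) (n : nat) (P : set 'rV[Rr]_n).
Variable PP : doubling_spectrum P.
Variable R : comPzRingType.
Local Notation lat := (nat -> int).

Definition stable_col (w : lat) : Prop :=
  exists i (v : 'rV[int]_(i + n)), Col (PP i) v /\ w = pad v.

Record Col_stable := ColStable { col_val :> lat; col_valP : stable_col col_val }.

Implicit Types (u v : Col_stable) (lam mu : R).

(* "i >> 0": vectors of Col(PP) are truncated to their first i + n
   coordinates, which loses nothing once i is large. *)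
Definition stable_prod_exists u v := exists i0, forall i, (i0 <= i)%N ->
  prod_exists (PP i) (restr (i + n) u) (restr (i + n) v).

(* N is the common value of the <(P_i)_v, u>. *)
Definition stable_form v u (N : nat) := forall i (v' u' : 'rV[int]_(i + n)),
  Col (PP i) v' -> Col (PP i) u' -> pad v' = v -> pad u' = u ->
  facet_form (PP i) (base_facet (PP i) v') u' = N%:Z.

(* Says that phi is e_v^lam. The factor (1 + lam v)^ht does not belong to
   R[PP], so the equation is written in the ambient group algebra. *)
Definition is_elementary v lam (phi : stable_alg PP R -> stable_alg PP R) :=
  exists i0, forall i, (i0 <= i)%N ->
  forall (x : 'rV[int]_(i + n)) (a : stable_alg PP R),
    latpts (PP i) x -> val a = mon R (pad x, 1) ->
    val (phi a) =
      (1 + lam *: mon R ((v : lat), 0)) ^+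
        `|ht (PP i) (base_facet (PP i) (restr (i + n) v)) x|%N
      * mon R (pad x, 1).

Definition stable_E := gen_subgroup
  [set phi : alg_aut PP R | exists v lam, is_elementary v lam phi].

Local Notation st_term := (gterm (Col_stable * R)).
Local Notation "'x_[' v , lam ]" := (Tgen (v, lam) : st_term).
Local Notation "s ** t" := (Tmul s t) (at level 40, left associativity).

(* [s, t] = s t s^-1 t^-1, unlike [~ s, t] in the library. *)
Definition Tcomm (s t : st_term) := s ** t ** Tinv s ** Tinv t.

Definition Tprod N (F : nat -> st_term) : st_term :=
  \big[@Tmul _ / Tone]_(1 <= i < N.+1) F i.

(* The vectors w i are those of the symbols on the right-hand side, given as
   elements of Col(PP). *)
Inductive steinberg_rel : st_term -> st_term -> Prop :=
| St_add v lam mu :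
    steinberg_rel (x_[v, lam] ** x_[v, mu]) (x_[v, lam + mu])
| St_prod u v lam mu N (w : nat -> Col_stable) :
    (u : lat) + v <> 0 -> stable_prod_exists u v -> stable_form v u N ->
    (forall i, (1 <= i <= N)%N -> w i = (u : lat) + (v : lat) *+ i :> lat) ->
    steinberg_rel (Tcomm (x_[u, lam]) (x_[v, mu]))
      (Tprod N (fun i => x_[w i, - ('C(N, i)%:R * lam * mu ^+ i)]))
| St_prodC u v lam mu N (w : nat -> Col_stable) :
    (u : lat) + v <> 0 -> stable_prod_exists v u -> stable_form u v N ->
    (forall i, (1 <= i <= N)%N -> w i = (v : lat) + (u : lat) *+ i :> lat) ->
    steinberg_rel (Tcomm (x_[u, lam]) (x_[v, mu]))
      (Tprod N (fun i => x_[w i, 'C(N, i)%:R * mu * lam ^+ i]))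
| St_comm u v lam mu :
    (u : lat) + v <> 0 -> ~ stable_col ((u : lat) + v) ->
    steinberg_rel (Tcomm (x_[u, lam]) (x_[v, mu])) Tone.

Definition stable_St := pres_group steinberg_rel.

Definition st_gen v lam : stable_St := pres_gen steinberg_rel (v, lam).

End Stable.

(* Main.v *)
(** A vector [v] is a column vector of a lattice polytope exactly when there is
    an integral affine form, nonnegative on the lattice points, with linear part
    -1 on [v], such that every lattice point of positive height may be
    translated by [v]. For a balanced polytope the numbers <P_v, u> lie in
    {-1, 0, 1}, and doubling along the base facet of [w] creates opposite column
    vectors [d], [-d] such that [d] has the base facet of [w], [w = d + (w - d)]
    is a product, and the earlier column vectors are invisible to the base facet
    of [-d]. This splitting drives the whole proof.

    Universality: in a central extension of E(R,P), the commutators of lifts of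
    e_d^1 and e_(w-d)^(-lambda) are lifts of e_w^lambda that do not depend on
    the splitting (by a degenerate Hall-Witt identity), and they satisfy the
    Steinberg relations.

    Kernel: a word in column vectors of degree 0 over the base facet of [-d]
    normalizes the abelian groups generated by the x_w with [w] of degree 1,
    respectively -1; these embed into E(R,P), as the terms of first order in the
    degree show. So a word in the kernel commutes with x_d and x_(w-d), hence
    with x_w. Conversely a central element of E(R,P) fixes all monomials: the
    monomials of height 0 over all base facets in question are fixed, and a
    general monomial is reached from those by applying e_(-d) and comparing
    the parts of degree 0. *)

From HB Require Import structures.
Require Import Defs.
From mathcomp Require Import all_boot all_order all_algebra.
From mathcomp Require Import boolp classical_sets functions reals.
From mathcomp Require Import finmap monalg zify ring.
Require Import Defs.

Set Implicit Arguments.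
Unset Strict Implicit.
Unset Printing Implicit Defensive.

Import Order.TTheory GRing.Theory Num.Theory.

Local Open Scope classical_set_scope.
Local Open Scope ring_scope.

(** * Column vectors of a set of lattice points *)

(** For a balanced polytope the number <P_v, u> decides every relation: it is -1 exactly when u and
    v share their base facet, 1 exactly when u + v = 0 or the product uv exists, and 0 otherwise. So
    the group theory needs only these numbers, the heights on the semigroup and the supply of
    splittings, which [column_axioms] collects. The obstacle lies before that point: facets and
    doublings are given by real and metric data, whereas all later arguments count lattice steps. An
    integral affine form attached to a column vector replaces the facet, and an integral coordinate
    along the difference of the two copies of P replaces the isometric embedding. Condition (ii) of
    a doubling spectrum enters only in [stable_fresh]. *)

Definition lform m (f : 'cV[int]_m) (z : 'rV[int]_m) : int := (z *m f) 0 0.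

Section LinearForms.
Variables (m : nat) (f : 'cV[int]_m).
Implicit Types z : 'rV[int]_m.

Lemma lformD z1 z2 : lform f (z1 + z2) = lform f z1 + lform f z2.
Proof. by rewrite /lform mulmxDl mxE. Qed.

Lemma lformN z : lform f (- z) = - lform f z.
Proof. by rewrite /lform mulNmx mxE. Qed.

Lemma lformB z1 z2 : lform f (z1 - z2) = lform f z1 - lform f z2.
Proof. by rewrite lformD lformN. Qed.

Lemma lform0 : lform f 0 = 0.
Proof. by rewrite /lform mul0mx mxE. Qed.

Lemma lformZ k z : lform f (k *: z) = k * lform f z.
Proof. by rewrite /lform -scalemxAl mxE. Qed.

Lemma lformMn z k : lform f (z *+ k) = lform f z * k%:Z.
Proof. by elim: k => [|k IHk]; rewrite ?mulr0n ?lform0 ?mulrS ?lformD ?IHk; lia. Qed.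

Lemma lform_delta i : lform f (delta_mx 0 i) = f i 0.
Proof. by rewrite /lform -rowE mxE. Qed.

Lemma lform_mulmx k (M : 'M[int]_(k, m)) (z : 'rV[int]_k) :
  lform (M *m f) z = lform f (z *m M).
Proof. by rewrite /lform mulmxA. Qed.

End LinearForms.

Lemma lform_subf m (f g : 'cV[int]_m) z : lform (f - g) z = lform f z - lform g z.
Proof. by rewrite /lform mulmxBr !mxE. Qed.

Lemma lform_inj m (f g : 'cV[int]_m) : lform f =1 lform g -> f = g.
Proof.
by move=> fg; apply/colP => i; have := fg (delta_mx 0 i); rewrite !lform_delta.
Qed.

Section ColumnForms.
Variables (m : nat) (A : set 'rV[int]_m).
Implicit Types (f g : 'cV[int]_m) (b c : int) (u v w x y z : 'rV[int]_m).

(** Affine generation as an induction principle: with integer coefficients, closure under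
    [x + y - z] already yields all affine combinations. *)
Definition affgen := forall H : set 'rV[int]_m,
  (forall x y z, H x -> H y -> H z -> H (x + y - z)) -> A `<=` H ->
  forall x, H x.

(** The form in which compactness of the polytope is used. *)
Definition noray := forall x w, (forall k, A (x + w *+ k)) -> w = 0.

(* [lform f x - b] is the height of [x] over the base facet of [v]. *)
Definition col_form v f b :=
  (forall x, A x -> b <= lform f x /\ (b < lform f x -> A (x + v))) /\
  lform f v = - 1.

Lemma col_form_ge v f b x : col_form v f b -> A x -> b <= lform f x.
Proof. by move=> [H _] /H []. Qed.

Lemma col_form_step v f b x : col_form v f b -> A x -> b < lform f x -> A (x + v).
Proof. by move=> [H _] /H []. Qed.

Lemma col_form_self v f b : col_form v f b -> lform f v = - 1.
Proof. by case. Qed.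

Lemma col_form_iter v f b x (k : nat) :
  col_form v f b -> A x -> b + k%:Z <= lform f x -> A (x + v *+ k).
Proof.
move=> cf; elim: k x => [|k IHk] x Ax le_k; first by rewrite mulr0n addr0.
rewrite mulrS addrA; apply: IHk; first by apply: col_form_step cf Ax _; lia.
by rewrite lformD (col_form_self cf); lia.
Qed.

Lemma col_form_proj v f b x : col_form v f b -> A x ->
  A (x + v *+ `|lform f x - b|%N).
Proof.
move=> cf Ax; apply: (col_form_iter cf Ax).
by have := col_form_ge cf Ax; lia.
Qed.

Lemma lform_proj v f b x g : col_form v f b -> A x ->
  lform g (x + v *+ `|lform f x - b|%N) = lform g x + lform g v * (lform f x - b).
Proof.
by move=> cf Ax; rewrite lformD lformMn; have := col_form_ge cf Ax; lia.
Qed.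

Hypothesis genA : affgen.

Lemma affgen_lform_ext f g b c :
  (forall x, A x -> lform f x - b = lform g x - c) -> f = g /\ b = c.
Proof.
move=> fg.
have all_fg x : lform f x - b = lform g x - c.
  by move: x; apply: genA => // x y z; rewrite !lformB !lformD; lia.
have bc : b = c by have := all_fg 0; rewrite !lform0; lia.
by split=> //; apply: lform_inj => x; have := all_fg x; lia.
Qed.

(** Translating [x] along [v] onto the face of one form lowers the other form by the same amount,
    which must not pass its minimum; so each height bounds the other. *)
Lemma col_form_uniq v f g b c : col_form v f b -> col_form v g c ->
  f = g /\ b = c.
Proof.
move=> cf cg; apply: affgen_lform_ext => x Ax.
have := col_form_ge cg (col_form_proj cf Ax).
have := col_form_ge cf (col_form_proj cg Ax).
rewrite (lform_proj _ cf Ax) (lform_proj _ cg Ax).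
by rewrite (col_form_self cf) (col_form_self cg); lia.
Qed.

Lemma col_form_neq0 v f b : col_form v f b -> v <> 0.
Proof. by move=> /col_form_self + v0; rewrite v0 lform0. Qed.

Lemma affgen_high v f b : col_form v f b -> exists2 x, A x & b < lform f x.
Proof.
move=> cf; apply: contrapT => nx.
have fb x : lform f x = b.
  move: x; apply: genA => [x y z|x Ax]; first by rewrite lformB lformD; lia.
  have := col_form_ge cf Ax; case: (ltrP b (lform f x)) => [lt_b|]; last by lia.
  by case: nx; exists x.
by have := fb v; have := fb (v *+ 2); rewrite lformMn (col_form_self cf); lia.
Qed.

Lemma affgen_height1 v f b : col_form v f b -> exists2 x, A x & lform f x = b + 1.
Proof.
move=> cf; have [x Ax lt_b] := affgen_high cf.
exists (x + v *+ `|(lform f x - b - 1)%R|%N).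
  by apply: (col_form_iter cf Ax); lia.
by rewrite lformD lformMn (col_form_self cf); lia.
Qed.

(** If every point on the face of [v] has height 0 over that of [u], projection along [v] makes the
    height for [u] a multiple of the height for [v]; evaluation at [u] and the signs show that the
    factor is 1. *)
Lemma col_form_dichotomy u v g f c b : col_form u g c -> col_form v f b ->
  (g = f /\ c = b) \/ exists x, [/\ A x, lform f x = b & c < lform g x].
Proof.
move=> cg cf; have [|nx] := pselect (exists x, [/\ A x, lform f x = b & c < lform g x]).
  by right.
left.
have prop_gf x : A x -> lform g x + lform g v * (lform f x - b) = c.
  move=> Ax; have Ay := col_form_proj cf Ax.
  have := lform_proj g cf Ax; have := lform_proj f cf Ax.
  move: (x + _) Ay => y Ay; rewrite (col_form_self cf) => yf yg.
  have := col_form_ge cg Ay; case: (ltrP c (lform g y)) => [lt_c _|]; last by lia.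
  by case: nx; exists y; split=> //; lia.
have all_gf x : lform g x + lform g v * (lform f x - b) = c.
  move: x; apply: genA => // x y z; rewrite !lformB !lformD; lia.
have uv : lform g v * lform f u = 1.
  by have := all_gf u; have := all_gf 0; rewrite (col_form_self cg) !lform0; lia.
have [x Ax lt_b] := affgen_high cf.
have := prop_gf x Ax; have := col_form_ge cg Ax => le_c eq_c.
have gv_le0 : lform g v <= 0 by nia.
have fu_lt0 : lform f u < 0 by nia.
have gv : lform g v = -1 by nia.
by apply: affgen_lform_ext => y /prop_gf; rewrite gv; lia.
Qed.

(** A point on the face of [v] but off the face of [u] can be moved by [u], and this must not take
    it below the minimum of [f]. *)
Lemma col_form_ge0 u v g f c b : col_form u g c -> col_form v f b ->
  (g = f /\ c = b) \/ 0 <= lform f u.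
Proof.
move=> cg cf; have [|[x [Ax fx gx]]] := col_form_dichotomy cg cf; first by left.
right; have := col_form_ge cf (col_form_step cg Ax gx).
by rewrite lformD; lia.
Qed.

Hypothesis norayA : noray.

(** As each vector raises the height of the other, steps by [u] and [v] can be taken in turn
    forever. *)
Lemma col_form_opp u v g f c b : col_form u g c -> col_form v f b ->
  0 < lform f u -> 0 < lform g v -> u + v = 0.
Proof.
move=> cg cf fu gv; have [x Ax gx] := affgen_high cg.
apply: (norayA (x := x)) => k.
suff [] : A (x + (u + v) *+ k) /\ c < lform g (x + (u + v) *+ k) by [].
elim: k => [|k [Ay gy]]; first by rewrite mulr0n addr0.
rewrite mulrSr addrA; move: (x + _) Ay gy => y Ay gy.
have Ayu := col_form_step cg Ay gy.
rewrite addrA; split; last by rewrite !lformD (col_form_self cg); lia.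
by apply: (col_form_step cf Ayu); have := col_form_ge cf Ay; rewrite lformD; lia.
Qed.

(** By the previous lemma [v] is parallel to the face of [u], and the step by [v] is allowed after
    the step by [u] because the latter has raised the height over the face of [v]. *)
Lemma col_form_prod u v g f c b : col_form u g c -> col_form v f b ->
  0 < lform f u -> u + v <> 0 -> col_form (u + v) g c.
Proof.
move=> cg cf fu uv0.
have gv : lform g v = 0.
  case: (col_form_ge0 cf cg) => [[fg _]|gv_ge0].
    by move: fu; rewrite fg (col_form_self cg).
  by case: (ltrP 0 (lform g v)) => [/(col_form_opp cg cf fu)//|]; lia.
split=> [x Ax|]; last by rewrite lformD gv (col_form_self cg).
split=> [|gx]; first exact: col_form_ge cg Ax.
rewrite addrA; apply: (col_form_step cf (col_form_step cg Ax gx)).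
by have := col_form_ge cf Ax; rewrite lformD; lia.
Qed.

End ColumnForms.

Section Inclusion.
Variables (K : pzRingType) (n : nat).
Implicit Types x y : 'rV[K]_n.

Definition incl_mx : 'M[K]_(n, n.+1) := \matrix_(i, j) (i == j :> nat)%:R.

Lemma inclE x : incl x = x *m incl_mx.
Proof.
apply/rowP => j; rewrite !mxE /pad; case: insubP => [k _ kj|].
  rewrite (bigD1 k) //= mxE kj eqxx mulr1 big1 ?addr0 // => i ik.
  rewrite mxE; case: eqP => [ij|_]; last by rewrite mulr0.
  by case/eqP: ik; apply: val_inj; rewrite /= ij kj.
rewrite -leqNgt => le_nj; rewrite big1 // => i _; rewrite mxE.
case: eqP => [ij|_]; last by rewrite mulr0.
by move: le_nj; rewrite -ij leqNgt ltn_ord.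
Qed.

Lemma inclD x y : incl (x + y) = incl x + incl y.
Proof. by rewrite !inclE mulmxDl. Qed.

Lemma inclN x : incl (- x) = - incl x.
Proof. by rewrite !inclE mulNmx. Qed.

Lemma incl0 : incl (0 : 'rV[K]_n) = 0.
Proof. by rewrite inclE mul0mx. Qed.

End Inclusion.

(** * Column vectors of a doubled set of lattice points *)

Definition col_balanced m (A : set 'rV[int]_m) := forall u v g f c b,
  col_form A u g c -> col_form A v f b -> lform f u <= 1.

(* The lattice points of the doubling: [delta] is the difference of the two
   copies of a point of height 1, [kappa] the coordinate along [delta] and
   [sigma] the projection along [delta]. *)
Record lat_doubling n (A : set 'rV[int]_n) (f : 'cV[int]_n) (b : int)
    (A' : set 'rV[int]_n.+1) (delta : 'rV[int]_n.+1)
    (sigma : 'M[int]_(n.+1, n)) (kappa : 'cV[int]_n.+1) : Prop := LatDoubling {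
  dbl_kappa_delta : lform kappa delta = 1;
  dbl_sigma_delta : delta *m sigma = 0;
  dbl_kappa_incl : forall x, lform kappa (incl x) = 0;
  dbl_sigma_incl : forall x, incl x *m sigma = x;
  dbl_decomp : forall z, z = incl (z *m sigma) + lform kappa z *: delta;
  dbl_latpts : forall z, A' z <->
    A (z *m sigma) /\ 0 <= lform kappa z <= lform f (z *m sigma) - b
}.

Section LatDoubling.
Variables (n : nat) (A : set 'rV[int]_n) (f : 'cV[int]_n) (b : int).
Variables (A' : set 'rV[int]_n.+1) (delta : 'rV[int]_n.+1).
Variables (sigma : 'M[int]_(n.+1, n)) (kappa : 'cV[int]_n.+1).
Hypothesis dbl : lat_doubling A f b A' delta sigma kappa.
Variable v0 : 'rV[int]_n.
Hypothesis col_v0 : col_form A v0 f b.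

(** The equations [kappa = 0] and [f1 = b] cut out the two copies of the polytope in its
    doubling. *)
Let f1 := sigma *m f - kappa.

Lemma dbl_f1_delta : lform f1 delta = - 1.
Proof.
by rewrite lform_subf lform_mulmx (dbl_sigma_delta dbl) lform0 (dbl_kappa_delta dbl).
Qed.

Lemma dbl_f1_incl x : lform f1 (incl x) = lform f x.
Proof.
by rewrite lform_subf lform_mulmx (dbl_sigma_incl dbl) (dbl_kappa_incl dbl) subr0.
Qed.

Lemma dbl_f1E z : lform f1 z = lform f (z *m sigma) - lform kappa z.
Proof. by rewrite lform_subf lform_mulmx. Qed.

Lemma dbl_latpts_incl x : A' (incl x) <-> A x.
Proof.
rewrite (dbl_latpts dbl) (dbl_sigma_incl dbl) (dbl_kappa_incl dbl) lexx /=.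
split=> [[]//|Ax]; split=> //.
by have := col_form_ge col_v0 Ax; lia.
Qed.

Lemma dbl_col_same u : col_form A u f b -> col_form A' (incl u) f1 b.
Proof.
move=> cu; split=> [z|]; last by rewrite dbl_f1_incl (col_form_self cu).
move=> /(dbl_latpts dbl) [Az /andP[k0 kf]]; rewrite dbl_f1E.
split=> [|kf']; first by lia.
apply/(dbl_latpts dbl); rewrite mulmxDl (dbl_sigma_incl dbl) !lformD.
rewrite (dbl_kappa_incl dbl) (col_form_self cu).
by split; [apply: (col_form_step cu Az)|]; lia.
Qed.

(** As [u] does not lower [f], the fibre over the translated point is at least as long, so the
    coordinate along [delta] can be kept. *)
Lemma dbl_col_other u g c :
  col_form A u g c -> 0 <= lform f u -> col_form A' (incl u) (sigma *m g) c.
Proof.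
move=> cu fu; split=> [z|]; last first.
  by rewrite lform_mulmx (dbl_sigma_incl dbl) (col_form_self cu).
move=> /(dbl_latpts dbl) [Az /andP[k0 kf]]; rewrite lform_mulmx.
split=> [|kf']; first exact: col_form_ge cu Az.
apply/(dbl_latpts dbl); rewrite mulmxDl (dbl_sigma_incl dbl) !lformD.
rewrite (dbl_kappa_incl dbl).
by split; [apply: (col_form_step cu Az)|]; lia.
Qed.

Lemma dbl_col_delta : col_form A' delta f1 b.
Proof.
split=> [z|]; last exact: dbl_f1_delta.
move=> /(dbl_latpts dbl) [Az /andP[k0 kf]]; rewrite dbl_f1E.
split=> [|kf']; first by lia.
apply/(dbl_latpts dbl); rewrite mulmxDl (dbl_sigma_delta dbl) addr0 lformD.
by rewrite (dbl_kappa_delta dbl); split=> //; lia.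
Qed.

Lemma dbl_col_opp : col_form A' (- delta) kappa 0.
Proof.
split=> [z|]; last by rewrite lformN (dbl_kappa_delta dbl).
move=> /(dbl_latpts dbl) [Az /andP[k0 kf]].
split=> [//|kf'].
have zs : (z - delta) *m sigma = z *m sigma by rewrite mulmxBl (dbl_sigma_delta dbl) subr0.
apply/(dbl_latpts dbl); rewrite zs lformB (dbl_kappa_delta dbl).
by split=> //; lia.
Qed.

Hypothesis genA : affgen A.

Lemma dbl_affgen : affgen A'.
Proof.
move=> H Hadd AH; have [y Ay fy] := affgen_high genA col_v0.
have Hincl x : H (incl x).
  move: x; apply: (genA (H := [set x | H (incl x)])) => [x1 x2 x3|x Ax] /=.
    by rewrite inclD inclD inclN; apply: Hadd.
  exact/AH/dbl_latpts_incl.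
(* A point [y] of positive height supplies [delta] as a difference of two lattice points of the
   doubling. *)
have Hy : H (incl y + delta).
  apply/AH/(dbl_latpts dbl); rewrite mulmxDl (dbl_sigma_incl dbl).
  rewrite (dbl_sigma_delta dbl) addr0 lformD (dbl_kappa_incl dbl).
  by rewrite (dbl_kappa_delta dbl); split=> //; lia.
have Hd x (k : nat) : H x -> H (x + delta *+ k) /\ H (x - delta *+ k).
  elim: k => [|k IHk] Hx; first by rewrite mulr0n subr0 addr0.
  have [Hp Hm] := IHk Hx; split.
    suff -> : x + delta *+ k.+1 = x + delta *+ k + (incl y + delta) - incl y.
      exact: Hadd.
    by rewrite mulrSr [incl y + _]addrC -!addrA subrr addr0.
  suff -> : x - delta *+ k.+1 = x - delta *+ k + incl y - (incl y + delta).
    exact: Hadd.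
  by rewrite mulrSr !opprD -!addrA addNKr.
move=> z; rewrite (dbl_decomp dbl z); set k := lform kappa z.
have [Hp Hm] := Hd (incl (z *m sigma)) `|k|%N (Hincl _).
have [k0|k0] := lerP 0 k.
  suff -> : k *: delta = delta *+ `|k|%N by [].
  by rewrite -scaler_nat natz gez0_abs.
suff -> : k *: delta = - (delta *+ `|k|%N) by [].
by rewrite -scaler_nat natz -scaleNr ltz0_abs // opprK.
Qed.

Hypothesis norayA : noray A.

Hypothesis balA : col_balanced A.

(* By the dichotomy with respect to delta and -delta, a base facet of the
   doubling is one of the two copies of P or does not change along delta. *)
Lemma dbl_col_cases w h e : col_form A' w h e ->
  [\/ h = kappa /\ e = 0, h = f1 /\ e = b
    | exists g, [/\ h = sigma *m g, col_form A (w *m sigma) g e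
      & 0 <= lform kappa w <= lform f (w *m sigma)]].
Proof.
move=> ch.
case: (col_form_ge0 dbl_affgen dbl_col_opp ch) => [[-> ->]|h_ge0]; first by constructor 1.
case: (col_form_ge0 dbl_affgen dbl_col_delta ch) => [[-> ->]|h_ge0']; first by constructor 2.
constructor 3.
have hdelta : lform h delta = 0 by move: h_ge0; rewrite lformN; lia.
pose g := incl_mx _ n *m h.
have gE x : lform g x = lform h (incl x) by rewrite /g lform_mulmx inclE.
have hE z : lform h z = lform g (z *m sigma).
  by rewrite gE {1}(dbl_decomp dbl z) lformD lformZ hdelta mulr0 addr0.
exists g; split.
- by apply: lform_inj => z; rewrite hE lform_mulmx.
- split=> [x Ax|]; last by rewrite -hE (col_form_self ch).
  have A'x : A' (incl x) by apply/dbl_latpts_incl.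
  rewrite gE; split; first exact: col_form_ge ch A'x.
  move=> lt_e; have := col_form_step ch A'x lt_e.
  by move=> /(dbl_latpts dbl)[]; rewrite mulmxDl (dbl_sigma_incl dbl).
have [z A'z hz] := affgen_high dbl_affgen ch.
have /(dbl_latpts dbl)[Az _] := A'z.
set x := z *m sigma in Az; rewrite hE -/x in hz.
have ht0 := col_form_ge col_v0 Az.
(* The fibre over [x] is an interval that [w] carries into the fibre over [x + w *m sigma]; its two
   ends give the two bounds on [lform kappa w]. *)
have lift k : 0 <= k <= lform f x - b ->
    0 <= k + lform kappa w <= lform f x + lform f (w *m sigma) - b.
  move=> k0; have : A' (incl x + k *: delta).
    apply/(dbl_latpts dbl); rewrite mulmxDl (dbl_sigma_incl dbl) -scalemxAl.
    rewrite (dbl_sigma_delta dbl) scaler0 addr0 lformD (dbl_kappa_incl dbl).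
    by rewrite lformZ (dbl_kappa_delta dbl) mulr1 add0r.
  move=> /(col_form_step ch); rewrite lformD lformZ hdelta mulr0 addr0.
  rewrite -gE hz => /(_ isT) /(dbl_latpts dbl)[_].
  rewrite !mulmxDl (dbl_sigma_incl dbl) -scalemxAl (dbl_sigma_delta dbl).
  rewrite scaler0 addr0 !lformD (dbl_kappa_incl dbl) lformZ (dbl_kappa_delta dbl).
  by rewrite mulr1 add0r.
by have := lift 0; have := lift (lform f x - b); lia.
Qed.

(** A column vector based at one of the two copies is [delta], [- delta], an old one based at the
    doubled facet, or such a one minus [delta]; every other one projects to a column vector of [A].
    So each pairing is explicit or reduces to one in [A]. *)
Lemma dbl_balanced : col_balanced A'.
Proof.
(* A translation that does not lower [f] keeps points off the face, so it can be iterated and must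
   be 0. *)
have stay x' : 0 <= lform f x' ->
    (forall x, A x -> b < lform f x -> A (x + x')) -> x' = 0.
  move=> fx' mv; have [y Ay fy] := affgen_high genA col_v0.
  apply: (norayA (x := y)) => k.
  suff [] : A (y + x' *+ k) /\ b < lform f (y + x' *+ k) by [].
  elim: k => [|k [Ak fk]]; first by rewrite mulr0n addr0.
  rewrite mulrSr addrA; move: (y + _) Ak fk => y' Ak fk.
  by rewrite lformD; split; [apply: mv|lia].
have kappa_col w : col_form A' w kappa 0 ->
    (w *m sigma = 0 \/ col_form A (w *m sigma) f b) /\ lform kappa w = - 1.
  move=> cw; split; last exact: col_form_self cw.
  have mv x : A x -> b < lform f x -> A (x + w *m sigma).
    move=> Ax fx; have : A' (incl x + delta).
      apply/(dbl_latpts dbl); rewrite mulmxDl (dbl_sigma_incl dbl).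
      rewrite (dbl_sigma_delta dbl) addr0 lformD (dbl_kappa_incl dbl).
      by rewrite (dbl_kappa_delta dbl); split=> //; lia.
    move=> /(col_form_step cw); rewrite lformD (dbl_kappa_incl dbl).
    rewrite (dbl_kappa_delta dbl) => /(_ isT) /(dbl_latpts dbl)[].
    by rewrite !mulmxDl (dbl_sigma_incl dbl) (dbl_sigma_delta dbl) addr0.
  have [fw|fw] := lerP 0 (lform f (w *m sigma)); first by left; apply: stay.
  right; split=> [x Ax|]; first by split; [exact: col_form_ge col_v0 Ax|exact: mv].
  case: (col_form_ge0 dbl_affgen cw dbl_col_delta) => [[fk _]|].
    by have := dbl_f1_delta; rewrite -fk (dbl_kappa_delta dbl).
  by rewrite dbl_f1E (col_form_self cw); lia.
have f1_col w : col_form A' w f1 b ->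
    w = delta \/ (col_form A (w *m sigma) f b /\ lform kappa w = 0).
  move=> cw; have := col_form_self cw; rewrite dbl_f1E => fw.
  have mv x : A x -> b < lform f x -> A (x + w *m sigma).
    move=> Ax fx; have /(col_form_step cw) : A' (incl x) by apply/dbl_latpts_incl.
    rewrite dbl_f1_incl fx => /(_ isT) /(dbl_latpts dbl)[].
    by rewrite mulmxDl (dbl_sigma_incl dbl).
  have kw : 0 <= lform kappa w.
    case: (col_form_ge0 dbl_affgen cw dbl_col_opp) => [[fk _]|//].
    by have := dbl_f1_delta; rewrite fk (dbl_kappa_delta dbl).
  have [fw0|fw0] := lerP 0 (lform f (w *m sigma)).
    left; have w0 := stay _ fw0 mv.
    have kw1 : lform kappa w = 1 by move: fw; rewrite w0 lform0; lia.
    by have := dbl_decomp dbl w; rewrite w0 incl0 add0r kw1 scale1r.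
  right; split; last by lia.
  split=> [x Ax|]; last by lia.
  by split; [exact: col_form_ge col_v0 Ax|exact: mv].
move=> u v g h c e cu cv.
have hu : [\/ h = kappa, h = f1 | exists g v, h = sigma *m g /\ col_form A v g e].
  case: (dbl_col_cases cv) => [[-> _]|[-> _]|[g' [-> cg _]]].
  - by constructor 1.
  - by constructor 2.
  - by constructor 3; exists g', (v *m sigma).
case: (dbl_col_cases cu) => [[gk ck]|[gk ck]|[g' [gE cg' /andP[ku0 kuf]]]].
- rewrite gk ck in cu; have [[u0|cu'] ku] := kappa_col u cu.
    case: hu => [->|->|[g' [v' [-> _]]]]; rewrite ?dbl_f1E ?lform_mulmx ?u0 ?lform0; lia.
  case: hu => [->|->|[g' [v' [-> cg']]]]; first by lia.
    by rewrite dbl_f1E (col_form_self cu'); lia.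
  by rewrite lform_mulmx; apply: balA cu' cg'.
- rewrite gk ck in cu; have [->|[cu' ku]] := f1_col u cu.
    case: hu => [->|->|[g' [v' [-> _]]]]; rewrite ?dbl_f1_delta ?lform_mulmx;
    by rewrite ?(dbl_sigma_delta dbl) ?lform0 ?(dbl_kappa_delta dbl); lia.
  case: hu => [->|->|[g' [v' [-> cg']]]]; first by lia.
    by rewrite (col_form_self cu).
  by rewrite lform_mulmx; apply: balA cu' cg'.
have fu := balA cg' col_v0.
case: hu => [->|->|[h' [v' [-> ch']]]]; first by lia.
  by rewrite dbl_f1E; lia.
by rewrite lform_mulmx; apply: balA cg' ch'.
Qed.

(** This makes heights and pairings independent of the stage of the spectrum. *)
Lemma dbl_col_restr v g c h e : col_form A v g c -> col_form A' (incl v) h e ->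
  e = c /\ forall x, lform h (incl x) = lform g x.
Proof.
move=> cv cv'; case: (col_form_ge0 genA cv col_v0) => [[gf cb]|fv].
  rewrite gf cb in cv *; have := dbl_col_same cv => /(col_form_uniq dbl_affgen cv')[-> ->].
  by split=> // x; rewrite dbl_f1_incl.
have := dbl_col_other cv fv => /(col_form_uniq dbl_affgen cv')[-> ->].
by split=> // x; rewrite lform_mulmx (dbl_sigma_incl dbl).
Qed.

Lemma dbl_col v g c : col_form A v g c -> exists h, col_form A' (incl v) h c.
Proof.
move=> cv; case: (col_form_ge0 genA cv col_v0) => [[gf cb]|fv].
  by rewrite gf cb in cv *; exists f1; apply: dbl_col_same.
by exists (sigma *m g); apply: dbl_col_other.
Qed.

End LatDoubling.

(** * Lattice polytopes and their doublings *)

(* Affine combinations with coefficients in [C]; [C] is everything for affine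
   hulls and the nonnegative numbers for convex hulls. *)
Definition comb_hull (K : numDomainType) (V : lmodType K) (C : set K) (A : set V)
    : set V := [set x | exists s : seq (K * V),
  [/\ forall p, p \in s -> C p.1 /\ A p.2, \sum_(p <- s) p.1 = 1
    & x = \sum_(p <- s) p.1 *: p.2]].

Section Hulls.
Variables (K : numDomainType) (V : lmodType K).
Implicit Types (A B : set V) (C : set K).

Lemma comb_hull_ord C A x : comb_hull C A x <->
  exists m (a : 'I_m -> K) (y : 'I_m -> V),
  [/\ forall i, C (a i), \sum_i a i = 1, forall i, A (y i)
    & x = \sum_i a i *: y i].
Proof.
split=> [[s [sP s1 ->]]|[m [a [y [Ca a1 Ay ->]]]]].
  exists (size s), (fun i => (tnth (in_tuple s) i).1), (fun i => (tnth (in_tuple s) i).2).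
  have tP i : C (tnth (in_tuple s) i).1 /\ A (tnth (in_tuple s) i).2.
    exact/sP/mem_tnth.
  split=> [i||i|]; [by case: (tP i)| |by case: (tP i)|by rewrite big_tnth].
  by rewrite -s1 [RHS]big_tnth.
exists [seq (a i, y i) | i <- enum 'I_m]; split.
- by move=> p /mapP[i _ ->]; split; [apply: Ca|apply: Ay].
- by rewrite big_map big_enum.
- by rewrite big_map big_enum.
Qed.

Lemma conv_hullE A : conv_hull A = comb_hull [set a | 0 <= a] A.
Proof.
apply/seteqP; split=> x; first by move=> [m [a [y H]]]; apply/comb_hull_ord; exists m, a, y.
by move=> /comb_hull_ord[m [a [y H]]]; exists m, a, y.
Qed.

Lemma aff_hullE A : aff_hull A = comb_hull setT A.
Proof.
apply/seteqP; split=> x.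
  by move=> [m [a [y [a1 Ay ->]]]]; apply/comb_hull_ord; exists m, a, y.
by move=> /comb_hull_ord[m [a [y [_ a1 Ay ->]]]]; exists m, a, y.
Qed.

Lemma comb_hull_sub C A : C 1 -> A `<=` comb_hull C A.
Proof.
move=> C1 x Ax; exists [:: (1, x)]; rewrite !big_seq1 scale1r; split=> // p.
by rewrite inE => /eqP ->.
Qed.

Lemma comb_hull_idem C A : (forall a b, C a -> C b -> C (a * b)) ->
  comb_hull C (comb_hull C A) `<=` comb_hull C A.
Proof.
move=> CM _ [s [sP s1 ->]].
have {sP}: exists t : seq (K * V), [/\ forall p, p \in t -> C p.1 /\ A p.2,
    \sum_(p <- t) p.1 = \sum_(p <- s) p.1
  & \sum_(p <- t) p.1 *: p.2 = \sum_(p <- s) p.1 *: p.2].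
  elim: s {s1} sP => [|[a x] s IHs] sP; first by exists [::]; rewrite !big_nil.
  have [|t [tP t1 t2]] := IHs; first by move=> p ps; apply: sP; rewrite inE ps orbT.
  have [/= Ca [r [rP r1 xE]]] := sP _ (mem_head _ _).
  exists ([seq (a * p.1, p.2) | p <- r] ++ t); split.
  - move=> p; rewrite mem_cat => /orP[/mapP[q qr ->]|/tP//].
    by have [? ?] := rP q qr; split=> //=; apply: CM.
  - by rewrite big_cat big_map big_cons t1 -mulr_sumr r1 mulr1.
  - rewrite big_cat big_map big_cons t2 /= xE scaler_sumr.
    by congr (_ + _); apply: eq_bigr => p _; rewrite scalerA.
by move=> [t [tP t1 t2]]; exists t; rewrite t1 t2.
Qed.

Lemma comb_hullS C A B : A `<=` B -> comb_hull C A `<=` comb_hull C B.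
Proof. by move=> AB x [s [sP s1 ->]]; exists s; split=> // p /sP[? /AB]. Qed.

Lemma aff_hull3 A x y z :
  aff_hull A x -> aff_hull A y -> aff_hull A z -> aff_hull A (x + y - z).
Proof.
rewrite aff_hullE => Ax Ay Az; apply: comb_hull_idem => //.
exists [:: (1, x); (1, y); (- 1, z)]; rewrite !big_cons !big_nil /=.
rewrite !addr0 subrr addr0 !scale1r scaleN1r addrA; split=> // p.
by rewrite !inE => /or3P[] /eqP ->.
Qed.

Lemma conv_hull2 A a x y : 0 <= a <= 1 ->
  conv_hull A x -> conv_hull A y -> conv_hull A ((1 - a) *: x + a *: y).
Proof.
move=> /andP[a0 a1]; rewrite conv_hullE => Ax Ay.
apply: comb_hull_idem; first exact: mulr_ge0.
exists [:: (1 - a, x); (a, y)]; rewrite !big_cons !big_nil /= !addr0 subrK.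
by split=> // p; rewrite !inE => /orP[] /eqP -> /=; rewrite ?subr_ge0.
Qed.

End Hulls.

(** Only combinations of total weight 1 are tested on [h], because the graph map of the doubling is
    affine and not linear. *)
Lemma comb_hull_img (K : numDomainType) (V W : lmodType K) (C : set K)
    (A : set V) (B : set W) (h : V -> W) :
  (forall s : seq (K * V), \sum_(p <- s) p.1 = 1 ->
    h (\sum_(p <- s) p.1 *: p.2) = \sum_(p <- s) p.1 *: h p.2) ->
  (forall x, A x -> B (h x)) -> forall x, comb_hull C A x -> comb_hull C B (h x).
Proof.
move=> hlin hAB x [s [sP s1 ->]]; exists [seq (p.1, h p.2) | p <- s]; split.
- by move=> _ /mapP[p /sP[Cp /hAB ?] ->].
- by rewrite big_map.
- by rewrite big_map hlin.
Qed.

(** An integral affine combination is [y0] plus integral multiples of differences [y - y0], and each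
    difference is added or subtracted by one closure step. *)
Lemma affgen_aff_hull n (A : set 'rV[int]_n) : aff_hull A = setT -> affgen A.
Proof.
move=> AT H H3 AH x.
have : aff_hull A x by rewrite AT.
rewrite aff_hullE => -[s [sP s1 ->]] {AT x}.
have [y0 Ay0] : exists y, A y.
  case: s sP s1 => [|p s] sP; first by rewrite big_nil.
  by exists p.2; case: (sP p (mem_head _ _)).
have Hk y (k : nat) w : A y -> H w -> H (w + (y - y0) *+ k) /\ H (w - (y - y0) *+ k).
  move=> Ay Hw; elim: k => [|k [IHp IHm]]; first by rewrite mulr0n subr0 addr0.
  rewrite mulrSr opprD !addrA opprB; split; first by apply: H3 => //; apply: AH.
  by rewrite addrA; apply: H3 => //; apply: AH.
suff : H (y0 + \sum_(p <- s) p.1 *: (p.2 - y0)).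
  congr H; rewrite (eq_bigr (fun p => p.1 *: p.2 - p.1 *: y0)) => [|p _]; last first.
    by rewrite scalerBr.
  by rewrite sumrB -scaler_suml s1 scale1r addrC subrK.
elim: s sP {s1} => [|[k y] s IHs] sP; first by rewrite big_nil addr0; apply: AH.
have Ay : A y by have [] := sP _ (mem_head _ _).
have {IHs} Hs := IHs (fun p ps => sP p (mem_behead (s := _ :: _) ps)).
rewrite big_cons /= addrCA addrC; have [Hp Hm] := Hk y `|k|%N _ Ay Hs.
have [k0|k0] := lerP 0 k.
  suff -> : k *: (y - y0) = (y - y0) *+ `|k|%N by [].
  by rewrite -scaler_nat natz gez0_abs.
suff -> : k *: (y - y0) = - ((y - y0) *+ `|k|%N) by [].
by rewrite -scaler_nat natz -scaleNr ltz0_abs // opprK.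
Qed.

Section RealForms.
Variables (Rr : realType) (n : nat).
Implicit Types (c : 'cV[Rr]_n) (x : 'rV[Rr]_n) (z : 'rV[int]_n).
Local Notation latpt := (@latpt Rr n).

Definition rform c x : Rr := (x *m c) 0 0.

Lemma rformD c x y : rform c (x + y) = rform c x + rform c y.
Proof. by rewrite /rform mulmxDl mxE. Qed.

Lemma rformZ c a x : rform c (a *: x) = a * rform c x.
Proof. by rewrite /rform -scalemxAl mxE. Qed.

Lemma rformN c x : rform c (- x) = - rform c x.
Proof. by rewrite /rform mulNmx mxE. Qed.

Lemma rform0 c : rform c 0 = 0.
Proof. by rewrite /rform mul0mx mxE. Qed.

Lemma rformMn c x k : rform c (x *+ k) = rform c x *+ k.
Proof. by elim: k => [|k IHk]; rewrite ?rform0 // !mulrS rformD IHk. Qed.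

Lemma rform_comb c (s : seq (Rr * 'rV[Rr]_n)) :
  rform c (\sum_(p <- s) p.1 *: p.2) = \sum_(p <- s) p.1 * rform c p.2.
Proof.
elim: s => [|p s IHs]; first by rewrite !big_nil rform0.
by rewrite !big_cons rformD rformZ IHs.
Qed.

Lemma rform_delta c i : rform c (delta_mx 0 i) = c i 0.
Proof. by rewrite /rform -rowE mxE. Qed.

Lemma latptD z1 z2 : latpt (z1 + z2) = latpt z1 + latpt z2.
Proof. exact: map_mxD. Qed.

Lemma latptB z1 z2 : latpt (z1 - z2) = latpt z1 - latpt z2.
Proof. exact: map_mxB. Qed.

Lemma latpt0 : latpt 0 = 0.
Proof. exact: map_mx0. Qed.

Lemma latptZ k z : latpt (k *: z) = k%:~R *: latpt z.
Proof. exact: map_mxZ. Qed.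

Lemma latptMn z k : latpt (z *+ k) = latpt z *+ k.
Proof. by elim: k => [|k IHk]; rewrite ?latpt0 // !mulrS latptD IHk. Qed.

Lemma latpt_delta i : latpt (delta_mx 0 i) = delta_mx 0 i.
Proof. exact: map_delta_mx. Qed.

Lemma latpt_inj : injective latpt.
Proof.
move=> z1 z2 /rowP eq12; apply/rowP => i; have := eq12 i.
by rewrite !mxE => /intr_inj.
Qed.

Lemma rform_latpt f z : rform (map_mx intr f) (latpt z) = (lform f z)%:~R.
Proof. by rewrite /rform -map_mxM mxE. Qed.

Lemma rform_comb_ge c b C (A : set 'rV[Rr]_n) x : C `<=` [set a | 0 <= a] ->
  (forall y, A y -> b <= rform c y) -> comb_hull C A x -> b <= rform c x.
Proof.
move=> C0 Ab [s [sP s1 ->]]; rewrite rform_comb -[b]mul1r -s1 mulr_suml.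
rewrite !big_seq; apply: ler_sum => p /sP[/C0 /= p0 /Ab].
exact: ler_wpM2l.
Qed.

End RealForms.

(** * Base facets and facet forms of a lattice polytope *)

Section Polytope.
Variables (Rr : realType) (n : nat) (P : set 'rV[Rr]_n).
Implicit Types (F : set 'rV[Rr]_n) (f g : 'cV[int]_n) (u v z : 'rV[int]_n).
Local Notation latpt := (@latpt Rr n).
Local Notation A := (latpts P).

Definition good_polytope := lattice_polytope P /\ affgen A.

Hypothesis goodP : good_polytope.

Lemma good_affgen : affgen A. Proof. by case: goodP. Qed.

Lemma polytope_ge c b : (forall z, A z -> b <= rform c (latpt z)) ->
  forall x, P x -> b <= rform c x.
Proof.
move=> Ab x; have [[s PE] _] := goodP; rewrite PE conv_hullE.
apply: rform_comb_ge => // _ [z zs <-]; apply: Ab.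
by rewrite /latpts /= PE conv_hullE; apply: comb_hull_sub => //=; exists z.
Qed.

Lemma polytope_conv : conv_hull P `<=` P.
Proof.
have [[s ->] _] := goodP; rewrite !conv_hullE.
by apply: comb_hull_idem => a b; apply: mulr_ge0.
Qed.

Lemma polytope_bounded c : exists M : Rr, forall x, P x -> M <= rform c x.
Proof.
have [[s PE] _] := goodP; exists (- \sum_(z <- s) `|rform c (latpt z)|).
rewrite PE conv_hullE => x; apply: rform_comb_ge => // _ [z /= zs <-].
have : rform c (latpt z) \in [seq rform c (latpt z) | z <- s] by apply: map_f.
rewrite -(big_map (fun z => rform c (latpt z)) xpredT (fun a => `|a|)).
elim: [seq _ | _ <- s] => // a t IHt; rewrite big_cons inE opprD => /predU1P[->|/IHt le_t].
  apply: le_trans (lerNnormlW (lexx _)).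
  by rewrite gerDl oppr_le0 sumr_ge0.
by apply: le_trans le_t; rewrite gerDr oppr_le0.
Qed.

Lemma good_noray : noray A.
Proof.
move=> x w ray; apply/rowP => i; rewrite mxE; apply/eqP/negP => wi0.
(* The coordinate [i], signed so that it drops by at least 1 with each step along [w]. *)
pose c : 'cV[Rr]_n := - Num.sg ((w 0 i)%:~R) *: delta_mx i 0.
have cE z : rform c (latpt z) = - Num.sg ((w 0 i)%:~R) * (z 0 i)%:~R.
  rewrite /rform -scalemxAr mxE -colE; congr (_ * _).
  by rewrite !mxE.
have [M boundM] := polytope_bounded c.
have := archi_boundP (normr_ge0 (rform c (latpt x) - M)).
set N := Num.bound _ => ltN.
have := boundM _ (ray N); rewrite latptD latptMn rformD rformMn.
have -> : rform c (latpt w) = - `|(w 0 i)%:~R| by rewrite cE mulNr -normrEsg.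
have w1 : 1 <= `|(w 0 i)%:~R| :> Rr.
  by rewrite -intr_norm (ler_int _ 1); move/negP: wi0; lia.
rewrite mulNrn lerBrDr addrC -lerBrDr => leN.
have : N%:R <= N%:R * `|(w 0 i)%:~R| :> Rr by rewrite ler_peMr.
rewrite mulr_natl => /le_trans /(_ leN) /(le_lt_trans) /(_ (le_lt_trans (ler_norm _) ltN)).
by rewrite ltxx.
Qed.

Lemma aff_hull_latpt F : (forall z, A z -> aff_hull F (latpt z)) ->
  forall z, aff_hull F (latpt z).
Proof.
move=> AF z; move: z; apply: (good_affgen (H := [set z | aff_hull F (latpt z)])) => //=.
by move=> x y z Fx Fy Fz; rewrite latptB latptD; apply: aff_hull3.
Qed.

Lemma lat_comb (x : 'rV[Rr]_n) : exists s : seq (Rr * 'rV[int]_n),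
  \sum_(p <- s) p.1 = 1 /\ x = \sum_(p <- s) p.1 *: latpt p.2.
Proof.
exists ((1 - \sum_i x 0 i, 0) :: [seq (x 0 i, delta_mx 0 i) | i <- enum 'I_n]).
split; rewrite big_cons big_map big_enum /= ?subrK //.
rewrite latpt0 scaler0 add0r {1}[x]row_sum_delta; apply: eq_bigr => i _.
by rewrite latpt_delta.
Qed.

Definition base_face f (b : int) : set 'rV[Rr]_n :=
  [set x | P x /\ rform (map_mx intr f) x = b%:~R].

Lemma base_face_latpt f b z : base_face f b (latpt z) <-> A z /\ lform f z = b.
Proof.
rewrite /base_face /= rform_latpt; split=> [[Az /intr_inj]//|[Az ->]//].
Qed.

Section ColumnForm.
Variables (v : 'rV[int]_n) (f : 'cV[int]_n) (b : int).
Hypothesis cf : col_form A v f b.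
Local Notation fr := (map_mx intr f : 'cV[Rr]_n).

Lemma base_face_proj z : A z -> base_face f b (latpt (z + v *+ `|lform f z - b|%N)).
Proof.
move=> Az; apply/base_face_latpt; split; first exact: col_form_proj cf Az.
by rewrite (lform_proj f cf Az) (col_form_self cf); lia.
Qed.

Lemma aff_hull_base_face : aff_hull (base_face f b) = [set x | rform fr x = b%:~R].
Proof.
apply/seteqP; split=> x; rewrite aff_hullE /=.
  move=> [s [sP s1 ->]]; rewrite rform_comb big_seq.
  under eq_bigr => p /sP[_ [_ ->]] do [].
  by rewrite -big_seq -mulr_suml s1 mul1r.
(* Projection along [v] to the hyperplane. It is affine and maps [A] into the face, hence by affine
   generation every lattice point into the affine hull of the face. *)
pose proj z := latpt z + (lform f z - b)%:~R *: latpt v.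
have projP z : comb_hull setT (base_face f b) (proj z).
  rewrite -aff_hullE; move: z.
  apply: (good_affgen (H := [set z | aff_hull (base_face f b) (proj z)])) => /=.
    move=> z1 z2 z3 H1 H2 H3.
    suff -> : proj (z1 + z2 - z3) = proj z1 + proj z2 - proj z3 by apply: aff_hull3.
    rewrite /proj latptB latptD (addrACA (latpt z1)) -scalerDl opprD.
    rewrite (addrACA (latpt z1 + latpt z2)) -scalerBl.
    congr (_ + _ *: _); rewrite -intrD -intrB; congr _%:~R.
    by rewrite lformB lformD; lia.
  move=> z Az; rewrite aff_hullE; apply: comb_hull_sub => //.
  have := base_face_proj Az; rewrite latptD latptMn.
  rewrite /proj.
  suff -> : (lform f z - b)%:~R *: latpt v = latpt v *+ `|lform f z - b|%N by [].
  by rewrite -scaler_nat pmulrn gez0_abs // subr_ge0; apply: col_form_ge cf Az.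
move=> fx; have [s [s1 xE]] := lat_comb x.
suff -> : x = \sum_(p <- [seq (p.1, proj p.2) | p <- s]) p.1 *: p.2.
  apply: comb_hull_idem => //; exists [seq (p.1, proj p.2) | p <- s].
  split=> [_ /mapP[p _ ->]|//|//]; last by rewrite big_map.
  by split=> //; apply: projP.
rewrite big_map /=; under eq_bigr do rewrite scalerDr scalerA.
rewrite big_split /= -xE -scaler_suml.
suff -> : \sum_(i <- s) i.1 * (lform f i.2 - b)%:~R = 0 by rewrite scale0r addr0.
under eq_bigr do rewrite intrB mulrBr -rform_latpt.
rewrite sumrB -mulr_suml s1 mul1r; apply/eqP; rewrite subr_eq0 -fx xE; apply/eqP.
rewrite -(big_map (fun p => (p.1, latpt p.2)) xpredT (fun p => p.1 * rform fr p.2)).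
by rewrite -rform_comb big_map.
Qed.

Lemma base_face_facet : facet P (base_face f b).
Proof.
exists fr, b%:~R; split=> //.
  apply: polytope_ge => z Az; rewrite rform_latpt ler_int.
  exact: col_form_ge cf Az.
have f0 : fr != 0.
  apply/eqP => f0; have := rform_latpt Rr f v.
  rewrite f0 /rform mulmx0 mxE (col_form_self cf) => /eqP.
  by rewrite eq_sym intr_eq0.
have rkf : \rank (kermx fr) = n.-1.
  rewrite mxrank_ker; suff -> : \rank fr = 1%N by rewrite subn1.
  by apply/eqP; rewrite eqn_leq rank_leq_col lt0n mxrank_eq0.
exists n.-1.
  rewrite prednK // lt0n; apply/eqP => n0; case/eqP: f0.
  by apply/colP => i; have := ltn_ord i; rewrite {2}n0.
have [x Ax _] := affgen_high good_affgen cf.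
exists (latpt (x + v *+ `|lform f x - b|%N)).
have [B [Bfree Beq]] : exists B : 'M[Rr]_(n.-1, n), row_free B /\ (B :=: kermx fr)%MS.
  have := row_base_free (kermx fr); have := eq_row_base (kermx fr).
  by move: (row_base _); rewrite rkf => B; exists B.
exists B; split=> //; rewrite aff_hull_base_face; apply/seteqP.
have [_ fy] := base_face_proj Ax.
split=> y /=; rewrite Beq sub_kermx mulmxBl.
  move=> fy'; apply/eqP/matrixP => i j; rewrite !ord1 [LHS]mxE [X in _ + X]mxE.
  by rewrite -/(rform _ _) -/(rform _ _) fy fy' subrr mxE.
move=> /eqP/matrixP/(_ 0 0); rewrite [LHS]mxE [X in _ + X]mxE.
by rewrite -/(rform _ _) -/(rform _ _) fy mxE => /eqP; rewrite subr_eq0 => /eqP.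
Qed.

Lemma base_face_is_base : is_base_facet P v (base_face f b).
Proof.
split; first exact: base_face_facet.
move=> z Az nF; apply: (col_form_step cf Az).
rewrite lt_neqAle (col_form_ge cf Az) andbT; apply/eqP => fz.
by apply: nF; apply/base_face_latpt.
Qed.

(** Being constant on the projections of lattice points along [v], a facet form is a multiple of
    [f]; minimality on the face fixes the sign and surjectivity the absolute value. *)
Lemma is_facet_form_col g : is_facet_form P (base_face f b) g <-> g = f.
Proof.
have [x Ax fx] := affgen_high good_affgen cf.
split=> [[gsurj gconst gmin]|->].
  pose be := lform g (x + v *+ `|lform f x - b|%N).
  have gE z : lform g z + lform g v * (lform f z - b) = be.
    move: z; apply: good_affgen => [x' y z|z Az].
      by rewrite !lformB !lformD; lia.
    rewrite -(lform_proj g cf Az); apply/eqP; rewrite -subr_eq0 /be -lformB; apply/eqP.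
    by apply: gconst; rewrite aff_hullE; apply: comb_hull_sub => //;
      apply: base_face_proj.
  have gE' z : lform g z = - lform g v * lform f z.
    by have := gE z; have := gE 0; rewrite !lform0; lia.
  have := gmin (x + v *+ `|lform f x - b|%N) x (col_form_proj cf Ax)
    (base_face_proj Ax) Ax.
  rewrite -/(lform g _) -/(lform g _) (lform_proj g cf Ax) => gv.
  have [z gz] := gsurj 1; rewrite -/(lform g _) gE' in gz.
  have gv0 : lform g v <= 0 by nia.
  have fz0 : 0 < lform f z by nia.
  have gv1 : lform g v = -1 by nia.
  by apply: lform_inj => y; rewrite gE' gv1 opprK mul1r.
split.
- move=> k; exists (- k *: v).
  by rewrite -/(lform f _) lformZ (col_form_self cf) mulrN1 opprK.
- move=> y z; rewrite aff_hull_base_face /= !rform_latpt => /intr_inj fy /intr_inj fz.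
  by rewrite -/(lform f _) lformB fy fz subrr.
move=> y z Ay /base_face_latpt[_ fy] Az; rewrite -/(lform f _) -/(lform f _) fy.
exact: col_form_ge cf Az.
Qed.

End ColumnForm.

(** Otherwise all of [A] lies in the facet, whose affine hull then contains the whole lattice and
    has dimension [n], not [n - 1]. *)
Lemma facet_nontrivial F c b : (forall x, P x -> b <= rform c x) ->
  F = [set x | P x /\ rform c x = b] ->
  (exists2 d, n = d.+1 & has_dim F d) -> exists2 z, A z & b < rform c (latpt z).
Proof.
move=> cP FE [d nd [x0 [B [_ FB]]]]; apply: contrapT => nz.
have AF z : A z -> aff_hull F (latpt z).
  move=> Az; rewrite aff_hullE; apply: comb_hull_sub => //; rewrite FE; split=> //.
  apply/eqP; rewrite eq_le cP // andbT leNgt; apply/negP => lt_b.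
  by apply: nz; exists z.
have allB z : (latpt z - x0 <= B)%MS.
  by have := aff_hull_latpt AF z; rewrite FB.
have : (1%:M <= B)%MS.
  apply/row_subP => i; rewrite row1 -latpt_delta.
  have -> : latpt (delta_mx 0 i) = (latpt (delta_mx 0 i) - x0) - (latpt 0 - x0).
    by rewrite latpt0 sub0r opprK subrK.
  by apply: addmx_sub; rewrite ?eqmx_opp // allB.
move=> /mxrankS; rewrite mxrank1 => /leq_trans /(_ (rank_leq_row B)).
by rewrite nd ltnn.
Qed.

(* Iterating [z + v] from a lattice point reaches the base facet, so [c] takes
   values in [b + N gamma] on A, with gamma = - c v. *)
Lemma is_base_facet_col v F : v <> 0 -> is_base_facet P v F ->
  exists f b, col_form A v f b /\ F = base_face f b.
Proof.
move=> v0 [[c [b [cP FE dimF]]] stepv].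
rewrite -/(rform c _) in cP.
have {}cP x : P x -> b <= rform c x := cP x.
have {}FE : F = [set x | P x /\ rform c x = b] := FE.
have [x Ax cx] := facet_nontrivial cP FE dimF.
have {}stepv z : A z -> b < rform c (latpt z) -> A (z + v).
  move=> Az cz; apply: stepv => //; rewrite FE => -[_ cz'].
  by rewrite cz' ltxx in cz.
(* If [v] did not lower [c], it could be added forever to a point off the facet. *)
have cv : rform c (latpt v) < 0.
  rewrite ltNge; apply/negP => cv; apply: v0; apply: (good_noray (x := x)) => k.
  suff [] : A (x + v *+ k) /\ b < rform c (latpt (x + v *+ k)) by [].
  elim: k => [|k [Ak ck]]; first by rewrite mulr0n addr0.
  rewrite mulrSr addrA; split; first exact: stepv.
  by rewrite latptD rformD; apply: lt_le_trans ck _; rewrite lerDl.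
pose ga := - rform c (latpt v); have ga0 : 0 < ga by rewrite oppr_gt0.
have cA z : A z -> exists k : int, rform c (latpt z) = b + k%:~R * ga.
  have [N] : exists N : nat, rform c (latpt z) - b <= N%:R * ga.
    exists (Num.bound `|(rform c (latpt z) - b) / ga|).
    rewrite -ler_pdivrMr //.
    exact: ltW (le_lt_trans (ler_norm _) (archi_boundP (normr_ge0 _))).
  elim: N z => [|N IHN] z leN Az.
    exists 0; rewrite mul0r addr0; apply/eqP; rewrite eq_le (cP _ Az) andbT.
    by rewrite -subr_le0 (le_trans leN) ?mul0r.
  have [cz|] := ltP b (rform c (latpt z)); last first.
    by move=> cz; exists 0; rewrite mul0r addr0; apply/eqP; rewrite eq_le (cP _ Az) cz.
  have [|k kE] := IHN (z + v) _ (stepv _ Az cz).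
    rewrite latptD rformD -[rform c (latpt v)]opprK -/ga addrAC lerBlDr.
    by rewrite -[X in _ <= _ + X]mul1r -mulrDl natr1.
  exists (k + 1); rewrite intrD mulrDl mul1r addrA -kE latptD rformD /ga.
  by rewrite addrK.
have {}cA z : exists k : int, rform c (latpt z) = b + k%:~R * ga.
  move: z; apply: (good_affgen (H := [set z | exists k : int, _])) => //=.
  move=> z1 z2 z3 [k1 E1] [k2 E2] [k3 E3]; exists (k1 + k2 - k3).
  rewrite latptB latptD !rformD rformN E1 E2 E3 intrB intrD mulrBl mulrDl.
  by ring.
(* [h z] counts the steps of size [ga] above [b]. It is affine in [z], so its linear part [f] is
   read off at the unit vectors, and [f] takes the value [- h 0] on the facet. *)
have [h hE] := choice cA.
pose f : 'cV[int]_n := \col_i (h (delta_mx 0 i) - h 0).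
have b0 : b = - (h 0)%:~R * ga.
  by have := hE 0; rewrite latpt0 rform0 mulNr => /eqP; rewrite eq_sym addr_eq0 => /eqP.
have cE : c = ga *: map_mx intr f.
  apply/colP => i; rewrite !mxE -rform_delta -latpt_delta hE b0 -mulrDl addrC.
  by rewrite -intrB mulrC.
have cfE x' : rform c x' = ga * rform (map_mx intr f) x'.
  by rewrite cE /rform -scalemxAr mxE.
have bE : b = ga * (- h 0)%:~R by rewrite b0 mulrC intrN.
exists f, (- h 0); split; last first.
  rewrite FE; apply/seteqP; split=> y /= [Py] cy; split=> //.
    by apply: (mulfI (lt0r_neq0 ga0)); rewrite -cfE -bE.
  by rewrite cfE cy.
split=> [z Az|].
  have := cP _ Az; have := stepv _ Az; rewrite cfE bE ler_pM2l // ltr_pM2l //.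
  by rewrite rform_latpt ler_int ltr_int.
have e := cfE (latpt v); rewrite rform_latpt in e.
apply: (@intr_inj Rr); apply: (mulfI (lt0r_neq0 ga0)).
by rewrite -e intrN mulrN mulr1 opprK.
Qed.

Lemma ColP v : Col P v <-> exists f b, col_form A v f b.
Proof.
split=> [[v0 [F /(is_base_facet_col v0)[f [b [cf _]]]]]|[f [b cf]]].
  by exists f, b.
by split; [exact: col_form_neq0 cf|exists (base_face f b); apply: base_face_is_base].
Qed.

Lemma base_facetE v f b : col_form A v f b -> base_facet P v = base_face f b.
Proof.
move=> cf; rewrite /base_facet; case: xgetP => [F _ vF|/(_ (base_face f b))]; last first.
  by case; apply: base_face_is_base.
have [g [c [cg ->]]] := is_base_facet_col (col_form_neq0 cf) vF.
by have [-> ->] := col_form_uniq good_affgen cf cg.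
Qed.

Lemma facet_formE v f b z : col_form A v f b ->
  facet_form P (base_facet P v) z = lform f z.
Proof.
move=> cf; rewrite (base_facetE cf) /facet_form -/(lform _ _).
case: xgetP => [g _ /(is_facet_form_col cf) -> //|/(_ f) []].
exact/(is_facet_form_col cf).
Qed.

Lemma htE v f b z : col_form A v f b -> ht P (base_facet P v) z = lform f z - b.
Proof.
move=> cf; rewrite /ht (facet_formE _ cf); congr (_ - _).
have [x Ax fx] := affgen_high good_affgen cf.
rewrite /facet_min; case: xgetP => [c _ [[y Ay <-] ymin]|/(_ b) []].
  rewrite (facet_formE _ cf) in ymin *; apply/eqP; rewrite eq_le (col_form_ge cf Ay) andbT.
  have := ymin _ (col_form_proj cf Ax).
  by rewrite (facet_formE _ cf) (lform_proj f cf Ax) (col_form_self cf); lia.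
split=> [|z' Az']; rewrite ?(facet_formE _ cf); last exact: col_form_ge cf Az'.
exists (x + v *+ `|lform f x - b|%N); first exact: col_form_proj cf Ax.
by rewrite (facet_formE _ cf) (lform_proj f cf Ax) (col_form_self cf); lia.
Qed.

End Polytope.

(** * From isometric doublings to integral ones *)

Lemma incl_ord_max (K : zmodType) n (x : 'rV[K]_n) : incl x 0 ord_max = 0.
Proof. by rewrite mxE pad_out. Qed.

Lemma incl_mxK (K : pzRingType) n : incl_mx K n *m (incl_mx K n)^T = 1%:M.
Proof.
apply/row_matrixP => i; rewrite row_mul row1 -[RHS](padK (n := n)).
rewrite rowE -inclE; apply/rowP => j; rewrite !mxE (bigD1 (widen_ord (leqnSn n) j)) //=.
rewrite !mxE eqxx mulr1 big1 ?addr0 // => k kj; rewrite !mxE.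
case: eqP => [jk|_]; last by rewrite mulr0.
by case/eqP: kj; apply: val_inj; rewrite /= jk.
Qed.

Lemma mulmx_rank1 (K : comPzRingType) m n (x : 'rV[K]_m) (c : 'cV[K]_m) (y : 'rV[K]_n) :
  x *m (c *m y) = (x *m c) 0 0 *: y.
Proof. by rewrite mulmxA [x *m c]mx11_scalar mul_scalar_mx !mxE. Qed.

Lemma matrix_rowP (K : pzRingType) m n (M N : 'M[K]_(m, n)) :
  (forall x : 'rV[K]_m, x *m M = x *m N) -> M = N.
Proof. by move=> MN; apply/row_matrixP => i; rewrite !rowE. Qed.

Lemma sum_mulmx (K : comPzRingType) m n (M : 'M[K]_(m, n)) (s : seq (K * 'rV[K]_m)) :
  (\sum_(p <- s) p.1 *: p.2) *m M = \sum_(p <- s) p.1 *: (p.2 *m M).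
Proof. by rewrite mulmx_suml; apply: eq_bigr => p _; rewrite -scalemxAl. Qed.

Section Doubling.
Variables (Rr : realType) (n : nat) (P : set 'rV[Rr]_n) (Q : set 'rV[Rr]_n.+1).
Local Notation latpt := (@latpt Rr _).
Variables (v : 'rV[int]_n) (f : 'cV[int]_n) (b : int).
Hypothesis goodP : good_polytope P.
Hypothesis cf : col_form (latpts P) v f b.
Local Notation fr := (map_mx intr f : 'cV[Rr]_n).
Local Notation rmap M := (map_mx intr M : 'M[Rr]_(_, _)).

(* The embedding rho of the doubling differs from the inclusion by a map of
   rank 1, as it fixes the directions in the base facet. *)
Lemma doubling_rho x0 (rho : 'M[Rr]_(n, n.+1)) :
  base_face P f b (latpt x0) ->
  (forall x, base_face P f b x -> (x - latpt x0) *m rho = incl (x - latpt x0)) ->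
  rho = incl_mx Rr n + fr *m (incl (latpt v) - latpt v *m rho).
Proof.
(* [D] is forced by the value at [v], where [f] is -1. *)
move=> Fx0 rhoF; set D := incl _ - _; set rho' := incl_mx Rr n + fr *m D.
have rho'E x : x *m rho' = incl x + rform fr x *: D.
  by rewrite /rho' mulmxDr mulmx_rank1 -inclE.
have rho_v : latpt v *m rho = latpt v *m rho'.
  by rewrite rho'E rform_latpt (col_form_self cf) scaleN1r /D opprB addrC subrK.
have eq_lat z : (latpt z - latpt x0) *m rho = (latpt z - latpt x0) *m rho'.
  move: z; apply: (good_affgen goodP (H := [set z | _])) => /= [z1 z2 z3 H1 H2 H3|z Az].
    rewrite latptB latptD.
    have -> : latpt z1 + latpt z2 - latpt z3 - latpt x0 = (latpt z1 - latpt x0)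
        + (latpt z2 - latpt x0) - (latpt z3 - latpt x0).
      by apply/matrixP => i j; rewrite !mxE; ring.
    by rewrite !(mulmxDl, mulNmx) in H1 H2 H3 *; rewrite H1 H2 H3.
  rewrite /=; have Fy := base_face_proj cf Az.
  have := rhoF _ Fy; rewrite latptD latptMn => rhoy.
  set k := `|_|%N in rhoy Fy.
  have -> : latpt z - latpt x0 = (latpt z + latpt v *+ k - latpt x0) - latpt v *+ k.
    by rewrite addrAC addrK.
  rewrite mulmxBl [RHS]mulmxBl rhoy (rho'E (_ - _)).
  suff -> : rform fr (latpt z + latpt v *+ k - latpt x0) = 0.
    by rewrite scale0r addr0 -!scaler_nat -!scalemxAl rho_v.
  have [_ fx0] := Fx0; have [_ fy] := Fy.
  by rewrite rformD rformN fx0 -latptMn -latptD fy subrr.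
apply/row_matrixP => i; rewrite !rowE -latpt_delta.
have -> : latpt (delta_mx 0 i) = (latpt (delta_mx 0 i) - latpt x0) - (latpt 0 - latpt x0).
  by rewrite latpt0 sub0r opprK subrK.
by rewrite mulmxBl [RHS]mulmxBl !eq_lat.
Qed.

(** After the renaming of the lattice the metric data survive only in [delta], the difference of the
    two copies of a point of height 1, and the second copy of P becomes the graph of the height in
    the direction [delta]. *)
Lemma doubling_shape : is_doubling P (base_facet P v) Q ->
  exists delta : 'rV[int]_n.+1,
  (forall w : 'rV[int]_n.+1, exists z k, w = incl z + k *: delta) /\
  Q = conv_hull ([set incl x | x in P] `|`
    [set incl x + (rform fr x - b%:~R) *: latpt delta | x in P]).
Proof.
rewrite (base_facetE goodP cf) => -[x0 [nu [rho [phi [Fx0 _ [_ rhoF _]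
  [phiU phi_incl phi_lat] QE]]]]].
have := doubling_rho Fx0 rhoF; set D := incl _ - _ => rhoE.
have rho_phi x : x *m rho *m phi = incl x + rform fr x *: (D *m phi).
  by rewrite rhoE mulmxDr mulmx_rank1 -inclE mulmxDl phi_incl -scalemxAl.
have lat_phi z1 z2 : (incl (latpt z1) + latpt z2 *m rho) *m phi
    = latpt (incl (z1 + z2)) + (lform f z2)%:~R *: (D *m phi).
  by rewrite mulmxDl phi_incl rho_phi rform_latpt addrA -inclD latpt_incl latptD.
(* [D *m phi] is a lattice point because it is the image of the pair [(v, - v)]. *)
have [delta _ deltaE] : [set latpt z | z in setT] (D *m phi).
  rewrite -phi_lat; exists (v, - v) => //=.
  rewrite lat_phi subrr incl0 latpt0 add0r lformN (col_form_self cf) opprK.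
  by rewrite scale1r.
exists delta; split=> [w|].
  have : [set latpt z | z in setT] (latpt w) by exists w.
  rewrite -phi_lat => -[[z1 z2] _ /=]; rewrite lat_phi -deltaE -latptZ -latptD.
  by move=> /latpt_inj <-; exists (z1 + z2), (lform f z2).
have [_ fx0] := Fx0.
have graphE x : (incl (latpt x0) + (x - latpt x0) *m rho) *m phi
    = incl x + (rform fr x - b%:~R) *: latpt delta.
  rewrite mulmxDl phi_incl rho_phi addrA -inclD [_ + (x - _)]addrC subrK deltaE.
  by rewrite rformD rformN fx0.
rewrite QE !conv_hullE; apply/seteqP; split=> [_ [y + <-]|y].
  apply: (comb_hull_img (h := mulmxr phi)) => [s _|{}y]; first exact: sum_mulmx.
  by move=> [[x Px <-]|[x Px <-]] /=; [left|right]; exists x; rewrite ?phi_incl ?graphE.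
move=> Uy; exists (y *m invmx phi); last by rewrite mulmxKV.
move: y Uy; apply: (comb_hull_img (h := mulmxr (invmx phi))) => [s _|y].
  exact: sum_mulmx.
move=> [[x Px <-]|[x Px <-]] /=; [left|right]; exists x => //.
  by rewrite -{2}phi_incl mulmxK.
by rewrite -graphE mulmxK.
Qed.

Lemma doubling_split (delta : 'rV[int]_n.+1) :
  (forall w : 'rV[int]_n.+1, exists z k, w = incl z + k *: delta) ->
  exists (sigma : 'M[int]_(n.+1, n)) (kappa : 'cV[int]_n.+1),
  [/\ lform kappa delta = 1, delta *m sigma = 0,
      forall x, lform kappa (incl x) = 0, forall x, incl x *m sigma = x
    & forall z, z = incl (z *m sigma) + lform kappa z *: delta].
Proof.
move=> gen; set ep := delta 0 ord_max.
(* The last unit vector has the form [incl z + k *: delta], so the last entry of [delta] divides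
   1. *)
have ep2 : ep * ep = 1.
  have [z [k /rowP/(_ ord_max)]] := gen (delta_mx 0 ord_max).
  rewrite !mxE !eqxx pad_out // add0r -/ep => kep.
  have : (`|k| * `|ep|)%N == 1%N by rewrite -abszM -kep.
  rewrite muln_eq1 => /andP[_ /eqP ep1].
  by have [->|->] : ep = 1 \/ ep = -1 by lia.
pose kappa : 'cV[int]_n.+1 := ep *: delta_mx ord_max 0.
have kappaE z : lform kappa z = ep * z 0 ord_max.
  by rewrite /lform -scalemxAr mxE -colE mxE.
pose sigma := (1%:M - kappa *m delta) *m (incl_mx int n)^T.
have sigmaE z : z *m sigma = (z - lform kappa z *: delta) *m (incl_mx int n)^T.
  by rewrite mulmxA mulmxBr mulmx1 mulmx_rank1.
have kd : lform kappa delta = 1 by rewrite kappaE.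
have sd : delta *m sigma = 0 by rewrite sigmaE kd scale1r subrr mul0mx.
have ki x : lform kappa (incl x) = 0 by rewrite kappaE incl_ord_max mulr0.
have si x : incl x *m sigma = x.
  by rewrite sigmaE ki scale0r subr0 inclE -mulmxA incl_mxK mulmx1.
exists sigma, kappa; split=> // z; have [y [k ->]] := gen z.
by rewrite mulmxDl si -scalemxAl sd scaler0 addr0 lformD ki lformZ kd mulr1 add0r.
Qed.

Lemma doubling_lat : is_doubling P (base_facet P v) Q ->
  good_polytope Q /\ exists delta sigma kappa,
    lat_doubling (latpts P) f b (latpts Q) delta sigma kappa.
Proof.
move=> /doubling_shape[delta [/doubling_split[sigma [kappa [kd sd ki si dec]]] QE]].
set U := _ `|` _ in QE.
have dec1 : sigma *m incl_mx int n + kappa *m delta = 1%:M.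
  apply: matrix_rowP => z; rewrite mulmx1 [RHS]dec mulmxDr mulmx_rank1.
  by rewrite mulmxA -inclE.
have rincl : rmap (incl_mx int n) = incl_mx Rr n.
  by apply/matrixP => i j; rewrite !mxE; case: eqP.
have decr (y : 'rV[Rr]_n.+1) : y = incl (y *m rmap sigma)
    + rform (rmap kappa) y *: latpt delta.
  have : y *m rmap (sigma *m incl_mx int n + kappa *m delta) = y *m rmap 1%:M.
    by rewrite dec1.
  rewrite map_mx1 mulmx1 map_mxD !map_mxM mulmxDr mulmx_rank1 rincl mulmxA.
  by rewrite -inclE.
have rsi (x : 'rV[Rr]_n) : incl x *m rmap sigma = x.
  have siM : incl_mx int n *m sigma = 1%:M.
    by apply: matrix_rowP => z; rewrite mulmxA -inclE si mulmx1.
  by rewrite inclE -rincl -mulmxA -map_mxM siM map_mx1 mulmx1.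
have rki (x : 'rV[Rr]_n) : rform (rmap kappa) (incl x) = 0.
  have kiM : incl_mx int n *m kappa = 0.
    apply: matrix_rowP => z; rewrite mulmxA -inclE mulmx0.
    by apply/matrixP => i j; rewrite !ord1 -/(lform _ _) ki mxE.
  by rewrite /rform inclE -rincl -mulmxA -map_mxM kiM map_mx0 mulmx0 mxE.
have rsd : latpt delta *m rmap sigma = 0 by rewrite -map_mxM sd map_mx0.
have rkd : rform (rmap kappa) (latpt delta) = 1 by rewrite rform_latpt kd.
have ht0 x : P x -> 0 <= rform fr x - b%:~R.
  move=> Px; rewrite subr_ge0; apply: (polytope_ge goodP) Px => z Az.
  by rewrite rform_latpt ler_int; apply: col_form_ge cf Az.
have U_P y : U y -> [/\ P (y *m rmap sigma), 0 <= rform (rmap kappa) y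
    & b%:~R <= rform (rmap (sigma *m f - kappa)) y].
  have rfE y' : rform (rmap (sigma *m f - kappa)) y'
      = rform fr (y' *m rmap sigma) - rform (rmap kappa) y'.
    by rewrite /rform map_mxB map_mxM mulmxBr mulmxA !mxE.
  rewrite rfE => -[[x Px <-]|[x Px <-]].
    by rewrite rsi rki subr0; split=> //; rewrite -subr_ge0; apply: ht0.
  rewrite mulmxDl rsi -scalemxAl rsd scaler0 addr0 rformD rki rformZ rkd.
  by rewrite add0r mulr1 subKr; split=> //; apply: ht0.
(* The doubling as the region between the two copies of P; this is what makes its lattice points
   computable. *)
have Q_P y : Q y <-> [/\ P (y *m rmap sigma), 0 <= rform (rmap kappa) y
    & rform (rmap kappa) y <= rform fr (y *m rmap sigma) - b%:~R].
  split.
    rewrite QE conv_hullE => Qy; split.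
    - apply: (polytope_conv goodP); rewrite conv_hullE.
      move: y Qy; apply: (comb_hull_img (h := mulmxr (rmap sigma))) => [s _|y /U_P[]//].
      exact: sum_mulmx.
    - by apply: rform_comb_ge Qy => // y' /U_P[].
    have : b%:~R <= rform (rmap (sigma *m f - kappa)) y.
      by apply: rform_comb_ge Qy => // y' /U_P[].
    rewrite /rform map_mxB map_mxM mulmxBr mulmxA mxE [X in _ + X]mxE.
    by rewrite lerBrDr addrC -lerBrDr.
  move=> [Px t0 t1]; rewrite QE (decr y).
  set x := y *m _ in Px t1 *; set t := rform _ y in t0 t1 *.
  set h := rform _ _ - _ in t1.
  have Ux : conv_hull U (incl x).
    by rewrite conv_hullE; apply: comb_hull_sub; [exact: ler01|left; exists x].
  have Uhx : conv_hull U (incl x + h *: latpt delta).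
    by rewrite conv_hullE; apply: comb_hull_sub; [exact: ler01|right; exists x].
  (* A fibre of length 0 is a point; in a longer one the point at [t] is the convex combination of
     the two ends with weight [t / h]. *)
  have [h0|h0] := eqVneq h 0.
    have -> : t = 0 by apply/eqP; rewrite eq_le t0 -h0 t1.
    by rewrite scale0r addr0.
  have hpos : 0 < h by rewrite lt_neqAle eq_sym h0 (le_trans t0 t1).
  have -> : incl x + t *: latpt delta
      = (1 - t / h) *: incl x + (t / h) *: (incl x + h *: latpt delta).
    by rewrite scalerDr scalerA divfK // addrA -scalerDl subrK scale1r.
  by apply: conv_hull2 => //; rewrite divr_ge0 ?(ltW hpos) //= ler_pdivrMr ?mul1r.
have dbl : lat_doubling (latpts P) f b (latpts Q) delta sigma kappa.
  split=> // z; rewrite /latpts /= Q_P -map_mxM !rform_latpt -intrB !ler_int.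
  rewrite (ler_int _ 0).
  by split=> [[? -> ->]|[? /andP[-> ->]]].
split; last by exists delta, sigma, kappa.
split; last exact (dbl_affgen dbl cf (good_affgen goodP)).
have [[s PE] _] := goodP.
pose gr z := incl z + (lform f z - b) *: delta.
exists ([seq incl z | z <- s] ++ [seq gr z | z <- s]); rewrite QE.
have grE z : latpt (gr z) = incl (latpt z)
    + (rform fr (latpt z) - b%:~R) *: latpt delta.
  by rewrite latptD latptZ intrB rform_latpt latpt_incl.
rewrite !conv_hullE; apply/seteqP; split.
  apply: (subset_trans (B := comb_hull [set a | 0 <= a] (comb_hull [set a | 0 <= a]
     [set latpt z | z in [set` [seq incl z | z <- s] ++ [seq gr z | z <- s]]]))).
    apply: comb_hullS; rewrite subUset; split=> _ [x Px <-]; move: x Px; rewrite PE conv_hullE.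
      apply: (comb_hull_img (h := @incl Rr n)) => [t _|_ [z /= zs <-]].
        by rewrite inclE sum_mulmx; apply: eq_bigr => p _; rewrite inclE.
      exists (incl z); last by rewrite latpt_incl.
      by rewrite /= mem_cat map_f.
    apply: (comb_hull_img (h := fun x => incl x + (rform fr x - b%:~R) *: latpt delta)).
      move=> t t1; under [RHS]eq_bigr do rewrite scalerDr scalerA.
      rewrite big_split /= -scaler_suml; congr (_ + _ *: _).
        by rewrite inclE sum_mulmx; apply: eq_bigr => p _; rewrite inclE.
      under [RHS]eq_bigr do rewrite mulrBr.
      by rewrite sumrB -mulr_suml t1 mul1r rform_comb.
    move=> _ [z /= zs <-]; exists (gr z); last by rewrite grE.
    by rewrite /= mem_cat map_f ?orbT.
  by apply: comb_hull_idem => a c; apply: mulr_ge0.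
apply: comb_hullS => _ [w /= + <-].
have Pz z : z \in s -> P (latpt z).
  by move=> zs; rewrite PE conv_hullE; apply: comb_hull_sub; [exact: ler01|exists z].
rewrite mem_cat => /orP[] /mapP[z zs ->].
  by left; exists (latpt z); rewrite ?latpt_incl //; apply: Pz.
by right; exists (latpt z); rewrite ?grE //; apply: Pz.
Qed.

End Doubling.

(** * Stable column vectors *)

(* The combinatorial structure of the stable column vectors of a balanced
   polytope: [S] is the semigroup of the stable polytopal algebra, [ht v] the
   height over the base facet of [v], and [pr u v] stands for <P_v, u>. *)
Record column_axioms (T : zmodType) (S : set T) (C : eqType) (vec : C -> T)
    (pr : C -> C -> int) (ht : C -> T -> nat) : Prop := ColumnAxioms {
  cs_S0 : S 0;
  cs_inj : injective vec;
  cs_htD : forall v s t, S s -> S t -> ht v (s + t) = (ht v s + ht v t)%N;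
  cs_ht_vec : forall u v s, S s -> S (s + vec u) ->
    (ht v (s + vec u))%:Z = (ht v s)%:Z + pr u v;
  cs_step : forall v s, S s -> (0 < ht v s)%N -> S (s + vec v);
  cs_self : forall v, pr v v = - 1;
  cs_bound : forall u v, - 1 <= pr u v <= 1;
  cs_same : forall u v, pr u v = - 1 -> forall s, S s -> ht u s = ht v s;
  cs_prD : forall u v w z, vec w = vec u + vec v -> pr w z = pr u z + pr v z;
  cs_prN : forall u v z, vec u + vec v = 0 -> pr u z + pr v z = 0;
  cs_prod : forall u v, pr u v = 1 -> vec u + vec v <> 0 ->
    exists2 w, vec w = vec u + vec v & pr w u = - 1;
  cs_ht1 : forall v, exists2 s, S s & ht v s = 1%N;
  cs_fresh : forall u (vs : seq C) x, S x -> exists d d',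
    [/\ vec d + vec d' = 0, pr d u = - 1, {in vs, forall v, pr v d' = 0}
      & ht d' x = 0%N]
}.

HB.instance Definition _ (Rr : realType) n (P : set 'rV[Rr]_n)
  (PP : doubling_spectrum P) := gen_eqMixin (Col_stable PP).

Section StableColumns.
Variables (Rr : realType) (n : nat) (P : set 'rV[Rr]_n).
Variable PP : doubling_spectrum P.
Hypothesis goodP : good_polytope P.
Hypothesis balP : col_balanced (latpts P).
Local Notation lat := (nat -> int).
Local Notation A i := (latpts (PP i)).
Implicit Types (w : lat) (i j : nat).

Definition supp_le i w := pad (restr (i + n) w) = w.

Lemma restrD m (w1 w2 : lat) : restr m (w1 + w2) = restr m w1 + restr m w2.
Proof. by apply/rowP => j; rewrite !mxE. Qed.

Lemma restr0 m : restr m (0 : lat) = 0.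
Proof. by apply/rowP => j; rewrite !mxE. Qed.

Lemma supp_le_pad i (x : 'rV[int]_(i + n)) : supp_le i (pad x).
Proof. by rewrite /supp_le padK. Qed.

Lemma supp_leS i w : supp_le i w -> supp_le i.+1 w.
Proof. by move=> iw; rewrite /supp_le -iw; apply: pad_incl. Qed.

Lemma supp_le_le i j w : (i <= j)%N -> supp_le i w -> supp_le j w.
Proof. by move=> /subnK <-; elim: (j - i)%N => // k IHk /IHk /supp_leS. Qed.

Lemma supp_leD i w1 w2 : supp_le i w1 -> supp_le i w2 -> supp_le i (w1 + w2).
Proof. by move=> i1 i2; rewrite /supp_le restrD padD i1 i2. Qed.

Lemma incl_restr i w : supp_le i w -> incl (restr (i + n) w) = restr (i.+1 + n) w.
Proof. by rewrite /incl => ->. Qed.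

Lemma good_stage i : good_polytope (PP i) /\ col_balanced (A i).
Proof.
elim: i => [|i [gi bi]]; first by rewrite stage0.
have [v /(ColP gi)[f [b cf]] dbl] := stageS PP i.
have [gQ [d [si [ka ld]]]] := doubling_lat gi cf dbl.
by split=> //; apply: (dbl_balanced ld cf (good_affgen gi) (good_noray gi) bi).
Qed.

Definition stage_form i w (f : 'cV[int]_(i + n)) b :=
  supp_le i w /\ col_form (A i) (restr (i + n) w) f b.
Arguments stage_form : clear implicits.

Lemma stage_form_uniq i w f g b c : stage_form i w f b -> stage_form i w g c ->
  f = g /\ b = c.
Proof.
by move=> [_ cf] [_ cg]; apply: (col_form_uniq (good_affgen (good_stage i).1) cf cg).
Qed.

Lemma stage_formS i w f b : stage_form i w f b -> exists2 h, stage_form i.+1 w h b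
  & forall x : lat, supp_le i x ->
    lform h (restr (i.+1 + n) x) = lform f (restr (i + n) x).
Proof.
move=> [iw cw]; have [gi _] := good_stage i.
have [v /(ColP gi)[f0 [b0 cf0]] dbl] := stageS PP i.
have [_ [d [si [ka ld]]]] := doubling_lat gi cf0 dbl.
have [h ch] := dbl_col ld cf0 (good_affgen gi) cw.
exists h.
  by split; [exact: supp_leS|rewrite -incl_restr].
move=> x ix; rewrite -(incl_restr ix).
by have [_ ->] := dbl_col_restr ld cf0 (good_affgen gi) cw ch.
Qed.

Lemma stage_form_le i j w f b : (i <= j)%N -> stage_form i w f b ->
  exists2 h, stage_form j w h b & forall x : lat, supp_le i x ->
    lform h (restr (j + n) x) = lform f (restr (i + n) x).
Proof.
move=> le_ij; rewrite -(subnK le_ij); elim: (j - i)%N => [|k IHk] cw; first by exists f.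
have [h ch hf] := IHk cw; have [h' ch' hh'] := stage_formS ch.
exists h' => // x ix; rewrite hh' ?hf //.
by apply: supp_le_le ix; rewrite leq_addl.
Qed.

Lemma col_stage (w : Col_stable PP) : exists i, exists f b, stage_form i w f b.
Proof.
have [i [v [/(ColP (good_stage i).1)[f [b cf]] wE]]] := col_valP w.
exists i, f, b; split; first by rewrite wE; apply: supp_le_pad.
by rewrite wE padK.
Qed.

Lemma stage_form_stable i w f b : stage_form i w f b -> stable_col PP w.
Proof.
move=> [iw cw]; exists i, (restr (i + n) w); split; last by rewrite iw.
by apply/(ColP (good_stage i).1); exists f, b.
Qed.

(* The affine function [<P_w, x> - k b] of the cone over the stable polytope. *)
Definition stable_ht w (t : lat * int) : int := xget 0 [set N | exists i f b,
  [/\ stage_form i w f b, supp_le i t.1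
    & lform f (restr (i + n) t.1) - t.2 * b = N]].

Lemma stable_htE i w f b t : stage_form i w f b -> supp_le i t.1 ->
  stable_ht w t = lform f (restr (i + n) t.1) - t.2 * b.
Proof.
move=> cf it; rewrite /stable_ht.
case: xgetP => [N _ [j [g [c [cg jt <-]]]]|/(_ (lform f (restr (i + n) t.1) - t.2 * b))[]].
  have [h ch hf] := stage_form_le (leq_maxl i j) cf.
  have [h' ch' hg] := stage_form_le (leq_maxr i j) cg.
  have [hh' bc] := stage_form_uniq ch ch'.
  by rewrite -(hf _ it) -(hg _ jt) hh' bc.
by exists i, f, b.
Qed.

Definition col_vec (w : Col_stable PP) : lat * int := (w : lat, 0).
(** The second component 0 of [col_vec u] removes the constant [b], so this height is <P_v, u>. *)
Definition stable_pr (u v : Col_stable PP) : int := stable_ht v (col_vec u).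
Definition stable_S : set (lat * int) := [set t | exists i, stageSP PP i t].
(** On other sequences [stable_ht] has the default value 0, so additivity is claimed only here. *)
Definition finsupp (t : lat * int) := exists i, supp_le i t.1.

Lemma common_stage (us : seq (Col_stable PP)) (ts : seq (lat * int)) :
  (forall t, t \in ts -> finsupp t) ->
  exists i, (forall u, u \in us -> exists f b, stage_form i u f b) /\
    (forall t, t \in ts -> supp_le i t.1).
Proof.
move=> tsP; elim: us => [|u us [i [iu it]]].
  elim: ts tsP => [|t ts IHts] tsP; first by exists 0%N.
  have [s st|i [_ it]] := IHts; first by apply: tsP; rewrite inE st orbT.
  have [j jt] := tsP _ (mem_head _ _); exists (maxn i j); split=> // s.
  rewrite inE => /predU1P[->|/it]; first exact: supp_le_le (leq_maxr _ _) jt.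
  exact: supp_le_le (leq_maxl _ _).
have [j [g [c cg]]] := col_stage u; exists (maxn i j).
split=> [v|t /it]; last exact: supp_le_le (leq_maxl _ _).
rewrite inE => /predU1P[->|/iu[f [b cf]]].
  by have [h ch _] := stage_form_le (leq_maxr i j) cg; exists h, c.
by have [h ch _] := stage_form_le (leq_maxl i j) cf; exists h, b.
Qed.

Lemma finsupp_vec u : finsupp (col_vec u).
Proof. by have [i [f [b [iu _]]]] := col_stage u; exists i. Qed.

Lemma stageSP_seq i t : stageSP PP i t <->
  exists2 s : seq 'rV[int]_(i + n), (forall z, z \in s -> A i z)
  & t = \sum_(z <- s) (pad z, 1).
Proof.
have sumE (s : seq ('rV[int]_(i + n) * int)) : \sum_(z <- s) (pad z.1, z.2) =
    (pad (\sum_(z <- s) z).1, (\sum_(z <- s) z).2).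
  elim: s => [|z s IHs]; first by rewrite !big_nil pad0.
  by rewrite !big_cons IHs padD.
split=> [[_ [s [sP ->]] <-]|[s sP ->]].
  exists [seq z.1 | z <- s].
    by move=> _ /mapP[z /sP[y Ay <-] ->].
  rewrite -sumE big_map !big_seq; apply: eq_bigr => z /sP[y _ <-].
  by [].
exists (\sum_(z <- s) (z, 1)).
  exists [seq (z, 1) | z <- s]; split; last by rewrite big_map.
  by move=> _ /mapP[z /sP Az ->]; exists z.
by rewrite -(big_map (fun z => (z, 1)) xpredT id) -sumE big_map.
Qed.

Lemma supp_le_sum i (s : seq 'rV[int]_(i + n)) :
  supp_le i (\sum_(z <- s) (pad z, 1 : int)).1.
Proof.
elim: s => [|z s IHs]; first by rewrite big_nil /supp_le restr0 pad0.
by rewrite big_cons; apply: supp_leD => //; apply: supp_le_pad.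
Qed.

Lemma finsupp_S t : stable_S t -> finsupp t.
Proof. by move=> [i /stageSP_seq[s _ ->]]; exists i; apply: supp_le_sum. Qed.

Lemma stable_S_stage t : stable_S t -> exists i0, forall i, (i0 <= i)%N -> stageSP PP i t.
Proof. by move=> [i it]; exists i => j le_ij; apply: stageSP_le le_ij _ it. Qed.

Lemma stable_htD (w : Col_stable PP) s t : finsupp s -> finsupp t ->
  stable_ht w (s + t) = stable_ht w s + stable_ht w t.
Proof.
move=> fs ft; have [|i [iw it]] := @common_stage [:: w] [:: s; t].
  by move=> r; rewrite !inE => /orP[] /eqP ->.
have [f [b cf]] := iw _ (mem_head _ _).
have si : supp_le i s.1 by apply: it; rewrite !inE eqxx.
have ti : supp_le i t.1 by apply: it; rewrite !inE eqxx orbT.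
rewrite !(stable_htE cf) //; last exact: supp_leD.
by rewrite [(s + t).1]/= restrD lformD mulrDl; ring.
Qed.

Lemma stable_ht0 (w : Col_stable PP) : stable_ht w 0 = 0.
Proof.
have := @stable_htD w 0 0.
have f0 : finsupp 0 by exists 0%N; rewrite /supp_le restr0 pad0.
by move=> /(_ f0 f0); rewrite addr0; lia.
Qed.

Lemma stage_sum_ht i (w : Col_stable PP) f b (s : seq 'rV[int]_(i + n)) :
  stage_form i w f b ->
  stable_ht w (\sum_(z <- s) (pad z, 1)) = \sum_(z <- s) (lform f z - b).
Proof.
move=> cf; elim: s => [|z s IHs]; first by rewrite !big_nil stable_ht0.
rewrite !big_cons stable_htD ?IHs //; last 2 first.
- by exists i; apply: supp_le_pad.
- by exists i; apply: supp_le_sum.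
rewrite (stable_htE cf) ?padK ?mul1r //; exact: supp_le_pad.
Qed.

Lemma stable_ht_ge0 (w : Col_stable PP) t : stable_S t -> 0 <= stable_ht w t.
Proof.
move=> /stable_S_stage[i0 it]; have [i [f [b cf]]] := col_stage w.
have [h ch _] := stage_form_le (leq_maxl i i0) cf.
have /stageSP_seq[s sA ->] := it _ (leq_maxr i i0).
rewrite (stage_sum_ht _ ch) big_seq sumr_ge0 // => z /sA Az.
by rewrite subr_ge0; apply: col_form_ge Az; apply: ch.2.
Qed.

(** A sum of positive height has a summand of positive height, and moving that summand alone by [w]
    moves the sum. *)
Lemma stable_step (w : Col_stable PP) t : stable_S t -> 0 < stable_ht w t ->
  stable_S (t + col_vec w).
Proof.
move=> /stable_S_stage[i0 it]; have [i [f [b cf]]] := col_stage w.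
have [h ch _] := stage_form_le (leq_maxl i i0) cf.
have /stageSP_seq[s sA ->] := it _ (leq_maxr i i0).
set j := maxn i i0 in h ch s sA *; rewrite (stage_sum_ht _ ch) => hs.
exists j; elim: s sA hs => [|z s IHs] sA; first by rewrite big_nil ltxx.
have Az : A j z by apply: sA; rewrite mem_head.
have sA' y : y \in s -> A j y by move=> ys; apply: sA; rewrite inE ys orbT.
rewrite !big_cons; have [lt_b _|le_b] := ltrP b (lform h z).
  rewrite addrAC; apply: stageSPD; last by apply/stageSP_seq; exists s.
  apply/stageSP_seq; exists [:: z + restr (j + n) w].
    by move=> y; rewrite inE => /eqP ->; apply: col_form_step Az lt_b; apply: ch.2.
  by rewrite big_seq1 padD ch.1; congr (_, _); rewrite /= addr0.
have hz : lform h z - b = 0 by have := col_form_ge ch.2 Az; lia.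
rewrite hz add0r => hs; rewrite -addrA; apply: stageSPD; last exact: IHs.
by apply/stageSP_seq; exists [:: z] => [y|]; rewrite ?big_seq1 // inE => /eqP ->.
Qed.

Lemma pr_stage (u v : Col_stable PP) : exists i f g b c,
  [/\ stage_form i u g c, stage_form i v f b
    & stable_pr u v = lform f (restr (i + n) u)].
Proof.
have [|i [iu it]] := @common_stage [:: u; v] [::]; first by [].
have [g [c cg]] : exists g c, stage_form i u g c by apply: iu; rewrite !inE eqxx.
have [f [b cf]] : exists g c, stage_form i v g c by apply: iu; rewrite !inE eqxx orbT.
exists i, f, g, b, c; split=> //.
by rewrite /stable_pr (stable_htE cf) ?mul0r ?subr0 //; apply: cg.1.
Qed.

Lemma stable_prE i (u v : Col_stable PP) f b : stage_form i v f b -> supp_le i u ->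
  stable_pr u v = lform f (restr (i + n) u).
Proof. by move=> cf iu; rewrite /stable_pr (stable_htE cf) // mul0r subr0. Qed.

Lemma stable_same u v i g c f b : stable_pr u v = - 1 ->
  stage_form i u g c -> stage_form i v f b -> g = f /\ c = b.
Proof.
move=> uv cg cf; have := stable_prE cf cg.1; rewrite uv => fu.
case: (col_form_ge0 (good_affgen (good_stage i).1) cg.2 cf.2) => //.
by rewrite -fu.
Qed.

Lemma stable_fresh u (vs : seq (Col_stable PP)) x : stable_S x -> exists d d',
  [/\ col_vec d + col_vec d' = 0, stable_pr d u = - 1,
      {in vs, forall v, stable_pr v d' = 0} & stable_ht d' x = 0].
Proof.
move=> Sx; have [i1 xi] := stable_S_stage Sx.
have [|i [iu _]] := @common_stage (u :: vs) [::]; first by [].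
have [g0 [c0 cg0]] := iu _ (mem_head _ _).
have [g cg _] := stage_form_le (leq_maxl i i1) cg0.
have Cu : Col (PP (maxn i i1)) (restr (maxn i i1 + n) u).
  by apply/(ColP (good_stage _).1); exists g, c0; apply: cg.2.
(* The facet of [u] is doubled at some stage [j] not before those of [vs] and [x]; the form [ka] of
   [d'], whose minimum is 0, vanishes on everything that old. *)
have [j le_j dbl] := stage_all PP _ _ Cu.
rewrite cg.1 in dbl.
have [f cf _] := stage_form_le le_j cg.
have [gj _] := good_stage j.
have [_ [de [si [ka ld]]]] := doubling_lat gj cf.2 dbl.
pose f1 := si *m f - ka.
have formd : stage_form j.+1 (pad de) f1 c0.
  split; first exact: (@supp_le_pad j.+1).
  by rewrite padK; apply: dbl_col_delta ld.
have formd' : stage_form j.+1 (pad (- de)) ka 0.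
  split; first exact: (@supp_le_pad j.+1).
  by rewrite padK; apply: dbl_col_opp ld.
have formu : stage_form j.+1 u f1 c0.
  split; first exact: supp_leS cf.1.
  by rewrite -(incl_restr cf.1); apply: dbl_col_same ld _ cf.2.
pose d := ColStable (stage_form_stable formd).
pose d' := ColStable (stage_form_stable formd').
have d'0 (y : lat) k : supp_le j y -> stable_ht d' (y, k) = 0.
  move=> jy; rewrite (stable_htE (w := d') formd') ?mulr0 ?subr0; last exact: supp_leS.
  by rewrite -(incl_restr jy) (dbl_kappa_incl ld).
exists d, d'; split.
- by congr (_, _); rewrite /= -padD subrr pad0.
- rewrite (stable_prE formu) ?padK; first exact: col_form_self (dbl_col_delta ld).
  exact: formd.1.
- move=> v vvs; have [h [e ch]] := iu v (mem_behead (s := u :: _) vvs).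
  apply: d'0; apply: supp_le_le ch.1.
  exact: leq_trans (leq_maxl _ _) le_j.
case: x Sx xi => y k Sx xi; apply: d'0.
have /stageSP_seq[s _] := xi _ (leq_trans (leq_maxr _ _) le_j).
by move=> /(congr1 fst) /= ->; apply: supp_le_sum.
Qed.

Lemma col_val_inj : injective (fun w : Col_stable PP => (w : lat)).
Proof.
move=> [w wP] [w' wP'] /= ww'; move: wP wP'; rewrite ww' => wP wP'.
by congr ColStable; apply: Prop_irrelevance.
Qed.

Lemma stable_column_axioms :
  column_axioms stable_S col_vec stable_pr (fun v t => `|stable_ht v t|%N).
Proof.
have ge0 := stable_ht_ge0; have fS := finsupp_S; have fv := finsupp_vec.
(* The upper bound is balancedness; a negative value forces equal base facets, hence -1. *)
have pr1 u v : - 1 <= stable_pr u v <= 1.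
  have [i [f [g [b [c [cg cf ->]]]]]] := pr_stage u v.
  rewrite ((good_stage i).2 _ _ _ _ _ _ cg.2 cf.2) andbT.
  case: (col_form_ge0 (good_affgen (good_stage i).1) cg.2 cf.2) => [[<- _]|]; last by lia.
  by rewrite (col_form_self cg.2).
split=> //.
- by exists 0%N; apply: stageSP0.
- by move=> u v [/col_val_inj].
- move=> v s t Ss St; rewrite stable_htD; [|exact: fS..].
  by have := ge0 v s Ss; have := ge0 v t St; lia.
- move=> u v s Ss Ssu; have := ge0 v _ Ssu; have := ge0 v s Ss.
  by rewrite stable_htD ?fv //; [rewrite /stable_pr; lia|exact: fS].
- by move=> v s Ss lt0; apply: stable_step => //; have := ge0 v s Ss; lia.
- move=> v; have [i [f [g [b [c [cg cf ->]]]]]] := pr_stage v v.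
  exact: col_form_self cf.2.
- move=> u v uv s Ss; congr `|_|%N.
  have [|i [iu it]] := @common_stage [:: u; v] [:: s].
    by move=> r; rewrite !inE => /eqP ->; apply: fS.
  have [g [c cg]] : exists g c, stage_form i u g c by apply: iu; rewrite !inE eqxx.
  have [f [b cf]] : exists g c, stage_form i v g c by apply: iu; rewrite !inE eqxx orbT.
  have [gf cb] := stable_same uv cg cf.
  have si := it _ (mem_head _ _).
  by rewrite (stable_htE cg si) (stable_htE cf si) gf cb.
- by move=> u v w z wE; rewrite /stable_pr wE stable_htD.
- by move=> u v z uv; rewrite /stable_pr -stable_htD // uv stable_ht0.
- move=> u v uv uv0; have [i [f [g [b [c [cg cf uvE]]]]]] := pr_stage u v.
  have cw : stage_form i ((u : lat) + (v : lat)) g c.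
    split; first exact: supp_leD cg.1 cf.1.
    have [gi _] := good_stage i.
    rewrite restrD; apply: (col_form_prod (good_affgen gi) (good_noray gi) cg.2 cf.2).
      by rewrite -uvE uv.
    move=> ruv0; apply: uv0; congr (_, _) => /=.
    by rewrite -cg.1 -cf.1 -padD ruv0 pad0.
  exists (ColStable (stage_form_stable cw)); first by congr (_, _); rewrite /= addr0.
  by rewrite (stable_prE cg) /=; [exact: col_form_self cw.2|exact: cw.1].
- move=> v; have [i [f [b cf]]] := col_stage v.
  have [x Ax fx] := affgen_height1 (good_affgen (good_stage i).1) cf.2.
  exists (pad x, 1).
    by exists i; apply/stageSP_seq; exists [:: x] => [y|]; rewrite ?big_seq1 // inE => /eqP ->.
  rewrite (stable_htE cf) /= ?padK ?fx; last exact: supp_le_pad.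
  by lia.
move=> u vs x Sx; have [d [d' [dd' du vd' d'x]]] := stable_fresh u vs Sx.
by exists d, d'; rewrite d'x.
Qed.

End StableColumns.

(** * Elementary automorphisms *)

Section Binomial.
Variables (K : comPzRingType) (U V X : K).

Lemma binom_const h :
  \sum_(k < h.+1) (V ^+ k *+ 'C(h, k)) * X = (1 + V) ^+ h * X.
Proof. by rewrite addrC exprD1n mulr_suml. Qed.

Lemma binom_level h :
  \sum_(k < h.+1) (V ^+ k *+ 'C(h, k)) * ((1 + U) ^+ (h - k) * X)
  = (1 + U + V) ^+ h * X.
Proof.
rewrite exprDn mulr_suml; apply: eq_bigr => k _.
by rewrite !mulrnAl; congr (_ *+ _); rewrite mulrA; congr (_ * _); rewrite mulrC.
Qed.

(** With N = - U V the base on the right is 1 + U by [binom_shift_base]; this is the commutator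
    relation of elementary automorphisms on one monomial. *)
Lemma binom_shift N a b :
  \sum_(k < a.+1) (1 + N) ^+ (a - k) *
    ((U ^+ k *+ 'C(a, k)) * ((1 + V) ^+ (b + k) * X))
  = (1 + V) ^+ b * ((1 + N + U * (1 + V)) ^+ a * X).
Proof.
rewrite (exprDn (1 + N)) mulr_suml mulr_sumr; apply: eq_bigr => k _.
rewrite exprMn exprD; move: (1 + V) (1 + N) => Y Z.
rewrite !(mulrnAl, mulrnAr); congr (_ *+ _).
by move: (U ^+ k) (Y ^+ b) (Y ^+ k) (Z ^+ _) => *; ring.
Qed.

Lemma binom_swap h : (1 + U + V) ^+ h * X = (1 + V + U) ^+ h * X.
Proof. by rewrite addrAC. Qed.

Lemma binom_shift_base : 1 + U = 1 + - (U * V) + U * (1 + V).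
Proof. by rewrite mulrDr mulr1 [U + _]addrC addrA subrK. Qed.

End Binomial.

Section MonoidAlgebra.
Variables (R : comPzRingType) (M : nmodType).
Local Notation A := (monoid_alg R M).
Implicit Types (a b : A) (m : M) (c : R) (D : set M).

Lemma ma_coefD a b m : (a + b)@_m = a@_m + b@_m.
Proof. exact: mcoeffD. Qed.

Lemma ma_coefZ c a m : (c *: a)@_m = c * a@_m.
Proof. exact: ma_scaleE. Qed.

Lemma ma_coef0 m : (0 : A)@_m = 0.
Proof. exact: mcoeff0. Qed.

Lemma ma_coef_sum I (r : seq I) (F : I -> A) m :
  (\sum_(i <- r) F i)@_m = \sum_(i <- r) (F i)@_m.
Proof. by elim/big_rec2: _ => [|i x y _ <-]; rewrite ?ma_coef0 ?ma_coefD. Qed.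

Lemma ma_coef_mon m k : (mon R m)@_k = (m == k)%:R.
Proof. by rewrite mcoeffU. Qed.

Lemma ma_scaleAr c a b : c *: (a * b) = a * (c *: b).
Proof. by rewrite mulrC scale_mmull mulrC. Qed.

Lemma ma_exprZn c a k : (c *: a) ^+ k = c ^+ k *: a ^+ k.
Proof.
elim: k => [|k IHk]; first by rewrite !expr0 scale1r.
by rewrite !exprS IHk -scale_mmull -ma_scaleAr scalerA.
Qed.

Lemma mon_expr m k : mon R m ^+ k = mon R (m *+ k).
Proof. by elim: k => [|k IHk]; rewrite ?expr0 ?mon0 // exprS mulrS IHk -monD. Qed.

Lemma ma_decomp a : a = \sum_(m <- msupp a) a@_m *: mon R m.
Proof.
rewrite [LHS]monE; apply: eq_bigr => m _; apply/malgP => k.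
by rewrite [RHS]ma_coefZ ma_coef_mon mcoeffU mulr_natr.
Qed.

Definition spanned D : set A := [set a | forall m, a@_m <> 0 -> D m].

Lemma spanned_ind (K : A -> Prop) D : K 0 -> (forall a b, K a -> K b -> K (a + b)) ->
  (forall c m, D m -> K (c *: mon R m)) -> forall a, spanned D a -> K a.
Proof.
move=> K0 KD Km a Da; rewrite (ma_decomp a) big_seq.
elim/big_rec: _ => // m b; rewrite -mcoeff_neq0 => /eqP /Da Dm.
by apply: KD; apply: Km.
Qed.

Lemma spanned0 D : spanned D 0.
Proof. by move=> m; rewrite ma_coef0. Qed.

Lemma spannedD D a b : spanned D a -> spanned D b -> spanned D (a + b).
Proof.
move=> Da Db m; rewrite ma_coefD.
by have [->|/Da//] := pselect (a@_m = 0); rewrite add0r => /Db.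
Qed.

Lemma spannedZ D c a : spanned D a -> spanned D (c *: a).
Proof. by move=> Da m; rewrite ma_coefZ => ca; apply: Da => a0; rewrite a0 mulr0 in ca. Qed.

Lemma spannedMn D a k : spanned D a -> spanned D (a *+ k).
Proof. by move=> Da; rewrite -scaler_nat; apply: spannedZ. Qed.

Lemma spannedB D a b : spanned D a -> spanned D b -> spanned D (a - b).
Proof. by move=> Da Db; apply: spannedD => //; rewrite -scaleN1r; apply: spannedZ. Qed.

Lemma spanned_mon D m : D m -> spanned D (mon R m).
Proof. by move=> Dm k; rewrite ma_coef_mon; case: eqP => [<-|//]. Qed.

Lemma spanned_sum D I (r : seq I) (F : I -> A) :
  (forall i, spanned D (F i)) -> spanned D (\sum_(i <- r) F i).
Proof. by move=> DF; elim/big_ind: _ => //; [exact: spanned0|exact: spannedD]. Qed.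

Lemma spannedS D D' : D `<=` D' -> spanned D `<=` spanned D'.
Proof. by move=> DD' a Da m /Da /DD'. Qed.

Definition ma_ext (phi : M -> A) (a : A) : A := \sum_(m <- msupp a) a@_m *: phi m.

Lemma ma_ext_widen phi (d : {fset M}) a : (msupp a `<=` d)%fset ->
  ma_ext phi a = \sum_(m <- d) a@_m *: phi m.
Proof.
move=> le_d; apply: big_fset_incl => // m _ /mcoeff_outdom ->.
by rewrite scale0r.
Qed.

Lemma ma_ext_linear phi : linear (ma_ext phi).
Proof.
move=> c a b.
pose d := (msupp a `|` msupp b `|` msupp (c *: a + b))%fset.
have da : (msupp a `<=` d)%fset by rewrite /d -fsetUA fsubsetUl.
have db : (msupp b `<=` d)%fset by rewrite /d fsetUAC fsubsetUr.
have dab : (msupp (c *: a + b) `<=` d)%fset by rewrite fsubsetUr.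
rewrite (ma_ext_widen phi da) (ma_ext_widen phi db) (ma_ext_widen phi dab).
rewrite scaler_sumr -big_split /=; apply: eq_bigr => m _.
by rewrite ma_coefD ma_coefZ scalerDl scalerA.
Qed.

HB.instance Definition _ phi :=
  GRing.isLinear.Build R A A *:%R (ma_ext phi) (ma_ext_linear phi).

Lemma ma_ext_mon phi m : ma_ext phi (mon R m) = phi m.
Proof.
rewrite (ma_ext_widen phi (d := [fset m]%fset)) ?msuppU_le // big_seq_fset1.
by rewrite ma_coef_mon eqxx scale1r.
Qed.

End MonoidAlgebra.

Section Elementary.
Variables (R : comPzRingType) (T : zmodType) (S : set T) (C : eqType).
Variables (vec : C -> T) (pr : C -> C -> int) (ht : C -> T -> nat).
Hypothesis cs : column_axioms S vec pr ht.
Local Notation A := (monoid_alg R T).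
Implicit Types (u v w : C) (lam mu : R) (a b : A) (s t : T).

Definition elem_base v lam : A := 1 + lam *: mon R (vec v).

(** Defined on the whole group algebra, where the factor [elem_base v lam] lives; multiplicativity
    is available on [spanned S], where heights are additive. *)
Definition elem v lam : A -> A :=
  ma_ext (fun t => elem_base v lam ^+ ht v t * mon R t).

HB.instance Definition _ v lam := GRing.Linear.on (elem v lam).

Lemma elem_mon v lam t : elem v lam (mon R t) = elem_base v lam ^+ ht v t * mon R t.
Proof. exact: ma_ext_mon. Qed.

Lemma ht0 v : ht v 0 = 0%N.
Proof. by have := cs_htD cs v (cs_S0 cs) (cs_S0 cs); rewrite addr0; lia. Qed.

Lemma col_iter v s k : S s -> (k <= ht v s)%N -> S (s + vec v *+ k) /\
  forall u, (ht u (s + vec v *+ k))%:Z = (ht u s)%:Z + pr v u * k%:Z.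
Proof.
move=> Ss; elim: k => [|k IHk] le_k.
  by rewrite mulr0n addr0; split=> // u; rewrite mulr0 addr0.
have [Sk hk] := IHk (ltnW le_k); rewrite mulrSr addrA.
have Sk1 : S (s + vec v *+ k + vec v).
  by apply: (cs_step cs) => //; have := hk v; rewrite (cs_self cs); lia.
by split=> // u; rewrite (cs_ht_vec cs) // hk; lia.
Qed.

Lemma elem_level v lam h a : spanned [set t | S t /\ ht v t = h] a ->
  elem v lam a = elem_base v lam ^+ h * a.
Proof.
move: a; apply: spanned_ind => [|a b IHa IHb|c t [St <-]].
- by rewrite linear0 mulr0.
- by rewrite linearD /= IHa IHb mulrDr.
by rewrite linearZ /= elem_mon ma_scaleAr.
Qed.

Lemma elem_expand v lam t k :
  (lam *: mon R (vec v)) ^+ k * mon R t = lam ^+ k *: mon R (t + vec v *+ k).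
Proof. by rewrite ma_exprZn mon_expr -scale_mmull -monD addrC. Qed.

Lemma elem_monE v lam t : elem v lam (mon R t) =
  \sum_(k < (ht v t).+1) (lam ^+ k *+ 'C(ht v t, k)) *: mon R (t + vec v *+ k).
Proof.
rewrite elem_mon /elem_base addrC exprD1n mulr_suml; apply: eq_bigr => k _.
by rewrite mulrnAl elem_expand scalerMnl.
Qed.

Lemma elem_base0 v : elem_base v 0 = 1.
Proof. by rewrite /elem_base scale0r addr0. Qed.

Lemma elem0 v a : spanned S a -> elem v 0 a = a.
Proof.
move: a; apply: spanned_ind => [|a b IHa IHb|c t St]; rewrite ?linear0 //.
  by rewrite linearD /= IHa IHb.
by rewrite linearZ /= elem_mon elem_base0 expr1n mul1r.
Qed.

Lemma elem_span v lam (D : set T) a :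
  (forall t k, D t -> (k <= ht v t)%N -> D (t + vec v *+ k)) ->
  spanned D a -> spanned D (elem v lam a).
Proof.
move=> Dv; move: a; apply: spanned_ind => [|a b IHa IHb|c t Dt].
- by rewrite linear0; apply: spanned0.
- by rewrite linearD; apply: spannedD.
rewrite linearZ; apply: spannedZ; rewrite /= elem_monE; apply: spanned_sum => k.
by apply: spannedZ; apply: spanned_mon; apply: Dv => //; rewrite -ltnS.
Qed.

Lemma elem_S v lam a : spanned S a -> spanned S (elem v lam a).
Proof. by apply: elem_span => t k St /(col_iter St)[]. Qed.

Lemma elemM v lam a b : spanned S a -> spanned S b ->
  elem v lam (a * b) = elem v lam a * elem v lam b.
Proof.
move=> + Sb; move: a; apply: spanned_ind => [|a a' IHa IHa'|c t St].
- by rewrite mul0r linear0 mul0r.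
- by rewrite mulrDl !linearD /= IHa IHa' mulrDl.
rewrite -scale_mmull !linearZ /= -scale_mmull; congr (_ *: _).
move: b Sb; apply: spanned_ind => [|b b' IHb IHb'|c' t' St'].
- by rewrite mulr0 linear0 mulr0.
- by rewrite mulrDr !linearD /= IHb IHb' mulrDr.
rewrite -ma_scaleAr !linearZ /= -ma_scaleAr; congr (_ *: _).
by rewrite -monD !elem_mon (cs_htD cs) // exprD monD mulrACA.
Qed.

Lemma elem1 v lam : elem v lam 1 = 1.
Proof. by rewrite -(mon0 R T) elem_mon ht0 expr0 mul1r. Qed.

Lemma eq_on_mon (f g : {linear A -> A}) :
  (forall s, S s -> f (mon R s) = g (mon R s)) ->
  forall a, spanned S a -> f a = g a.
Proof.
move=> fg; apply: spanned_ind => [|a b fa fb|c t St].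
- by rewrite !linear0.
- by rewrite !linearD /= fa fb.
by rewrite !linearZ /= fg.
Qed.

Lemma elem_elem u v lam mu s : S s -> elem u lam (elem v mu (mon R s)) =
  \sum_(k < (ht v s).+1) ((mu *: mon R (vec v)) ^+ k *+ 'C(ht v s, k)) *
    (elem_base u lam ^+ (ht u (s + vec v *+ k)) * mon R s).
Proof.
move=> Ss; rewrite elem_monE linear_sum; apply: eq_bigr => k _.
rewrite linearZ /= elem_mon ma_scaleAr -scalerMnl -elem_expand.
set X := (mu *: mon R (vec v)) ^+ k; set Y := elem_base u lam ^+ _; set m := binomial _ _.
by rewrite -[X * _ *+ m]mulrnAl (mulrCA Y).
Qed.

(** Each step by [v] lowers the common height by 1, and the binomial theorem merges the two
    factors. *)
Lemma elem_same u v lam mu s : S s -> pr u v = - 1 ->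
  elem u lam (elem v mu (mon R s)) =
  (1 + lam *: mon R (vec u) + mu *: mon R (vec v)) ^+ ht v s * mon R s.
Proof.
move=> Ss uv; rewrite elem_elem //.
apply: etrans (binom_level _ _ _ _); apply: eq_bigr => k _.
have [Sk hk] := col_iter Ss (ltn_ord k : (k <= ht v s)%N).
have hu := cs_same cs uv; have -> : ht u (s + vec v *+ k) = (ht v s - k)%N.
  by rewrite hu //; have := hk v; rewrite (cs_self cs); have := ltn_ord k; lia.
by [].
Qed.

Lemma elem_add v lam mu a : spanned S a ->
  elem v lam (elem v mu a) = elem v (lam + mu) a.
Proof.
apply: (eq_on_mon (f := elem v lam \o elem v mu)) => s Ss /=.
by rewrite elem_same ?(cs_self cs) // -addrA -scalerDl elem_mon.
Qed.

(** Steps by [v] leave the height for [u] unchanged, so the two factors multiply independently. *)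
Lemma elem_transverse u v lam mu s : S s -> pr v u = 0 ->
  elem u lam (elem v mu (mon R s)) =
  elem_base v mu ^+ ht v s * (elem_base u lam ^+ ht u s * mon R s).
Proof.
move=> Ss vu; rewrite elem_elem //.
apply: etrans (binom_const _ _ _); apply: eq_bigr => k _.
have [Sk hk] := col_iter Ss (ltn_ord k : (k <= ht v s)%N).
suff -> : ht u (s + vec v *+ k) = ht u s by [].
by have := hk u; rewrite vu; lia.
Qed.

(** Equal height functions have equal increments, and the increment along [z] is visible at a point
    of height 1 over the facet of [z]. *)
Lemma same_pr u v z : pr u v = - 1 -> pr z u = pr z v.
Proof.
move=> uv; have [s Ss hs] := cs_ht1 cs z.
have Sz : S (s + vec z) by apply: (cs_step cs); rewrite ?hs.
have := cs_ht_vec cs u Ss Sz; have := cs_ht_vec cs v Ss Sz.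
by rewrite !(cs_same cs uv) //; lia.
Qed.

Lemma same_sym u v : pr u v = - 1 -> pr v u = - 1.
Proof. by move=> uv; rewrite (same_pr v uv) (cs_self cs). Qed.

Lemma elem_comm u v lam mu a : spanned S a -> pr u v <> 1 -> pr v u <> 1 ->
  elem u lam (elem v mu a) = elem v mu (elem u lam a).
Proof.
move=> + uv vu.
apply: (eq_on_mon (f := elem u lam \o elem v mu) (g := elem v mu \o elem u lam)).
move=> s Ss; rewrite [LHS]/= [RHS]/=.
have [uv1|uv1] := eqVneq (pr u v) (- 1).
  have vu1 := same_sym uv1; rewrite (elem_same lam mu Ss uv1) (elem_same mu lam Ss vu1) (cs_same cs uv1 Ss).
  exact: binom_swap.
have vu1 : pr v u != -1 by apply/eqP => /same_sym vu1; rewrite vu1 in uv1.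
have := cs_bound cs u v; have := cs_bound cs v u => bvu buv.
have uv0 : pr u v = 0 by lia.
have vu0 : pr v u = 0 by lia.
rewrite (elem_transverse lam mu Ss vu0) (elem_transverse mu lam Ss uv0).
exact: mulrCA.
Qed.

(** On the right, the k-th term of e_u on a monomial has height [ht u s - k] over the facet of [u],
    which is also that of [w], and e_v preserves this height. So e_w multiplies the term by a fixed
    power, and a binomial identity remains. *)
Lemma elem_prod u v w lam mu a : spanned S a ->
  pr u v = 1 -> vec u + vec v <> 0 -> vec w = vec u + vec v ->
  elem u lam (elem v mu a) = elem w (- (lam * mu)) (elem v mu (elem u lam a)).
Proof.
move=> + uv uv0 wE.
apply: (eq_on_mon (f := elem u lam \o elem v mu)
  (g := elem w (- (lam * mu)) \o elem v mu \o elem u lam)) => s Ss.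
rewrite [LHS]/= [RHS]/=.
have wu : pr w u = - 1.
  have [w' w'E] := cs_prod cs uv uv0; suff -> : w = w' by [].
  by apply: (cs_inj cs); rewrite wE.
have vu : pr v u = 0 by have := cs_prD cs u wE; rewrite wu (cs_self cs); lia.
rewrite (elem_transverse lam mu Ss vu) (elem_elem v u mu lam Ss) linear_sum.
pose U : A := lam *: mon R (vec u); pose V : A := mu *: mon R (vec v).
pose N : A := - (lam * mu) *: mon R (vec w).
transitivity (\sum_(k < (ht u s).+1) (1 + N) ^+ (ht u s - k) *
    ((U ^+ k *+ 'C(ht u s, k)) * ((1 + V) ^+ (ht v s + k) * mon R s))).
  apply: etrans (esym (binom_shift U V (mon R s) N _ _)).
  have NE : N = - (U * V).
    by rewrite /N wE monD /U /V -scale_mmull -ma_scaleAr scalerA scaleNr.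
  have eU : 1 + U = 1 + N + U * (1 + V) by rewrite NE; apply: binom_shift_base.
  exact: (congr1 (fun X => (1 + V) ^+ ht v s * (X ^+ ht u s * mon R s)) eU).
apply: eq_bigr => k _.
have [Sk hk] := col_iter Ss (ltn_ord k : (k <= ht u s)%N).
have -> : ht v (s + vec u *+ k) = (ht v s + k)%N by have := hk v; rewrite uv; lia.
apply: esym; apply: (@elem_level w _ (ht u s - k)%N).
rewrite mulrnAl; apply: spannedMn.
rewrite (mulrCA (U ^+ k)) elem_expand -ma_scaleAr; apply: spannedZ.
have -> : elem_base v mu ^+ (ht v s + k) * mon R (s + vec u *+ k) =
    elem v mu (mon R (s + vec u *+ k)).
  rewrite elem_mon; congr (_ ^+ _ * _).
  by have := hk v; rewrite uv; lia.
rewrite elem_monE; apply: spanned_sum => j.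
apply: spannedZ; apply: spanned_mon.
have [Sj hj] := col_iter Sk (ltn_ord j : (j <= ht v (s + vec u *+ k))%N).
split=> //.
rewrite (cs_same cs wu) //; have := hj u; have := hk u.
by rewrite vu (cs_self cs); have := ltn_ord k; lia.
Qed.

End Elementary.

(** * Words in elementary automorphisms *)

Lemma ltn_count (X : eqType) (p q : pred X) (l : seq X) x :
  {in l, forall y, p y -> q y} -> x \in l -> q x -> ~~ p x ->
  (count p l < count q l)%N.
Proof.
elim: l => //= y l IHl pq; rewrite inE => /predU1P[<-|xl] qx px.
  rewrite qx (negbTE px) add0n ltnS (@eq_in_count _ p (predI p q)) => [|z zl /=].
    by apply: sub_count => z /andP[].
  by case pz : (p z) => //=; rewrite (pq z) // inE zl orbT.
have := IHl (fun z zl => pq z (mem_behead (s := y :: l) zl)) xl qx px.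
have := pq y (mem_head _ _); case: (p y) => [->//|_]; last by lia.
Qed.

Lemma order1_split0 (V : zmodType) (w m x : V) : w = m + x + (w - m - x).
Proof. by rewrite addrC -(addrA w) -opprD subrK. Qed.

Lemma order1_split (V : zmodType) (e1 e2 e3 m z x y : V) :
  e1 + e2 + e3 - m - (z + x) = (e1 - m - z) + (e2 - x) + (e3 - y) + y.
Proof.
by rewrite -[RHS]addrA subrK opprD !addrA [LHS](AC 6%AC (1 * 4 * 5 * 2 * 6 * 3)%AC).
Qed.

Section Words.
Variables (R : comPzRingType) (T : zmodType) (S : set T) (C : eqType).
Variables (vec : C -> T) (pr : C -> C -> int) (ht : C -> T -> nat).
Hypothesis cs : column_axioms S vec pr ht.
Local Notation A := (monoid_alg R T).
Implicit Types (u v w d : C) (lam mu : R) (a b : A) (s t : T) (l : seq (C * R)).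

Definition elem_word l a : A := foldr (fun p b => elem vec ht p.1 p.2 b) a l.

Lemma elem_word_linear l : linear (elem_word l).
Proof. by elim: l => [|p l IHl] c a b //=; rewrite IHl linearP. Qed.

HB.instance Definition _ l :=
  GRing.isLinear.Build R A A *:%R (elem_word l) (elem_word_linear l).

Lemma pr_opp u v : vec u + vec v = 0 -> pr u v = 1.
Proof. by move=> uv; have := cs_prN cs v uv; rewrite (cs_self cs); lia. Qed.

Lemma elem_ht_span v lam d m a : pr v d = 0 ->
  spanned [set t | S t /\ ht d t = m] a ->
  spanned [set t | S t /\ ht d t = m] (elem vec ht v lam a).
Proof.
move=> vd Da; apply: elem_span Da => t k [St htm] le_k.
have [Sk hk] := col_iter cs St le_k; split=> //.
by have := hk d; rewrite vd; lia.
Qed.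

(* In degree 0 with respect to the facet of [-d], commutation of the word with
   the elementary automorphism of [-d] transports triviality of the word from
   [s + h d], which has height 0 over the facet of [v], to [s]. *)
Lemma central_word l s : S s ->
  (forall v a, spanned S a ->
    elem_word l (elem vec ht v 1 a) = elem vec ht v 1 (elem_word l a)) ->
  elem_word l (mon R s) = mon R s.
Proof.
(* Induction on the number of letters of positive height at [s]; if there is none, every letter
   fixes the monomial. *)
move=> + comm; pose N s := count (fun p : C * R => (0 < ht p.1 s)%N) l.
have [m] := ubnP (N s); elim: m s => // m IHm s ltN Ss.
have [/hasP[[v lam] vl /= hv]|] := boolP (has (fun p : C * R => (0 < ht p.1 s)%N) l); last first.
  rewrite -all_predC => /allP h0.
  suff triv l' : {subset l' <= l} -> elem_word l' (mon R s) = mon R s by apply: triv.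
  elim: l' => //= p l' IHl sub; rewrite IHl => [|q ql]; last by apply: sub; rewrite inE ql orbT.
  rewrite elem_mon; have /= := h0 _ (sub _ (mem_head _ _)).
  by rewrite -eqn0Ngt => /eqP ->; rewrite expr0 mul1r.
have [d [d' [dd' dv vd' d's]]] := cs_fresh cs v [seq p.1 | p <- l] Ss.
set h := ht v s in hv.
have hd : ht d s = h by apply: (cs_same cs).
have dd1 := pr_opp dd'.
have prl p : p \in l -> pr p.1 d' = 0 by move=> pl; apply: vd'; apply: map_f.
have [Sy hy] : S (s + vec d *+ h) /\ _ := col_iter cs Ss (eq_leq (esym hd)).
set y := s + _ in Sy hy.
(* Moving along [d] raises no height: pairing 1 with [d] means -1 with [d'], and then the letter
   would have the base facet of [d'], against [prl]. *)
have hle p : p \in l -> (ht p.1 y <= ht p.1 s)%N.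
  move=> pl; have := hy p.1; have := cs_bound cs d p.1.
  suff : pr d p.1 <> 1 by nia.
  move=> dp; have d'p : pr d' p.1 = -1 by have := cs_prN cs p.1 dd'; rewrite dp; lia.
  by have := same_sym cs d'p; rewrite prl.
have trivy : elem_word l (mon R y) = mon R y.
  apply: IHm => //; rewrite ltnS in ltN; apply: leq_trans ltN; rewrite /N.
  have yv : (0 < ht v y)%N = false.
    by have := hy v; rewrite dv; lia.
  apply: (ltn_count (x := (v, lam))) => //=; last by rewrite yv.
  by move=> p /hle /=; lia.
have hd'y : ht d' y = h by have := hy d'; rewrite dd1 d's; lia.
have yh : y + vec d' *+ h = s.
  rewrite /y -addrA -mulrnDl dd' mul0rn addr0.
  by [].
have stay l' (k : nat) a : {subset l' <= l} ->
    spanned [set t | S t /\ ht d' t = k] a ->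
    spanned [set t | S t /\ ht d' t = k] (elem_word l' a).
  elim: l' => //= p l' IHl sub Da; apply: elem_ht_span.
    by apply: prl; apply: sub; rewrite mem_head.
  by apply: IHl => // q ql; apply: sub; rewrite inE ql orbT.
have := comm d' _ (spanned_mon Sy); rewrite trivy elem_monE linear_sum hd'y /=.
move=> /eqP; rewrite -subr_eq0 -sumrB => /eqP eq0.
apply/malgP => t.
have lev0 : spanned [set t | S t /\ ht d' t = 0%N] (elem_word l (mon R s)).
  by apply: stay => //; apply: spanned_mon.
have [[St t0]|nt] := pselect (S t /\ ht d' t = 0%N); last first.
  have z a : spanned [set t | S t /\ ht d' t = 0%N] a -> a@_t = 0.
    by move=> Da; have [//|/Da] := pselect (a@_t = 0).
  by rewrite !z //; apply: spanned_mon.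
have := congr1 (fun a : A => a@_t) eq0; rewrite /= ma_coef_sum ma_coef0.
(* Of the terms [y + vec d' *+ k] only the last, [k = h], has degree 0; it is [s] itself, with
   coefficient 1. *)
rewrite big_ord_recr /= big1 => [|k _]; last first.
  have le_k : (k <= ht d' y)%N by rewrite hd'y ltnW.
  have [Sk hk] := col_iter cs Sy le_k.
  set Dk := [set t | S t /\ ht d' t = (h - k)%N].
  have Dyk : Dk (y + vec d' *+ k).
    by split=> //; have := hk d'; rewrite hd'y (cs_self cs); have := ltn_ord k; lia.
  have : spanned Dk (elem_word l ((1 ^+ k *+ 'C(h, k)) *: mon R (y + vec d' *+ k))
      - (1 ^+ k *+ 'C(h, k)) *: mon R (y + vec d' *+ k)).
    apply: spannedB; last by apply: spannedZ; apply: spanned_mon.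
    by apply: stay => //; apply: spannedZ; apply: spanned_mon.
  set a := _ - _ => Da; have [//|/Da[_]] := pselect (a@_t = 0).
  by rewrite t0; have := ltn_ord k; lia.
rewrite add0r yh binn mulr1n expr1n scale1r.
have -> : (elem_word l (mon R s) - mon R s)@_t = (elem_word l (mon R s))@_t - (mon R s)@_t.
  exact: mcoeffB.
by move/eqP; rewrite subr_eq0 => /eqP.
Qed.

Section Injectivity.
Variables (d : C) (ep : int).
Hypothesis ep1 : ep = 1 \/ ep = - 1.

(** The sign [ep] treats letters of degree 1 and -1 alike: both kinds raise [deg]. *)
Let deg t := ep * (ht d t)%:Z.
Let Fil m := spanned (R := R) [set t | S t /\ m <= deg t].

Lemma elem_filter v lam m a : ep * pr v d = 1 -> Fil m a ->
  Fil (m + 1) (elem vec ht v lam a - a).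
Proof.
move=> vd; move: a; apply: spanned_ind => [|a b IHa IHb|c t [St le_m]].
- by rewrite linear0 subr0; apply: spanned0.
- by rewrite linearD /= opprD addrACA; apply: spannedD.
rewrite linearZ /= -scalerBr; apply: spannedZ.
rewrite elem_monE big_ord_recl /= bin0 expr0 mulr1n mulr0n addr0 scale1r addrAC.
rewrite subrr add0r; apply: spanned_sum => k.
apply: spannedZ; apply: spanned_mon.
have [Sk hk] := col_iter cs St (ltn_ord k : (lift ord0 k <= ht v t)%N).
split=> //; rewrite /deg hk mulrDr mulrA vd -/(deg t) mul1r.
by have : (0 < lift ord0 k)%N by []; lia.
Qed.

Lemma filterS m m' a : m' <= m -> Fil m a -> Fil m' a.
Proof. by move=> le_m; apply: spannedS => t /= [St le_t]; split=> //; lia. Qed.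

(** The correction made by one letter lies one degree up and a correction of a correction two, so
    modulo the latter the word acts through the sum of its letters. *)
Lemma elem_word_order1 l s : S s -> {in l, forall p, ep * pr p.1 d = 1} ->
  Fil (deg s + 2) (elem_word l (mon R s) - mon R s
    - \sum_(p <- l) (p.2 *+ ht p.1 s) *: mon R (s + vec p.1)).
Proof.
move=> Ss; elim: l => [|[v lam] l IHl] ld; first by rewrite big_nil subrr subr0; apply: spanned0.
have vd : ep * pr v d = 1 := ld _ (mem_head _ _).
have ld' : {in l, forall p, ep * pr p.1 d = 1}.
  by move=> p pl; apply: ld; rewrite inE pl orbT.
have Fs : Fil (deg s) (mon R s) by apply: spanned_mon.
have Fsv w k : ep * pr w d = 1 -> Fil (deg s + 1) ((k *+ ht w s) *: mon R (s + vec w)).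
  move=> wd; case hw : (ht w s) => [|h]; first by rewrite mulr0n scale0r; apply: spanned0.
  have Sw : S (s + vec w) by apply: (cs_step cs); rewrite ?hw.
  apply: spannedZ; apply: spanned_mon; split=> //.
  by rewrite /deg (cs_ht_vec cs d Ss Sw) mulrDr wd.
rewrite big_cons /=; set X := \sum_(p <- l) _; have FX : Fil (deg s + 1) X.
  rewrite /X big_seq; elim/big_ind: _ => [|a b|p /ld' pd].
  - exact: spanned0.
  - exact: spannedD.
  - exact: Fsv.
set Y := elem_word l (mon R s) - mon R s - X in (IHl); have FY : Fil (deg s + 2) Y := IHl ld'.
have -> : elem_word l (mon R s) = mon R s + X + Y.
  exact: order1_split0.
set E := elem vec ht v lam; set Z := _ *: mon R (s + vec v).
have FEs : Fil (deg s + 2) (E (mon R s) - mon R s - Z).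
  rewrite /E elem_monE; case hv : (ht v s) => [|h].
    rewrite big_ord_recl big_ord0 /= bin0 mulr1n mulr0n !addr0 expr0 scale1r subrr.
    by rewrite /Z hv mulr0n scale0r subr0; apply: spanned0.
  rewrite big_ord_recl big_ord_recl /= bin0 bin1 !mulr1n mulr0n !addr0 expr0 expr1 scale1r.
  rewrite /Z hv (addrC (mon R s)) addrK (addrC (_ *: _)) addrK.
  apply: spanned_sum => k; apply: spannedZ; apply: spanned_mon.
  have le_k : (1 + (1 + k) <= ht v s)%N by rewrite hv; have := ltn_ord k; lia.
  have [Sk hk] := col_iter cs Ss le_k; split=> //.
  by rewrite /deg hk mulrDr mulrA vd -/(deg s) mul1r; lia.
have FEX := elem_filter (lam := lam) vd FX; have FEY := elem_filter (lam := lam) vd FY.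
have -> : E (mon R s + X + Y) = E (mon R s) + E X + E Y by rewrite /E (linearD _ (_ + X)) (linearD _ _ X).
have -> : E (mon R s) + E X + E Y - mon R s - (Z + X)
    = (E (mon R s) - mon R s - Z) + (E X - X) + (E Y - Y) + Y.
  exact: order1_split.
apply: spannedD => //; apply: spannedD; last by apply: filterS FEY; lia.
by apply: spannedD => //; apply: filterS FEX; lia.
Qed.

(** At a monomial of height 1 over the facet of [w], the coefficient at [s + vec w] of the
    first-order part is this sum. *)
Lemma elem_word_inj l w : {in l, forall p, ep * pr p.1 d = 1} ->
  (forall s, S s -> elem_word l (mon R s) = mon R s) ->
  \sum_(p <- l | p.1 == w) p.2 = 0.
Proof.
move=> ld triv; have [/hasP[q ql /eqP qw]|] := boolP (has (fun p => p.1 == w) l); last first.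
  by rewrite -all_predC => /allP nw; rewrite big_seq_cond big1 // => p /andP[/nw /= /negP].
have wd : ep * pr w d = 1 by rewrite -qw; apply: ld.
have [s Ss hw] := cs_ht1 cs w.
have Sw : S (s + vec w) by apply: (cs_step cs); rewrite ?hw.
have := elem_word_order1 Ss ld; rewrite triv // subrr sub0r.
set X := \sum_(p <- l) _ => FX.
have : (- X)@_(s + vec w) = 0.
  have [//|/FX[_]] := pselect ((- X)@_(s + vec w) = 0).
  by rewrite /deg (cs_ht_vec cs d Ss Sw) mulrDr wd; lia.
rewrite -scaleN1r ma_coefZ mulN1r ma_coef_sum => /eqP; rewrite oppr_eq0 => /eqP X0; rewrite -[RHS]X0.
rewrite big_mkcond. apply: eq_bigr => p _; rewrite ma_coefZ ma_coef_mon.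
rewrite (inj_eq (addrI s)) (inj_eq (cs_inj cs)); case: eqP => [->|_].
  by rewrite hw mulr1n mulr1.
by rewrite mulr0.
Qed.

End Injectivity.

End Words.

(** * Steinberg groups and central extensions *)

Section ColumnPairing.
Variables (T : zmodType) (S : set T) (C : eqType) (vec : C -> T).
Variables (pr : C -> C -> int) (ht : C -> T -> nat).
Hypothesis cs : column_axioms S vec pr ht.
Implicit Types u v w d e z : C.

Lemma vec_neq0 w : vec w <> 0.
Proof.
by move=> w0; have := @cs_prN _ _ _ _ _ _ cs w w w; rewrite w0 addr0 (cs_self cs) => /(_ erefl).
Qed.

(** As <P_w, w> is -1, exactly one of [u], [v] shares the base facet of [w], and additivity over the
    facet of the other forces the pairing to be 1. *)
Lemma sum_pr w u v : vec w = vec u + vec v -> pr u v = 1 \/ pr v u = 1.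
Proof.
move=> wE; have prw z : pr w z = pr u z + pr v z := cs_prD cs z wE.
have prw' := prw w; rewrite (cs_self cs) in prw'.
have [uw|vw] : pr u w = -1 /\ pr v w = 0 \/ pr u w = 0 /\ pr v w = -1.
- by have := cs_bound cs u w; have := cs_bound cs v w; lia.
- left; have := prw v; rewrite (cs_self cs).
  have := cs_bound cs w v; have := cs_bound cs u v.
  suff : pr w v <> -1 by lia.
  by move=> /(same_pr cs v); rewrite (cs_self cs); lia.
right; have := prw u; rewrite (cs_self cs).
have := cs_bound cs w u; have := cs_bound cs v u.
suff : pr w u <> -1 by lia.
by move=> /(same_pr cs u); rewrite (cs_self cs); lia.
Qed.

Lemma prod_pr u v w : pr u v = 1 -> vec w = vec u + vec v ->
  pr w u = -1 /\ pr v u = 0.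
Proof.
move=> uv wE; have [|w' w'E w'u] := cs_prod cs uv.
  by rewrite -wE; apply: vec_neq0.
have ww' : w = w' by apply: (cs_inj cs); rewrite wE.
split; first by rewrite ww'.
by have := cs_prD cs u w'E; rewrite w'u (cs_self cs); lia.
Qed.

(* A doubling along the base facet of [w] provides a vector [d] with the same
   base facet as [w] (the difference of the two copies) and its opposite [d']. *)
Definition splitting w d d' := vec d + vec d' = 0 /\ pr d w = - 1.

Lemma splitting_same w d d' z : splitting w d d' -> pr z d = pr z w.
Proof. by move=> [_ dw]; apply: (same_pr cs). Qed.

Lemma splitting_trans u w d d' : pr w u = - 1 -> splitting u d d' -> splitting w d d'.
Proof. by move=> wu [dd' du]; split=> //; rewrite (same_pr cs d wu). Qed.

Lemma splitting_opp w d d' z : splitting w d d' -> pr d' z = - pr d z.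
Proof. by move=> [dd' _]; have := cs_prN cs z dd'; lia. Qed.

(** A value 1 would give [v] the base facet of [d'], a value -1 that of [w]; both are excluded. *)
Lemma splitting_transverse w d d' v : splitting w d d' -> pr v d' = 0 ->
  pr v w <> -1 -> pr d v = 0.
Proof.
move=> dsp vd' vw; have := cs_bound cs d v => bd.
have dv1 : pr d v <> 1.
  move=> dv; have d'v : pr d' v = -1 by rewrite (splitting_opp v dsp) dv.
  by have := same_sym cs d'v; rewrite vd'.
suff : pr d v <> -1 by lia.
move=> dv; apply: vw; have [_ dw] := dsp.
by rewrite -(splitting_same v dsp); apply: (same_sym cs).
Qed.

(** [e] is w - d, obtained as the product of [d'] and [w]; it therefore inherits the base facet of
    [d']. *)
Lemma splitting_rest w d d' : splitting w d d' -> pr w d' = 0 ->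
  exists e, [/\ vec e = vec d' + vec w, vec w = vec d + vec e, pr d e = 1,
    forall z, pr z e = pr z d' & forall z, pr e z = pr w z - pr d z].
Proof.
move=> dsp wd'; have [dd' dw] := dsp.
have dd1 : pr d d' = 1 := pr_opp cs dd'.
have d'w : pr d' w = 1 by rewrite (splitting_opp w dsp) dw.
have n0 : vec d' + vec w <> 0.
  move=> d'w0; suff wd : w = d by move: wd'; rewrite wd dd1.
  by apply: (cs_inj cs); apply: (addrI (vec d')); rewrite d'w0 addrC.
have [e eE ed'] := cs_prod cs d'w n0; exists e.
have ze z : pr z e = pr z d' := same_pr cs z ed'.
split=> // [||z]; first by rewrite eE addrA dd' add0r.
  by rewrite ze.
by rewrite (cs_prD cs z eE) (splitting_opp z dsp) addrC.
Qed.

Lemma fresh_splitting w (vs : seq C) : exists d d', splitting w d d' /\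
  {in vs, forall v, pr v d' = 0}.
Proof.
have [d [d' [dd' dw vd' _]]] := cs_fresh cs w vs (cs_S0 cs).
by exists d, d'.
Qed.

End ColumnPairing.

(** * Commutators and central extensions *)

Local Open Scope group_scope.

(* [x, y] = x y x^-1 y^-1, unlike [~ x, y] in the library. *)
Definition lcomm (G : groupType) (x y : G) : G := x * y * x^-1 * y^-1.

Section Commutators.
Variable G : groupType.
Implicit Types x y z : G.

Lemma lcomm1P x y : lcomm x y = 1 <-> commute x y.
Proof.
rewrite /lcomm /commute; split=> [/eqP|->]; last by rewrite mulgK mulgV.
by rewrite -(inj_eq (mulIg (y * x))) mul1g !mulgA mulgVK mulgVK => /eqP.
Qed.

Lemma lcommV x y : (lcomm x y)^-1 = lcomm y x.
Proof. by rewrite /lcomm !invgM !invgK !mulgA. Qed.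

Lemma lcomm_conj z x y : z * lcomm x y * z^-1 = lcomm (z * x * z^-1) (z * y * z^-1).
Proof. by rewrite /lcomm !invgM !invgK !mulgA !mulgVK. Qed.

Lemma lcommMr x y z : lcomm x (y * z) = lcomm x y * (y * lcomm x z * y^-1).
Proof. by rewrite /lcomm !invgM !mulgA !mulgVK. Qed.

Lemma commuteP x y : commute x y <-> x * y * x^-1 = y.
Proof.
rewrite /commute; split=> [->|{2}<-]; first by rewrite mulgK.
by rewrite mulgVK.
Qed.

Lemma commuteM x y z : commute x y -> commute x z -> commute x (y * z).
Proof. by rewrite /commute => xy xz; rewrite mulgA xy -mulgA xz mulgA. Qed.

Lemma commuteV x y : commute x y -> commute x y^-1.
Proof.
by rewrite /commute => xy; apply: (mulgI y); apply: (mulIg y); rewrite !mulgA mulgVK mulgV mul1g.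
Qed.

Lemma commute_lcomm x y z : commute x y -> commute x z -> commute x (lcomm y z).
Proof.
by move=> xy xz; apply: commuteM; [apply: commuteM; [apply: commuteM|]|]; rewrite //; apply: commuteV.
Qed.

(* A degenerate form of the Hall-Witt identity. *)
Lemma lcomm_lcomm x y z : commute x z -> commute (lcomm y z) (lcomm x y) ->
  commute (lcomm y z) (lcomm x (lcomm y z)) ->
  lcomm (lcomm x y) z = lcomm x (lcomm y z).
Proof.
move=> xz; set t := lcomm y z; set p := lcomm x y => tp tc.
(* Conjugation by [z] fixes [x] and multiplies [y] by [t^-1]; this gives the conjugate of [p] and so
   [lcomm p z]. *)
have zx : z * x * z^-1 = x by apply/commuteP.
have zy : z * y * z^-1 = t^-1 * y by rewrite /t lcommV /lcomm mulgVK.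
have zp : z * p * z^-1 = lcomm x t^-1 * p.
  rewrite lcomm_conj zx zy lcommMr -/p invgK; congr (_ * _).
  by rewrite -mulgA -tp mulKg.
clearbody t p.
have xt : lcomm x t^-1 = (lcomm x t)^-1.
  have : lcomm x t * (t * lcomm x t^-1 * t^-1) = 1.
    by rewrite -lcommMr mulgV /lcomm mulg1 mulgV mul1g invg1.
  move=> /mulg1_eq e; apply: (mulgI t); apply: (mulIg t^-1).
  by rewrite -e (commuteV tc) mulgK.
have -> : lcomm p z = p * (z * p * z^-1)^-1 by rewrite /lcomm !invgM invgK !mulgA.
by rewrite zp xt invgM invgK mulgA mulgV mul1g.
Qed.

End Commutators.

Section GroupMorphism.
Variables (G H : groupType) (f : {multiplicative G -> H}).

Lemma multf1 : f 1 = 1.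
Proof. by apply: (mulgI (f 1)); rewrite -gmulfM !mulg1. Qed.

Lemma multfV : {morph f : x / x^-1}.
Proof. by move=> x; apply: (mulgI (f x)); rewrite -gmulfM !mulgV multf1. Qed.

End GroupMorphism.

Section CentralKernel.
Variables (H E : groupType) (rho : {multiplicative H -> E}).
Hypothesis rho_central : kernel rho `<=` center H.

Lemma lcomm_central x y x' y' : rho x = rho x' -> rho y = rho y' ->
  lcomm x y = lcomm x' y'.
Proof.
move=> xx' yy'; pose a := x'^-1 * x; pose b := y'^-1 * y.
have ca : forall z, commute a z by apply: rho_central; rewrite /kernel /= gmulfM multfV xx' mulVg.
have cb : forall z, commute b z by apply: rho_central; rewrite /kernel /= gmulfM multfV yy' mulVg.
have xE : x = x' * a by rewrite /a mulVKg.
have yE : y = y' * b by rewrite /b mulVKg.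
clearbody a b; rewrite xE yE /lcomm !invgM !mulgA.
rewrite -(mulgA _ a y') (ca y') !mulgA -(mulgA _ a b) (ca b) !mulgA mulgK.
by rewrite -(mulgA _ b x'^-1) (cb x'^-1) !mulgA mulgK.
Qed.

Lemma lcomm_rho x y : rho (lcomm x y) = lcomm (rho x) (rho y).
Proof. by rewrite /lcomm !gmulfM !multfV. Qed.

(** Conjugation by [g] changes [x] and [y] only by central factors, which a commutator does not
    see. *)
Lemma commute_lift_lcomm g x y : commute (rho g) (rho x) -> commute (rho g) (rho y) ->
  commute g (lcomm x y).
Proof.
move=> gx gy; apply/commuteP; rewrite lcomm_conj; apply: lcomm_central.
  by rewrite !gmulfM multfV; apply/commuteP.
by rewrite !gmulfM multfV; apply/commuteP.
Qed.

Lemma commute_lift_eq g x y : rho x = rho y -> commute g x -> commute g y.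
Proof. by move=> xy /lcomm1P gx; apply/lcomm1P; rewrite -gx; apply: lcomm_central. Qed.

End CentralKernel.

(** The relations for n = 1, in terms of the pairings. The relation for a product in the other order
    is the inverse of [sf_prod]; opposite vectors have pairing 1 and fall under neither commutator
    relation. *)
Record steinberg_family (R : comPzRingType) (T : zmodType) (C : eqType)
    (vec : C -> T) (pr : C -> C -> int) (G : groupType) (x : C -> R -> G) : Prop :=
  SteinbergFamily {
  sf_add : forall v a b, x v a * x v b = x v (a + b)%R;
  sf_prod : forall u v w a b, pr u v = 1%R -> vec w = (vec u + vec v)%R ->
    lcomm (x u a) (x v b) = x w (- (a * b))%R;
  sf_comm : forall u v a b, pr u v <> 1%R -> pr v u <> 1%R ->
    commute (x u a) (x v b)
}.

Section Families.
Variables (R : comPzRingType) (T : zmodType) (S : set T) (C : eqType).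
Variables (vec : C -> T) (pr : C -> C -> int) (ht : C -> T -> nat).
Hypothesis cs : column_axioms S vec pr ht.
Local Notation family := (@steinberg_family R T C vec pr _).
Local Notation splitting := (splitting vec pr).
Implicit Types (u v w d e : C) (a b : R).

Section OneFamily.
Variables (G : groupType) (x : C -> R -> G).
Hypothesis fx : family x.

Lemma sf_0 v : x v 0%R = 1.
Proof. by apply: (mulgI (x v 0%R)); rewrite (sf_add fx) addr0 mulg1. Qed.

Lemma sf_V v a : (x v a)^-1 = x v (- a)%R.
Proof. by apply: (mulgI (x v a)); rewrite mulgV (sf_add fx) subrr sf_0. Qed.

Lemma sf_split w d e a : pr d e = 1%R -> vec w = (vec d + vec e)%R ->
  x w a = lcomm (x d 1%R) (x e (- a)%R).
Proof. by move=> de wE; rewrite (sf_prod fx _ _ de wE) mul1r opprK. Qed.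

End OneFamily.

Section Lift.
Variables (E H : groupType) (ev : C -> R -> E) (rho : {multiplicative H -> E}).
Hypothesis fe : family ev.
Hypothesis rho_central : central_extension rho.
Let ker_center := rho_central.2.

(** Up to a central factor [g] is a commutator of lifts for [d] and [e], where u = d + e, and in E
    both of these commute with the generator for [v]. *)
Lemma lift_commute u v a b g g' : rho g = ev u a -> rho g' = ev v b ->
  pr u v <> 1%R -> pr v u <> 1%R -> commute g' g.
Proof.
move=> gE g'E uv vu.
have [d [d' [dsp vd']]] := fresh_splitting cs u [:: u; v].
have ud0 : pr u d' = 0%R by apply: vd'; rewrite mem_head.
have vd0 : pr v d' = 0%R by apply: vd'; rewrite !inE eqxx orbT.
have [e [_ uE de ze ez]] := splitting_rest cs dsp ud0.
have [y yE] := rho_central.1 (ev d 1%R); have [z zE] := rho_central.1 (ev e (- a)%R).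
apply: (commute_lift_eq ker_center (x := lcomm y z)).
  by rewrite lcomm_rho yE zE gE -(sf_split fe a de uE).
(* Over the facet of [v], if it is also that of [u], the vector [d] has pairing -1 and [e] has 0;
   otherwise [d] has pairing 0. *)
have dv : pr d v <> 1%R /\ (pr u v - pr d v)%R <> 1%R.
  have [vu1|vu1] := pselect (pr v u = -1)%R.
    have -> : pr d v = -1%R by rewrite (same_pr cs d vu1); case: dsp.
    by have -> : pr u v = -1%R by apply: (same_sym cs).
  by rewrite (splitting_transverse cs dsp vd0 vu1) subr0.
apply: (commute_lift_lcomm ker_center); rewrite g'E ?yE ?zE; apply: (sf_comm fe).
- by rewrite (splitting_same cs _ dsp).
- by case: dv.
- by rewrite ze vd0.
- by rewrite ez; case: dv.
Qed.

(** With B a lift for u - d, the left side is [[h, B], g'] and the right side [h, [B, g']], because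
    w - d = (u - d) + v; [lcomm_lcomm] compares them. *)
Lemma lift_lcomm u v w d d' e a b g g' h k : rho g = ev u a -> rho g' = ev v b ->
  rho h = ev d 1%R -> rho k = ev e (a * b)%R ->
  pr u v = 1%R -> vec w = (vec u + vec v)%R -> splitting u d d' ->
  pr u d' = 0%R -> pr v d' = 0%R -> pr w d' = 0%R -> vec w = (vec d + vec e)%R ->
  lcomm g g' = lcomm h k.
Proof.
move=> gE g'E hE kE uv wE dsp ud' vd' wd' wde.
have [wu vu0] := prod_pr cs uv wE.
have du : pr d u = -1%R by case: dsp.
have dv : pr d v = 0%R by apply: (splitting_transverse cs dsp vd'); rewrite vu0.
have dw : pr d w = -1%R by rewrite (same_pr cs d wu).
have [e1 [e1E uE de1 ze1 e1z]] := splitting_rest cs dsp ud'.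
have [e2 [_ wE2 de2 ze2 e2z]] := splitting_rest cs (splitting_trans cs wu dsp) wd'.
have ee2 : e = e2.
  by apply: (cs_inj cs); apply: (addrI (vec d)); rewrite -wde.
rewrite {}ee2 {e wde} in kE.
have e12 : vec e2 = (vec e1 + vec v)%R.
  by apply: (addrI (vec d)); rewrite -wE2 addrA -uE.
have [B BE] := rho_central.1 (ev e1 (- a)%R).
have e1v : pr e1 v = 1%R by rewrite e1z uv dv subr0.
have rD : rho (lcomm B g') = ev e2 (a * b)%R.
  by rewrite lcomm_rho BE g'E (sf_prod fe _ _ e1v e12) mulNr opprK.
have rAB : rho (lcomm h B) = ev u a.
  by rewrite lcomm_rho hE BE -(sf_split fe a de1 uE).
have rAD : rho (lcomm h (lcomm B g')) = ev w (- (a * b))%R.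
  by rewrite lcomm_rho hE rD (sf_prod fe _ _ de2 wE2) mul1r.
transitivity (lcomm (lcomm h B) g').
  by apply: (lcomm_central ker_center); rewrite ?rAB.
transitivity (lcomm h (lcomm B g')); last first.
  by apply: (lcomm_central ker_center); rewrite // rD.
apply: lcomm_lcomm.
- apply: (lift_commute g'E hE); last by rewrite dv.
  by rewrite (splitting_same cs _ dsp) vu0.
- apply: (lift_commute rAB rD); first by rewrite ze2 ud'.
  by rewrite e2z wu du subrr.
- apply: (lift_commute rAD rD); first by rewrite ze2 wd'.
  by rewrite e2z (cs_self cs) dw subrr.
Qed.

Lemma family_lift : exists2 s : C -> R -> H, family s &
  forall v a, rho (s v a) = ev v a.
Proof.
have [h hE] := choice (fun p : C * R => rho_central.1 (ev p.1 p.2)).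
have /choice[sp spP] : forall w, exists q : C * C * C,
    [/\ splitting w q.1.1 q.1.2, pr w q.1.2 = 0%R,
      vec w = (vec q.1.1 + vec q.2)%R, pr q.1.1 q.2 = 1%R &
      pr w q.2 = 0%R /\ pr q.2 w = 0%R].
  move=> w; have [d [d' [dsp vd']]] := fresh_splitting cs w [:: w].
  have wd' : pr w d' = 0%R by apply: vd'; rewrite mem_head.
  have [e [_ wE de ze ez]] := splitting_rest cs dsp wd'.
  have [_ dw] := dsp.
  by exists (d, d', e); split; rewrite //= ze wd' ez (cs_self cs) dw subrr.
pose s w a := lcomm (h ((sp w).1.1, 1%R)) (h ((sp w).2, (- a)%R)).
have rs v a : rho (s v a) = ev v a.
  have [_ _ vE de _] := spP v.
  by rewrite /s lcomm_rho !hE -(sf_split fe a de vE).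
exists s => //; split.
- move=> v a b; have [_ _ vE de [ve ev0]] := spP v.
  have rb := rs v b; rewrite /s in rb *.
  set A := h ((sp v).1.1, _) in rb *; set D1 := h (_, (- a)%R).
  have -> : lcomm A (h ((sp v).2, (- (a + b))%R))
      = lcomm A (D1 * h ((sp v).2, (- b)%R)).
    by apply: (lcomm_central ker_center) => //; rewrite gmulfM !hE (sf_add fe) opprD.
  rewrite lcommMr; congr (_ * _); apply/esym/commuteP.
  by apply: (lift_commute rb (hE (_, _))); rewrite ?ve ?ev0.
- move=> u v w a b uv wE; set sd := sp w.
  have [dwsp wd0 wdE dwe _] := spP w; rewrite -/sd in dwsp wd0 wdE dwe.
  have [wu _] := prod_pr cs uv wE.
  (* The new splitting is fresh also for the stored splitting of [w], so that both commutators can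
     be compared with the one for [d] and [e]. *)
  have [d [d' [dsp vd']]] := fresh_splitting cs u [:: u; v; w; sd.1.1; sd.2].
  have ud' : pr u d' = 0%R by apply: vd'; rewrite !inE eqxx.
  have v0 : pr v d' = 0%R by apply: vd'; rewrite !inE eqxx ?orbT.
  have wd' : pr w d' = 0%R by apply: vd'; rewrite !inE eqxx ?orbT.
  have dd' : pr sd.1.1 d' = 0%R by apply: vd'; rewrite !inE eqxx ?orbT.
  have ed' : pr sd.2 d' = 0%R by apply: vd'; rewrite !inE eqxx ?orbT.
  have dsw := splitting_trans cs wu dsp.
  have [e [_ wE2 _ _ _]] := splitting_rest cs dsw wd'.
  have dsd : splitting sd.1.1 d d'.
    by apply: (splitting_trans cs) dsw; case: dwsp.
  transitivity (lcomm (h (d, 1%R)) (h (e, (a * b)%R))).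
    exact: (lift_lcomm (rs u a) (rs v b) (hE (_, _)) (hE (_, _)) uv wE dsp).
  (* The stored splitting exhibits [w] as a product, so the same comparison applies to it. *)
  rewrite /s -/sd opprK; apply: esym.
  have hk : rho (h (e, (a * b)%R)) = ev e (1 * (a * b))%R by rewrite hE mul1r.
  exact: (lift_lcomm (hE (_, _)) (hE (_, _)) (hE (d, 1%R)) hk dwe wdE dsd dd' ed' wd' wE2).
- by move=> u v a b uv vu; apply: (lift_commute (rs v b) (rs u a)).
Qed.

Lemma family_lift_uniq (s t : C -> R -> H) : family s -> family t ->
  (forall v a, rho (s v a) = ev v a) -> (forall v a, rho (t v a) = ev v a) ->
  forall v a, s v a = t v a.
Proof.
move=> fs ft rs rt v a.
have [d [d' [dsp vd']]] := fresh_splitting cs v [:: v].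
have [|e [_ vE de _ _]] := splitting_rest cs dsp; first by apply: vd'; rewrite mem_head.
rewrite (sf_split fs _ de vE) (sf_split ft _ de vE).
by apply: (lcomm_central ker_center); rewrite rs rt.
Qed.

End Lift.

(** * Words in a Steinberg family *)

Section WordsInFamily.
Variables (G : groupType) (x : C -> R -> G).
Hypothesis fx : family x.

Definition fam_word (l : seq (C * R)) : G := foldr (fun p g => x p.1 p.2 * g) 1 l.

Lemma fam_word_cat l1 l2 : fam_word (l1 ++ l2) = fam_word l1 * fam_word l2.
Proof. by elim: l1 => [|p l1 IHl] /=; rewrite ?mul1g // IHl mulgA. Qed.

Lemma fam_word_inv l : exists l', fam_word l' = (fam_word l)^-1.
Proof.
exists (rev [seq (p.1, (- p.2)%R) | p <- l]); elim: l => [|p l IHl] /=; first by rewrite invg1.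
by rewrite rev_cons -cats1 fam_word_cat IHl /= mulg1 invgM (sf_V fx).
Qed.

Section Graded.
Variables (d : C) (ep : int).
Hypothesis ep1 : ep = 1%R \/ ep = (- 1)%R.
Local Notation upper := (fun p : C * R => (ep * pr p.1 d)%R = 1%R).

(** A product of two letters of degree [ep] would have degree [2 * ep], beyond the bound on
    pairings, and opposite letters have opposite degrees. *)
Lemma upper_commute u v a b : upper (u, a) -> upper (v, b) -> commute (x u a) (x v b).
Proof.
move=> /= ud vd; apply: (sf_comm fx) => uv.
  have [uv0|uv0] := pselect (vec u + vec v = 0)%R.
    by have := cs_prN cs d uv0; lia.
  have [w wE _] := cs_prod cs uv uv0.
  by have := cs_prD cs d wE; have := cs_bound cs w d; lia.
have [uv0|uv0] := pselect (vec v + vec u = 0)%R.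
  by have := cs_prN cs d uv0; lia.
have [w wE _] := cs_prod cs uv uv0.
by have := cs_prD cs d wE; have := cs_bound cs w d; lia.
Qed.

(** The commutator is 1 or a letter for v + w, again of degree [ep] since [v] has degree 0. *)
Lemma conj_upper v a w b : pr v d = 0%R -> upper (w, b) ->
  exists l, (forall p, p \in l -> upper p) /\
    x v a * x w b * (x v a)^-1 = fam_word l.
Proof.
move=> /= vd wd.
have vw0 : (vec v + vec w <> 0)%R.
  by move=> vw0; have := cs_prN cs d vw0; lia.
have E1 : x v a * x w b * (x v a)^-1 = lcomm (x v a) (x w b) * x w b.
  by rewrite /lcomm mulgVK.
have [vw|vw] := pselect (pr v w = 1%R).
  have [z zE _] := cs_prod cs vw vw0.
  exists [:: (z, (- (a * b))%R); (w, b)]; split; last first.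
    by rewrite /= mulg1 E1 (sf_prod fx _ _ vw zE).
  have := cs_prD cs d zE; rewrite vd add0r => zd p.
  by rewrite !inE => /orP[] /eqP -> //=; rewrite zd.
have [wv|wv] := pselect (pr w v = 1%R).
  have [|z zE _] := cs_prod cs wv; first by rewrite addrC.
  exists [:: (z, (b * a)%R); (w, b)]; split; last first.
    by rewrite /= mulg1 E1 -lcommV (sf_prod fx _ _ wv zE) (sf_V fx) opprK.
  have := cs_prD cs d zE; rewrite vd addr0 => zd p.
  by rewrite !inE => /orP[] /eqP -> //=; rewrite zd.
exists [:: (w, b)]; split; first by move=> p; rewrite inE => /eqP ->.
by rewrite /= mulg1; apply/commuteP/(sf_comm fx).
Qed.

Lemma conj_upper_word l0 l : (forall p, p \in l0 -> pr p.1 d = 0%R) ->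
  (forall p, p \in l -> upper p) ->
  exists l', (forall p, p \in l' -> upper p) /\
    fam_word l0 * fam_word l * (fam_word l0)^-1 = fam_word l'.
Proof.
elim: l0 => [|[v a] l0 IHl0] l0d ld; first by exists l; rewrite /= mul1g invg1 mulg1.
have [|l1 [l1d l1E]] := IHl0 _ ld; first by move=> p pl; apply: l0d; rewrite inE pl orbT.
have vd : pr v d = 0%R by apply: (l0d (v, a)); rewrite mem_head.
suff [l2 [l2d l2E]] : exists l2, (forall p, p \in l2 -> upper p) /\
    x v a * fam_word l1 * (x v a)^-1 = fam_word l2.
  by exists l2; split=> //; rewrite /= invgM -l2E -l1E !mulgA.
elim: l1 l1d {l1E} => [|[w b] l1 IHl1] l1d.
  by exists [::]; split=> //; rewrite /= mulg1 mulgV.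
have [|l2 [l2d l2E]] := IHl1; first by move=> p pl; apply: l1d; rewrite inE pl orbT.
have [l3 [l3d l3E]] := conj_upper a vd (l1d _ (mem_head _ _)).
exists (l3 ++ l2); split=> [p|]; first by rewrite mem_cat => /orP[/l3d|/l2d].
by rewrite fam_word_cat -l3E -l2E /= !mulgA mulgVK.
Qed.

Lemma upper_word_pick w l : (forall p, p \in l -> upper p) ->
  fam_word l = x w (\sum_(p <- l | p.1 == w) p.2)%R
    * fam_word [seq p <- l | p.1 != w].
Proof.
elim: l => [|[v a] l IHl] ld; first by rewrite big_nil (sf_0 fx) mul1g.
have {}IHl := IHl (fun p pl => ld p (mem_behead (s := _ :: _) pl)).
rewrite big_cons /=; case: eqP => [->|vw] /=; first by rewrite IHl mulgA (sf_add fx).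
have [/hasP[q ql /eqP qw]|] := boolP (has (fun p => p.1 == w) l).
  rewrite IHl !mulgA; congr (_ * _); apply: upper_commute; first exact: (ld _ (mem_head _ _)).
  by rewrite /= -qw; apply: (ld q); rewrite inE ql orbT.
rewrite -all_predC => /allP nw.
rewrite IHl big_seq_cond big1 ?(sf_0 fx) ?mul1g // => p /andP[/nw /= /negP] //.
Qed.

Lemma upper_word_trivial l : (forall p, p \in l -> upper p) ->
  (forall w, \sum_(p <- l | p.1 == w) p.2 = 0)%R -> fam_word l = 1.
Proof.
have [m] := ubnP (size l); elim: m l => // m IHm [|[w a] l] // ltm ld sum0.
rewrite (upper_word_pick w ld) sum0 (sf_0 fx) mul1g; apply: IHm.
- by rewrite /= eqxx /= (leq_ltn_trans _ (ltm : (size l < m)%N)) // size_filter count_size.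
- by move=> p; rewrite mem_filter => /andP[_ /ld].
move=> v; rewrite big_filter_cond; have [->|vw] := eqVneq v w.
  by rewrite big1 // => p /andP[/negPf ->].
rewrite -[RHS](sum0 v); apply: eq_bigl => p.
by case: (eqVneq p.1 v) => [->|_]; rewrite ?vw ?andbF.
Qed.

End Graded.

Section KernelWords.
Variables (E : groupType) (pi : {multiplicative G -> E}).
Hypothesis pi_act : forall l, pi (fam_word l) = 1 ->
  forall s, S s -> elem_word vec ht l (mon R s) = mon R s.

Lemma kernel_commute_upper d ep l0 w a : (ep = 1 \/ ep = - 1)%R ->
  (forall p, p \in l0 -> pr p.1 d = 0%R) -> (ep * pr w d = 1)%R ->
  pi (fam_word l0) = 1 -> commute (fam_word l0) (x w a).
Proof.
move=> ep1 l0d wd pi0.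
have [|l [ld lE]] := @conj_upper_word d ep ep1 l0 [:: (w, a)] l0d.
  by move=> p; rewrite inE => /eqP ->.
rewrite /= mulg1 in lE.
(* The conjugated letter times the inverse of the letter acts trivially, so its exponent sums vanish
   and it is 1 already in [G]. *)
have : fam_word (l ++ [:: (w, (- a)%R)]) = 1.
  have ld' p : p \in l ++ [:: (w, (- a)%R)] -> (ep * pr p.1 d = 1)%R.
    by rewrite mem_cat inE => /orP[/ld|/eqP ->].
  apply: (upper_word_trivial (ep := ep) (d := d)) => // v.
  apply: (elem_word_inj cs ep1 v ld').
  apply: pi_act; rewrite fam_word_cat -lE /= mulg1 !gmulfM !multfV pi0 -(sf_V fx) multfV.
  by rewrite invg1 mul1g mulg1 mulgV.
rewrite fam_word_cat -lE /= mulg1 -(sf_V fx) => e; apply/commuteP.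
by apply: (mulIg (x w a)^-1); rewrite e mulgV.
Qed.

Lemma kernel_commute l0 v a : pi (fam_word l0) = 1 -> commute (fam_word l0) (x v a).
Proof.
move=> pi0; have [d [d' [dsp vd']]] := fresh_splitting cs v (v :: [seq p.1 | p <- l0]).
have l0d p : p \in l0 -> pr p.1 d' = 0%R.
  by move=> pl; apply: vd'; rewrite inE map_f ?orbT.
have [|e [_ vE de ze _]] := splitting_rest cs dsp; first by apply: vd'; rewrite mem_head.
have [dd' _] := dsp.
rewrite (sf_split fx _ de vE); apply: commute_lcomm.
  by apply: (kernel_commute_upper (d := d') (ep := 1%R)) => //; [left|rewrite (pr_opp cs dd')].
apply: (kernel_commute_upper (d := d') (ep := (- 1)%R)) => //; first by right.
by rewrite -ze (cs_self cs).
Qed.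

End KernelWords.

End WordsInFamily.

End Families.
Local Close Scope group_scope.

(** * The stable Steinberg group of a balanced polytope *)

Section StableGroups.
Variables (Rr : realType) (R : comPzRingType) (n : nat) (P : set 'rV[Rr]_n).
Variable PP : doubling_spectrum P.
Hypothesis goodP : good_polytope P.
Hypothesis balP : col_balanced (latpts P).
Local Notation lat := (nat -> int).
Local Notation C := (Col_stable PP).
Local Notation GA := (monoid_alg R (lat * int)%type).
Local Notation SA := (stable_alg PP R).
Local Notation vec := (@col_vec Rr n P PP).
Local Notation pr := (@stable_pr Rr n P PP).
Local Notation hgt := (fun (v : C) t => `|stable_ht PP v t|%N).
Local Notation S := (stable_S PP).
Local Notation inSA := (@in_stable_alg Rr n P PP R).
Local Notation sform i := (@stage_form Rr n P PP i).
Local Notation el := (elem (R := R) vec hgt).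
Let cs : column_axioms S vec pr hgt := stable_column_axioms PP goodP balP.
Implicit Types (u v w : C) (lam mu : R).

Lemma in_stable_algP (a : GA) : a \in inSA <-> spanned S a.
Proof.
split=> [/asboolP[i ai] m am|]; first by exists i; apply: ai.
move=> Sa; apply/asboolP; move: a Sa.
apply: spanned_ind => [|a b [i ai] [j bj]|c t [i it]].
- by exists 0%N; apply: (@spanned0 R _ (stageSP PP 0)).
- exists (maxn i j); apply: (@spannedD R _ (stageSP PP (maxn i j))).
    exact: stage_alg_le (leq_maxl i j) _ ai.
  exact: stage_alg_le (leq_maxr i j) _ bj.
by exists i; apply: (@spannedZ R _ (stageSP PP i)); apply: spanned_mon.
Qed.

Lemma stable_alg_span (a : SA) : spanned S (val a).
Proof. exact/in_stable_algP/valP. Qed.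

Lemma elem_alg_subproof v lam (a : SA) : el v lam (val a) \in inSA.
Proof. exact/in_stable_algP/(elem_S cs)/stable_alg_span. Qed.

Definition elem_alg v lam (a : SA) : SA := StableAlg (elem_alg_subproof v lam a).

Lemma elem_alg_aut v lam : `[< is_alg_aut (elem_alg v lam) >].
Proof.
have elK mu1 mu2 : mu1 + mu2 = 0 -> cancel (elem_alg v mu1) (elem_alg v mu2).
  move=> mu0 a; apply: val_inj; have Sa := @stable_alg_span a.
  by rewrite [LHS](elem_add cs v mu2 mu1 Sa) addrC mu0 (elem0 _ _ _ Sa).
apply/asboolP; split.
- by exists (elem_alg v (- lam)); apply: elK; rewrite ?subrr ?addNr.
- by move=> a b; apply: val_inj; apply: (linearD (el v lam)).
- move=> a b; apply: val_inj.
  exact: (elemM cs v lam (@stable_alg_span a) (@stable_alg_span b)).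
- by apply: val_inj; rewrite [LHS](elem1 cs v lam).
move=> c a; apply: val_inj.
have elZ : el v lam (c *: val a) = c *: el v lam (val a) by rewrite linearZ.
exact: elZ.
Qed.

Definition elem_aut v lam : alg_aut PP R := AlgAut (elem_alg_aut v lam).

Lemma val_elem_aut v lam a : val (elem_aut v lam a) = el v lam (val a).
Proof. by []. Qed.

Lemma elem_aut_elementary v lam : is_elementary v lam (elem_aut v lam).
Proof.
have [i0 [f0 [b cf0]]] := col_stage goodP balP v.
exists i0 => i le_i x a Ax aE; rewrite val_elem_aut aE elem_mon.
have [f cf _] := stage_form_le goodP balP le_i cf0.
rewrite (stable_htE goodP balP cf); last exact: supp_le_pad.
rewrite (htE (good_stage PP goodP balP i).1 x cf.2) /= padK mul1r.
by [].
Qed.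

(** The algebra is generated by the monomials of lattice points, where [is_elementary] prescribes
    the values from some stage on. This identifies the generators of [stable_E], given by a
    property, with the [elem_aut]. *)
Lemma elementary_uniq v lam (phi psi : alg_aut PP R) :
  is_elementary v lam phi -> is_elementary v lam psi -> phi = psi.
Proof.
move=> [i1 phiE] [i2 psiE].
have /asboolP[_ phiD phiM phi1 phiZ] := alg_autP phi.
have /asboolP[_ psiD psiM psi1 psiZ] := alg_autP psi.
pose K (b : GA) := exists2 a : SA, val a = b & phi a = psi a.
have KM b c : K b -> K c -> K (b * c).
  by move=> [a <- aE] [a' <- a'E]; exists (a * a'); rewrite // phiM psiM aE a'E.
have KZ k b : K b -> K (k *: b).
  by move=> [a <- aE]; exists (k *: a); rewrite // phiZ psiZ aE.
have Kmon t : S t -> K (mon R t).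
  move=> /stable_S_stage[i3 it].
  have /stageSP_seq[s sA ->] := it _ (leq_trans (leq_maxr i2 i3) (leq_maxr i1 _)).
  set i := maxn _ _ in s sA *.
  have le1 : (i1 <= i)%N by rewrite leq_maxl.
  have le2 : (i2 <= i)%N by rewrite (leq_trans (leq_maxl i2 i3)) ?leq_maxr.
  elim: s sA => [|z s IHs] sA.
    by rewrite big_nil mon0; exists 1; rewrite // phi1 psi1.
  rewrite big_cons monD; apply: KM; last first.
    by apply: IHs => y ys; apply: sA; rewrite inE ys orbT.
  have Az : latpts (PP i) z by apply: sA; rewrite mem_head.
  have aS : mon R (pad z, 1 : int) \in inSA.
    apply/in_stable_algP; apply: spanned_mon; exists i; apply/stageSP_seq.
    by exists [:: z] => [y|]; rewrite ?big_seq1 // inE => /eqP ->.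
  exists (StableAlg aS) => //; apply: val_inj.
  by rewrite (phiE i le1 z (StableAlg aS) Az erefl) (psiE i le2 z (StableAlg aS) Az erefl).
apply: alg_aut_ext => a.
suff [b /val_inj -> //] : K (val a).
move: (val a) (@stable_alg_span a); apply: spanned_ind.
- exists ((0 : R) *: (1 : SA)); last by rewrite phiZ psiZ phi1 psi1.
  by rewrite scale0r.
- by move=> b c [a1 <- E1] [a2 <- E2]; exists (a1 + a2); rewrite // phiD psiD E1 E2.
by move=> c t St; apply: KZ; apply: Kmon.
Qed.

Local Open Scope group_scope.

Lemma lcomm_eq (G : groupType) (x y z : G) : x * y = z * (y * x) -> lcomm x y = z.
Proof. by move=> e; rewrite /lcomm e mulgA !mulgK. Qed.

Lemma elem_aut_family : steinberg_family vec pr elem_aut.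
Proof.
split.
- move=> v a b; apply: alg_aut_ext => c; apply: val_inj.
  exact: (elem_add cs v a b (@stable_alg_span c)).
- move=> u v w a b uv wE; apply: lcomm_eq; apply: alg_aut_ext => c; apply: val_inj.
  apply: (elem_prod cs a b (@stable_alg_span c) uv _ wE).
  by rewrite -wE; apply: (vec_neq0 cs).
move=> u v a b uv vu; apply: alg_aut_ext => c; apply: val_inj.
exact: (elem_comm cs a b (@stable_alg_span c) uv vu).
Qed.

Lemma elem_aut_gen v lam : elem_aut v lam \in in_gen
  [set phi : alg_aut PP R | exists v lam, is_elementary v lam phi].
Proof.
apply/asboolP => H _; apply; exists v, lam; exact: elem_aut_elementary.
Qed.

Definition elem_E v lam : stable_E PP R := GenSubgroup (elem_aut_gen v lam).

Lemma elem_E_family : steinberg_family vec pr elem_E.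
Proof.
have [fA fP fC] := elem_aut_family.
split.
- by move=> v a b; apply: val_inj; apply: fA.
- by move=> u v w a b uv wE; apply: val_inj; apply: fP.
by move=> u v a b uv vu; apply: val_inj; apply: fC.
Qed.

Local Close Scope group_scope.

(** With pairing 1 a step by [u] always ends off the facet of [v]. With pairing -1 the facets agree
    and a point of height 1 lands on them; with pairing 0 a point on the facet of [v] but off that
    of [u] stays on the former. *)
Lemma stable_prod_existsP u v : (u : lat) + v <> 0 ->
  stable_prod_exists u v <-> pr u v = 1.
Proof.
move=> uv0; have [|i1 [iuv _]] := @common_stage _ _ _ _ goodP balP [:: u; v] [::].
  by [].
have [g1 [c cg1]] : exists g c, sform i1 u g c by apply: iuv; rewrite !inE eqxx.
have [f1 [b cf1]] : exists g c, sform i1 v g c by apply: iuv; rewrite !inE eqxx orbT.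
split=> [[i0 ex]|uv].
  pose i := maxn i0 i1.
  have [g cg _] := stage_form_le goodP balP (leq_maxr i0 i1) cg1.
  have [f cf _] := stage_form_le goodP balP (leq_maxr i0 i1) cf1.
  have [gi _] := good_stage PP goodP balP i.
  have [_ noface] := ex i (leq_maxl i0 i1).
  have uvE := stable_prE goodP balP cf cg.1.
  rewrite -/i in cg cf uvE.
  have {}noface z : latpts (PP i) z -> c < lform g z -> lform f z + pr u v <> b.
    move=> Az gz fz; have Azu := col_form_step cg.2 Az gz.
    apply: (noface z Az).
      rewrite (base_facetE gi cg.2) => /base_face_latpt[_ gz'].
      by rewrite gz' ltxx in gz.
    rewrite (base_facetE gi cf.2); apply/base_face_latpt; split=> //.
    by rewrite lformD -uvE.
  have := cs_bound cs u v; suff : pr u v <> -1 /\ pr u v <> 0 by lia.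
  split=> pruv.
    have [gf cb] := stable_same goodP balP pruv cg cf.
    have [z Az fz] := affgen_height1 (good_affgen gi) cg.2.
    rewrite gf cb in fz noface.
    by apply: (noface z Az); rewrite fz ?pruv; lia.
  have [[gf _]|[z [Az fz gz]]] := col_form_dichotomy (good_affgen gi) cg.2 cf.2.
    by move: uvE; rewrite -gf (col_form_self cg.2) pruv.
  by apply: (noface z Az gz); rewrite pruv addr0.
exists i1 => i le_i.
have [g cg _] := stage_form_le goodP balP le_i cg1.
have [f cf _] := stage_form_le goodP balP le_i cf1.
have [gi _] := good_stage PP goodP balP i.
split=> [uv0'|z Az _].
  by apply: uv0; rewrite -cg.1 -cf.1 -padD uv0' pad0.
rewrite (base_facetE gi cf.2) => /base_face_latpt[_].
rewrite lformD -(stable_prE goodP balP cf cg.1) uv.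
by have := col_form_ge cf.2 Az; lia.
Qed.

Lemma stable_formP u v N : stable_form v u N <-> pr u v = N%:Z.
Proof.
split=> [form|uv i v' u' cv cu vE uE].
  have [i [f [g [b [c [cg cf ->]]]]]] := pr_stage goodP balP u v.
  have [gi _] := good_stage PP goodP balP i.
  rewrite -(facet_formE gi (restr (i + n) u) cf.2).
  apply: form; [| |exact: cf.1|exact: cg.1].
    by apply/(ColP gi); exists f, b; apply: cf.2.
  by apply/(ColP gi); exists g, c; apply: cg.2.
have [gi _] := good_stage PP goodP balP i.
have [f [b cf]] := (ColP gi v').1 cv.
rewrite (facet_formE gi u' cf) -uv.
have sf : sform i v f b.
  by rewrite -vE; split; [exact: supp_le_pad|rewrite padK].
by rewrite (stable_prE goodP balP sf) -uE ?padK //; apply: supp_le_pad.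
Qed.

Lemma vec_sum u v w : (w : lat) = (u : lat) + v -> vec w = vec u + vec v.
Proof. by move=> wE; congr (_, _); rewrite /= ?wE ?addr0. Qed.

Lemma vec_sumE u v w : vec w = vec u + vec v -> (w : lat) = (u : lat) + v.
Proof. by move=> /(congr1 fst). Qed.

Lemma vec_sum0 u v : vec u + vec v = 0 <-> (u : lat) + v = 0.
Proof.
by split=> [/(congr1 fst) //|uv]; congr (_, _).
Qed.

Lemma Tprod1 (F : nat -> gterm (C * R)) : Tprod 1 F = Tmul (F 1%N) Tone.
Proof. by rewrite /Tprod big_ltn // big_geq. Qed.

Local Open Scope group_scope.

Lemma st_gen_family : steinberg_family vec pr (@st_gen Rr n P PP R).
Proof.
split.
- by move=> v a b; apply: (pres_rel (St_add v a b)).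
- move=> u v w a b uv wE.
  have uv0 : ((u : lat) + v <> 0)%R.
    by move=> /vec_sum0; rewrite -wE; apply: (vec_neq0 cs).
  have wN i : (1 <= i <= 1)%N -> ((w : lat) = (u : lat) + (v : lat) *+ i :> lat)%R.
    rewrite -eqn_leq => /eqP <-; rewrite mulr1n; exact: vec_sumE.
  have := pres_rel (St_prod a b uv0 ((stable_prod_existsP uv0).2 uv)
    ((stable_formP u v 1).2 uv) (w := fun=> w) wN).
  rewrite Tprod1 /= mulg1 binn mul1r expr1 => rel; exact: rel.
move=> u v a b uv vu; apply/lcomm1P; apply: (pres_rel (St_comm a b _ _)).
  by move=> /vec_sum0 /(pr_opp cs).
(* If the sum were a column vector, one of the two pairings would be 1. *)
move=> cw; have := @sum_pr _ _ _ _ _ _ cs (ColStable cw) u v (vec_sum (w := ColStable cw) erefl).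
by case.
Qed.

Lemma family_rel (G : groupType) (x : C -> R -> G) : steinberg_family vec pr x ->
  forall s t, steinberg_rel (s : gterm (C * R)) t ->
  gterm_eval (fun p => x p.1 p.2) s = gterm_eval (fun p => x p.1 p.2) t.
Proof.
move=> fx s t [v a b|u v a b N w uv0 ex form wE|u v a b N w uv0 ex form wE|u v a b uv0 ncol] /=.
- exact: (sf_add fx).
- have uv := (stable_prod_existsP uv0).1 ex.
  have N1 : N = 1%N by have := (stable_formP u v N).1 form; rewrite uv; lia.
  have w1 := wE 1%N; rewrite N1 mulr1n in w1.
  rewrite N1 Tprod1 /= mulg1 binn mul1r expr1.
  exact: (sf_prod fx a b uv (vec_sum (w1 isT))).
- have vu0 : ((v : lat) + u <> 0)%R by rewrite addrC.
  have vu := (stable_prod_existsP vu0).1 ex.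
  have N1 : N = 1%N by have := (stable_formP v u N).1 form; rewrite vu; lia.
  have w1 := wE 1%N; rewrite N1 mulr1n in w1.
  rewrite N1 Tprod1 /= mulg1 binn mul1r expr1 -/(lcomm _ _) -lcommV.
  by rewrite (sf_prod fx b a vu (vec_sum (w1 isT))) (sf_V fx) opprK.
apply/lcomm1P/(sf_comm fx) => pruv; apply: ncol.
  have [|w /vec_sumE <- _] := cs_prod cs pruv; first by move=> /vec_sum0.
  exact: col_valP.
have [|w /vec_sumE wE _] := cs_prod cs pruv; first by move=> /vec_sum0; rewrite addrC.
by rewrite addrC -wE; apply: col_valP.
Qed.

Lemma St_word (g : stable_St PP R) : exists l, g = fam_word (@st_gen Rr n P PP R) l.
Proof.
elim/pres_ind: g => s; rewrite -gterm_eval_pres; elim: s => /= [[v a]||s [l1 ->] t [l2 ->]|s [l ->]].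
- by exists [:: (v, a)]; rewrite /= mulg1.
- by exists [::].
- by exists (l1 ++ l2); rewrite fam_word_cat.
by have [l' <-] := fam_word_inv st_gen_family l; exists l'.
Qed.

Lemma mult_fam_word (G H : groupType) (f : {multiplicative G -> H}) (x : C -> R -> G) l :
  f (fam_word x l) = fam_word (fun v a => f (x v a)) l.
Proof. by elim: l => [|p l IHl] /=; rewrite ?multf1 // gmulfM IHl. Qed.

Lemma fam_word_ext (G : groupType) (x y : C -> R -> G) l :
  (forall v a, x v a = y v a) -> fam_word x l = fam_word y l.
Proof. by move=> xy; elim: l => //= p l ->; rewrite xy. Qed.

Lemma lift_family (G : groupType) (x : C -> R -> G) : steinberg_family vec pr x ->
  exists f : {multiplicative stable_St PP R -> G}, forall v a, f (st_gen v a) = x v a.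
Proof.
move=> fx; have [f fE] := pres_lift (family_rel fx).
by exists f => v a; rewrite /st_gen fE.
Qed.

Lemma mult_family (G H : groupType) (f : {multiplicative G -> H}) (x : C -> R -> G) :
  steinberg_family vec pr x -> steinberg_family vec pr (fun v a => f (x v a)).
Proof.
move=> [fA fP fC]; split.
- by move=> v a b; rewrite -gmulfM fA.
- by move=> u v w a b uv wE; rewrite -lcomm_rho (fP _ _ _ _ _ uv wE).
by move=> u v a b uv vu; apply: gmulf_commute; apply: fC.
Qed.

Section Projection.
Variable pi : {multiplicative stable_St PP R -> stable_E PP R}.
Hypothesis piE : forall v a, pi (st_gen v a) = elem_E v a.
Local Notation word := (fam_word (@st_gen Rr n P PP R)).

Lemma pi_word_act l (a : SA) :
  val (gen_val (pi (word l)) a) = elem_word vec hgt l (val a).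
Proof.
elim: l => [|p l IHl] /=; first by rewrite multf1.
by rewrite gmulfM piE -IHl.
Qed.

Lemma pi_word_trivial l : pi (word l) = 1 ->
  forall s, S s -> elem_word vec hgt l (mon R s) = mon R s.
Proof.
move=> pil s Ss.
have aS : mon R s \in inSA by apply/in_stable_algP; apply: spanned_mon.
by have := pi_word_act l (StableAlg aS); rewrite pil /= => <-.
Qed.

Lemma pi_kernel_center : kernel pi `<=` center (stable_St PP R).
Proof.
move=> g; have [l ->] := St_word g => pil h; have [l' ->] := St_word h.
elim: l' => [|p l' IHl] /=; first by rewrite /commute mulg1 mul1g.
apply: commuteM => //; apply: (kernel_commute cs st_gen_family pi_word_trivial).
exact: pil.
Qed.

Lemma pi_center_kernel : center (stable_St PP R) `<=` kernel pi.
Proof.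
move=> g; have [l ->] := St_word g => lZ.
have triv s : S s -> elem_word vec hgt l (mon R s) = mon R s.
  move=> Ss; apply: (central_word cs) => // v a Sa.
  have aS : a \in inSA by apply/in_stable_algP.
  have := congr1 (fun x => val (gen_val (pi x) (StableAlg aS))) (lZ (st_gen v 1%R)).
  rewrite !gmulfM piE => e.
  have eL : val (gen_val (pi (word l) * elem_E v 1%R) (StableAlg aS))
      = elem_word vec hgt l (el v 1 a).
    exact: (pi_word_act l (elem_aut v 1%R (StableAlg aS))).
  rewrite -eL e; exact: (congr1 (el v 1) (pi_word_act l (StableAlg aS))).
apply: val_inj; apply: alg_aut_ext => a; apply: val_inj.
rewrite [LHS]pi_word_act.
exact: (eq_on_mon (f := elem_word vec hgt l) (g := idfun) triv (@stable_alg_span a)).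
Qed.

Lemma pi_surj e : exists g, pi g = e.
Proof.
(* The image of [pi] is a subgroup containing all elementary automorphisms, hence everything they
   generate. *)
have /asboolP /(_ [set phi | exists g, gen_val (pi g) = phi]) := gen_valP e.
case.
- split; first by exists 1; rewrite multf1.
    by move=> _ _ [g <-] [h <-]; exists (g * h); rewrite gmulfM.
  by move=> _ [g <-]; exists g^-1; rewrite multfV.
- move=> phi [v [lam ephi]]; exists (st_gen v lam); rewrite piE.
  exact: elementary_uniq (elem_aut_elementary v lam) ephi.
by move=> g ge; exists g; apply: val_inj.
Qed.

Lemma pi_universal : universal_central_extension pi.
Proof.
split; first by split; [exact: pi_surj|exact: pi_kernel_center].
move=> H rho rhoC; have [s fs sE] := family_lift cs elem_E_family rhoC.
have [f fE] := lift_family fs; exists f => [g|f' f'E g]; have [l ->] := St_word g.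
  rewrite !mult_fam_word; apply: fam_word_ext => v a.
  by rewrite fE sE piE.
rewrite !mult_fam_word; apply: fam_word_ext => v a.
rewrite fE; have ff := mult_family f' st_gen_family.
have f'sE u b : rho (f' (st_gen u b)) = elem_E u b by rewrite f'E piE.
exact: (family_lift_uniq cs rhoC ff fs f'sE sE).
Qed.

End Projection.

End StableGroups.

Lemma balanced_col_balanced (Rr : realType) n (P : set 'rV[Rr]_n) :
  good_polytope P -> balanced P -> col_balanced (latpts P).
Proof.
move=> gP bal u v g f c b cg cf; rewrite -(facet_formE gP u cf).
by apply: bal; apply/(ColP gP); [exists f, b|exists g, c].
Qed.

Theorem theorem8p4 (Rr : realType) (R : comPzRingType)
    (n : nat) (P : set 'rV[Rr]_n) (PP : doubling_spectrum P) :
  full_lattice_polytope P -> (exists v, Col P v) -> balanced P ->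
  exists pi : {multiplicative stable_St PP R -> stable_E PP R},
    [/\ forall (v : Col_stable PP) (lam : R),
          is_elementary v lam (gen_val (pi (st_gen v lam))),
        universal_central_extension pi
      & kernel pi = center (stable_St PP R)].
Proof.
move=> [latP _ affP] _ balP.
have gP : good_polytope P by split=> //; apply: affgen_aff_hull.
have bP := balanced_col_balanced gP balP.
have [pi piE] := lift_family gP bP (elem_E_family R PP gP bP).
exists pi; split.
- by move=> v lam; rewrite piE; apply: elem_aut_elementary.
- exact: pi_universal piE.
by apply/seteqP; split; [exact: pi_kernel_center piE|exact: pi_center_kernel piE].
Qed.
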